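(* Let $0<q<1$, let $a_+,a_-,b_+,b_-\in\mathbb{N}_0=\{0,1,2,\ldots\}$, and define nonnegative integers $n^+_+,n^+_-,n^-_+,n^-_-$ by $$n^+_\pm=a_\pm+b_\pm,\qquad n^-_\pm=\begin{cases}a_\pm-b_\pm&\text{if } a_\pm\ge b_\pm,\\ b_\pm-a_\pm-1&\text{if } a_\pm<b_\pm.\end{cases}$$ Let $\mathbf{A}(\hat x)$, $\mathbf{B}(x)$, $\mathbf{C}$ be the matrices defined in the context for these $n^\pm_\pm$. Let $\hat x\in i\mathbb{R}$ and let $x\in\mathbb{R}$ be generic in the sense that $\det[\mathbf{1}+\mathbf{B}(x)\mathbf{C}]\ne 0$. Then the Askey-Wilson function $\psi$ satisfies $$\psi\bigl(q^x,q^{\hat x};\,q^{a_-+1},-q^{a_++1},q^{b_-+1/2},-q^{b_++1/2}\mid q\bigr)=q^{x\hat x}\,\frac{\det[\mathbf{1}+\mathbf{A}(\hat x)\mathbf{B}(x)\mathbf{C}]}{\det[\mathbf{1}+\mathbf{B}(x)\mathbf{C}]}.$$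
   Context: Conventions: empty sums are $0$, empty products (and empty determinants) are $1$. $\mathbf 1$ is the identity matrix. $(a;q)_k=\prod_{n=0}^{k-1}(1-aq^n)$, $(a;q)_\infty=\prod_{n\ge0}(1-aq^n)$, $(a_1,\ldots,a_r;q)_k=\prod_i(a_i;q)_k$. ${}_{r+1}\Phi_r\left[\begin{array}{c}a_1,\ldots,a_{r+1}\\ b_1,\ldots,b_r\end{array}\mid q;z\right]=\sum_{k\ge0}\frac{(a_1,\ldots,a_{r+1};q)_k}{(q,b_1,\ldots,b_r;q)_k}z^k$, and ${}_8W_7(a_0;a_1,\ldots,a_5\mid q;z)=\sum_{k\ge0}\frac{1-a_0q^{2k}}{1-a_0}\frac{(a_0,a_1,\ldots,a_5;q)_k}{(q,qa_0/a_1,\ldots,qa_0/a_5;q)_k}z^k$. Askey-Wilson function. For real parameters $a,b,c,d$ with $abcd>0$ put $\hat a=\sqrt{q^{-1}abcd}$, $\hat b=ab/\hat a$, $\hat c=ac/\hat a$, $\hat d=ad/\hat a$. For generic $z=q^x,\hat z=q^{\hat x}$ with $|\hat a\hat z|<1$, $$\psi(z,\hat z;a,b,c,d\mid q)=q^{x\hat x}\frac{(\hat a\hat z,qaz\hat z/\hat a,qbz\hat z/\hat a,qcz\hat z/\hat a,qdz\hat z/\hat a;q)_\infty}{(q\hat z^2,q^2z^2\hat z/\hat a;q)_\infty}\,{}_8W_7\bigl(qz^2\hat z/\hat a;\,qz/a,qz/b,qz/c,qz/d,q\hat z/\hat a\mid q;\hat a\hat z\bigr)$$ (here $q^{x\hat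 x}=q^{\log_q(z)\log_q(\hat z)}$ with $\log_q z=x$, $\log_q\hat z=\hat x$). It extends to $q^{x\hat x}$ times a meromorphic function of $z,\hat z$ (and at points where a formula is singular but the singularity is removable, the value is understood by this extension), given by $$\psi=q^{x\hat x}\frac{(az,bz,\hat a\hat z,\hat b\hat z,qcz\hat z/\hat a,qdz\hat z/\hat a;q)_\infty}{(qz^2,q\hat z^2,ab/q;q)_\infty}{}_4\Phi_3\left[\begin{array}{c}qz/a,qz/b,q\hat z/\hat a,q\hat z/\hat b\\ q^2/ab,qcz\hat z/\hat a,qdz\hat z/\hat a\end{array}\mid q;q\right]$$ $$+\,q^{x\hat x}\frac{(qz/a,qz/b,q\hat z/\hat a,q\hat z/\hat b,q\hat az\hat z/c,q\hat az\hat z/d;q)_\infty}{(qz^2,q\hat z^2,q/ab;q)_\infty}{}_4\Phi_3\left[\begin{array}{c}az,bz,\hat a\hat z,\hat b\hat z\\ ab,q\hat az\hat z/c,q\hat az\hat z/d\end{array}\mid q;q\right].$$ Index sets and signs. Given nonnegative integers $n^+_+,n^+_-,n^-_+,n^-_-$, for each choice of superscript sign let $I^\pm=\{1,2,\ldots,|n^\pm_+-n^\pm_-|,\,|n^\pm_+-n^\pm_-|+2,\,|n^\pm_+-n^\pm_-|+4,\ldots,n^\pm_++n^\pm_-\}$. For $j\in I^\pm$ let $\eta^\pm_j=j$ if $j\le|n^\pm_+-n^\pm_-|$ and $\eta^\pm_j=(j+|n^\pm_+-n^\pm_-|)/2$ if $j>|n^\pm_+-n^\pm_-|$ (the position of $j$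 in $I^\pm$), and let $\epsilon^\pm_j=(-1)^{\eta^\pm_j+j}$ if $n^\pm_+\ge n^\pm_-$, $\epsilon^\pm_j=(-1)^{\eta^\pm_j}$ if $n^\pm_+<n^\pm_-$. Matrices (block form, rows and columns labelled by $I^+$ followed by $I^-$). $\mathbf{A}(\hat x)=\mathrm{diag}(\mathbf{A}^+,\mathbf{A}^-)$ with $\mathbf{A}^+=\mathrm{diag}\Bigl[\frac{1-q^{\hat x-j/2}}{1-q^{\hat x+j/2}}\Bigr]_{j\in I^+}$, $\mathbf{A}^-=\mathrm{diag}\Bigl[\frac{1+q^{\hat x-j/2}}{1+q^{\hat x+j/2}}\Bigr]_{j\in I^-}$. $\mathbf{B}(x)=\mathrm{diag}(\mathbf{B}^+,\mathbf{B}^-)$ with $$\mathbf{B}^+=\mathrm{diag}\Bigl[\epsilon^+_jq^{j(x+1/2)}(1-q^j)\prod_{k\in I^+,k\ne j}\Bigl|\tfrac{1-q^{(j+k)/2}}{q^{j/2}-q^{k/2}}\Bigr|\prod_{k\in I^-}\tfrac{1+q^{(j+k)/2}}{q^{j/2}+q^{k/2}}\Bigr]_{j\in I^+},$$ $$\mathbf{B}^-=\mathrm{diag}\Bigl[\epsilon^-_jq^{j(x+1/2)}(1-q^j)\prod_{k\in I^+}\tfrac{1+q^{(j+k)/2}}{q^{j/2}+q^{k/2}}\prod_{k\in I^-,k\ne j}\Bigl|\tfrac{1-q^{(j+k)/2}}{q^{j/2}-q^{k/2}}\Bigr|\Bigr]_{j\in I^-}.$$ $\mathbf{C}$ has $(j,k)$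 entry $(1-q^{(j+k)/2})^{-1}$ if $j,k$ both label $I^+$ or both label $I^-$, and $(1+q^{(j+k)/2})^{-1}$ if one labels $I^+$ and the other $I^-$. *)

(* Defs.v *)
From HB Require Import structures.
From mathcomp Require Import all_boot all_order all_algebra.
From mathcomp Require Import complex.
From mathcomp Require Import all_classical all_reals all_analysis.

Set Implicit Arguments.
Unset Strict Implicit.
Unset Printing Implicit Defensive.

Import Order.TTheory GRing.Theory Num.Theory.
Import numFieldNormedType.Exports.

Local Open Scope classical_set_scope.
Local Open Scope ring_scope.
Local Open Scope complex_scope.

(* The topology on R[i] is the one MathComp-Analysis puts on every
   numFieldType; it is found only when R[i] is seen as a numFieldType. *)
Notation Cplx R := (Num.NumField.sort (R[i] : numFieldType)).

Definition cexp (R : realType) (w : R[i]) : Cplx R :=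
  (expR (complex.Re w))%:C * (cos (complex.Im w) +i* sin (complex.Im w)).

Definition qpow (R : realType) (q : R) (w : R[i]) : Cplx R :=
  cexp (w * (ln q)%:C).

Definition qpoch (R : realType) (q : R) (u : Cplx R) (k : nat) : Cplx R :=
  \prod_(n < k) (1 - u * q%:C ^+ n).

Definition qpochs (R : realType) (q : R) (us : seq (Cplx R)) (k : nat)
  : Cplx R := \prod_(u <- us) qpoch q u k.

Definition qpochoo (R : realType) (q : R) (u : Cplx R) : Cplx R :=
  limn (qpoch q u).

Definition qpochsoo (R : realType) (q : R) (us : seq (Cplx R)) : Cplx R :=
  \prod_(u <- us) qpochoo q u.

Definition W87 (R : realType) (q : R) (a0 a1 a2 a3 a4 a5 z : Cplx R)
  : Cplx R :=
  let us := [:: a1; a2; a3; a4; a5] in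
  limn (series (fun k : nat =>
    (1 - a0 * q%:C ^+ k.*2) / (1 - a0)
    * (qpochs q (a0 :: us) k
       / qpochs q (q%:C :: [seq q%:C * a0 / u | u <- us]) k)
    * z ^+ k)).

Definition hata (R : realType) (q a b c d : R) : R :=
  Num.sqrt (q^-1 * (a * b * c * d)).

(* The function psi (z, zh) is multivalued through q^(x xh), so it is given
   as a function of p = (x, xh), where z = q^x and zh = q^xh. *)
Definition AW_W87 (R : realType) (q a b c d : R) (p : Cplx R * Cplx R)
  : Cplx R :=
  let z := qpow q p.1 in let zh := qpow q p.2 in
  let qC : Cplx R := q%:C in
  let aC : Cplx R := a%:C in let bC : Cplx R := b%:C in
  let cC : Cplx R := c%:C in let dC : Cplx R := d%:C in
  let ah : Cplx R := (hata q a b c d)%:C in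
  qpow q (p.1 * p.2)
  * (qpochsoo q [:: ah * zh; qC * aC * z * zh / ah; qC * bC * z * zh / ah;
                    qC * cC * z * zh / ah; qC * dC * z * zh / ah]
     / qpochsoo q [:: qC * zh ^+ 2; qC ^+ 2 * z ^+ 2 * zh / ah])
  * W87 q (qC * z ^+ 2 * zh / ah)
        (qC * z / aC) (qC * z / bC) (qC * z / cC) (qC * z / dC)
        (qC * zh / ah) (ah * zh).

(* The points where the series converges and no denominator in AW_W87
   vanishes. Writing a0 = q z^2 zh / ah, the parameters u listed below are
   a0 (this covers 1 - a0 and the factor (q a0; q)_oo), q zh^2, and the lower
   parameters q a0 / a_i of the series, the last of which is q z^2. *)
Definition AW_generic (R : realType) (q a b c d : R)
  : set (Cplx R * Cplx R) :=
  [set p |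
    let z := qpow q p.1 in let zh := qpow q p.2 in
    let qC : Cplx R := q%:C in
    let aC : Cplx R := a%:C in let bC : Cplx R := b%:C in
    let cC : Cplx R := c%:C in let dC : Cplx R := d%:C in
    let ah : Cplx R := (hata q a b c d)%:C in
    `|ah * zh| < 1 /\
    forall (u : Cplx R) (n : nat),
      u \in [:: qC * z ^+ 2 * zh / ah; qC * zh ^+ 2;
                qC * aC * z * zh / ah; qC * bC * z * zh / ah;
                qC * cC * z * zh / ah; qC * dC * z * zh / ah; qC * z ^+ 2] ->
      1 - u * qC ^+ n != 0].

Definition AW_punctured (R : realType) (q a b c d : R)
  (p : Cplx R * Cplx R) : set_system (Cplx R * Cplx R) :=
  within (AW_generic q a b c d) (nbhs p).

(* The meromorphic continuation has a value at p. At a nongeneric point this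
   means that the formula has a limit as both variables tend, through generic
   complex points, to p. Only |ah zh| <= 1 is covered, the closure of
   the region where the series converges. *)
Definition AW_regular (R : realType) (q a b c d : R) (x xh : R[i]) : Prop :=
  AW_generic q a b c d (x, xh) \/
  cvg (AW_W87 q a b c d @ AW_punctured q a b c d (x, xh)).

Definition AWpsi (R : realType) (q a b c d : R) (x xh : R[i]) : Cplx R :=
  if `[< AW_generic q a b c d (x, xh) >] then AW_W87 q a b c d (x, xh)
  else lim (AW_W87 q a b c d @ AW_punctured q a b c d (x, xh)).

(* Below, np and nm stand for n^s_+ and n^s_-, for a fixed superscript s. *)

Definition absdiff (np nm : nat) : nat := `|np - nm|%N.

Definition index_seq (np nm : nat) : seq nat :=
  iota 1 (absdiff np nm)
  ++ [seq (absdiff np nm + i.*2)%N | i <- iota 1 (minn np nm)].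

Definition eta (np nm j : nat) : nat :=
  if (j <= absdiff np nm)%N then j else (j + absdiff np nm)./2.

Definition epsj (R : realType) (np nm j : nat) : R :=
  if (nm <= np)%N then (-1) ^+ (eta np nm j + j) else (-1) ^+ eta np nm j.

Definition label_size (npp npm nmp nmm : nat) : nat :=
  size (index_seq npp npm) + size (index_seq nmp nmm).

(* The sign s is 1 for the block A^+ and -1 for the block A^-. *)
Definition Ablock (R : realType) (q : R) (s xh : R[i]) (I : seq nat)
  : 'M[R[i]]_(size I) :=
  diag_mx (\row_(i < size I)
    let j : R := (nth 0%N I i)%:R in
    (1 - s * qpow q (xh - (j / 2)%:C)) / (1 - s * qpow q (xh + (j / 2)%:C))).

Definition Amx (R : realType) (q : R) (npp npm nmp nmm : nat) (xh : R[i])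
  : 'M[R[i]]_(label_size npp npm nmp nmm) :=
  block_mx (Ablock q 1 xh (index_seq npp npm)) 0
           0 (Ablock q (-1) xh (index_seq nmp nmm)).

(* J is the index set with the superscript opposite to that of np and nm. *)
Definition Bblock (R : realType) (q : R) (np nm : nat) (J : seq nat) (x : R)
  : 'M[R]_(size (index_seq np nm)) :=
  let I := index_seq np nm in
  diag_mx (\row_(i < size I)
    let j := nth 0%N I i in
    epsj R np nm j * q `^ (j%:R * (x + 1 / 2)) * (1 - q ^+ j)
    * (\prod_(k <- I | k != j)
         `| (1 - q `^ ((j + k)%:R / 2)) / (q `^ (j%:R / 2) - q `^ (k%:R / 2)) |)
    * (\prod_(k <- J)
         ((1 + q `^ ((j + k)%:R / 2)) / (q `^ (j%:R / 2) + q `^ (k%:R / 2))))).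

Definition Bmx (R : realType) (q : R) (npp npm nmp nmm : nat) (x : R)
  : 'M[R]_(label_size npp npm nmp nmm) :=
  block_mx (Bblock q npp npm (index_seq nmp nmm) x) 0
           0 (Bblock q nmp nmm (index_seq npp npm) x).

(* The sign s is 1 if I and J have the same superscript, and -1 otherwise. *)
Definition Cblock (R : realType) (q s : R) (I J : seq nat)
  : 'M[R]_(size I, size J) :=
  \matrix_(i < size I, k < size J)
    (1 - s * q `^ ((nth 0%N I i + nth 0%N J k)%:R / 2))^-1.

Definition Cmx (R : realType) (q : R) (npp npm nmp nmm : nat)
  : 'M[R]_(label_size npp npm nmp nmm) :=
  let Ip := index_seq npp npm in let Im := index_seq nmp nmm in
  block_mx (Cblock q 1 Ip Ip) (Cblock q (-1) Ip Im)
           (Cblock q (-1) Im Ip) (Cblock q 1 Im Im).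

Definition nplus (a b : nat) : nat := (a + b)%N.

Definition nminus (a b : nat) : nat :=
  if (b <= a)%N then (a - b)%N else (b - a - 1)%N.

(* Main.v *)
Require Import Defs.
From HB Require Import structures.
From mathcomp Require Import all_boot all_order all_algebra perm.
From mathcomp Require Import complex.
From mathcomp Require Import all_classical all_reals all_analysis.
From mathcomp Require Import ring lra zify.
Import Order.TTheory GRing.Theory Num.Theory.
Import numFieldNormedType.Exports.
Local Open Scope classical_set_scope.
Local Open Scope ring_scope.
Local Open Scope complex_scope.
Set Implicit Arguments. Unset Strict Implicit. Unset Printing Implicit Defensive.

(** The idea is to fix z = q^x and to view both sides, divided by q^(x xh), as
    functions F of the dual variable w = q^xh. Both solve the second-order
    q-difference equation
      F(w/q) / z + z Psi(w) F(q w) + V(w) F(w) = (z + 1/z) F(w)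
    with the same coefficients, and along the orbit w q^n both have asymptotic
    expansions in powers of q^n with constant term 1. A difference h of two such
    solutions is a solution whose expansion starts at a positive power; inserting
    the leading term c q^(M n) gives c (1 - q^M) (1 - z^2 q^M) / z = 0, so h
    decays faster than every q^(M n), and the equation, read backwards, then
    forces h = 0 (recurrence_unique).

    For the Askey-Wilson function the equation is a contiguous relation of
    very-well-poised series. It is proved by a telescoping certificate: a linear
    combination of the k-th terms of three contiguous series is a difference
    certC (k+1) - certC k (vwp_telescope), and the boundary term tends to 0
    (AWseries_contiguous, AWred_recurrence).

    For the determinants, every node is mu_t = s_t q^(j_t/2), with s_t = 1 for
    a label of I^+ and s_t = -1 for a label of I^-. The ratio of determinants is
    1 plus a combination of w / (1 - mu_t w) (det_baker). Multiplied by the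
    product of the 1 - mu_t w it is a polynomial P of degree at most N in w, the
    number of nodes, and the formula for the matrix B says that
      mu_t^N P(1/mu_t) = c_t P(mu_t),  c_t = s_t^N (tau z)^(j_t)
    for signs tau (baker_poly_symmetry). Since the determinant in the
    denominator is not 0, the only such polynomial with value 0 at w = 0 is 0
    (baker_unique). The difference operator with denominators cleared maps P to
    a polynomial that vanishes at the six zeros of the denominators, and the
    quotient satisfies the same conditions and vanishes at 0. Hence it is 0
    (dualOp_eq0), which is the difference equation of the ratio
    (baker_recurrence). This works because the index sets are closed under
    j -> j - 2, so that products over nodes telescope (label_telescope), and
    because for the special parameters Psi and V take the values that the
    telescoped product prescribes (dualPsi_nodes, dualV_nodes).

    This gives the identity at all generic complex points near (x, xh). The
    right-hand side is continuous there and generic points accumulate at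
    (x, xh) (AW_punctured_proper), so the value of psi defined by a limit is
    given by the same formula. *)

(** * Modulus and limits of complex sequences *)

Section Modulus.
Variable R : realType.
Local Notation C := (Cplx R).
Implicit Types x y : C.

(** The norm takes its values in R[i]; this is the same number in R, where it
    can be compared with real bounds. *)
Definition modulus x : R := complex.Re `|x|.

Lemma modulusE x : `|x| = (modulus x)%:C.
Proof. by rewrite /modulus normc_def. Qed.

Lemma modulus_ge0 x : 0 <= modulus x.
Proof. by rewrite -ler0c -modulusE. Qed.

Lemma modulusM x y : modulus (x * y) = modulus x * modulus y.
Proof. by apply: complexI; rewrite rmorphM -!modulusE normrM. Qed.

Lemma modulusD x y : modulus (x + y) <= modulus x + modulus y.
Proof. by rewrite -lecR rmorphD -!modulusE ler_normD. Qed.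

Lemma modulusN x : modulus (- x) = modulus x.
Proof. by rewrite /modulus normrN. Qed.

Lemma modulusB x y : modulus (x - y) <= modulus x + modulus y.
Proof. by rewrite -[modulus y]modulusN modulusD. Qed.

Lemma modulus_dist x y : modulus (x - y) = modulus (y - x).
Proof. by rewrite -modulusN opprB. Qed.

Lemma modulus0 : modulus 0 = 0. Proof. by rewrite /modulus normr0. Qed.
Lemma modulus1 : modulus 1 = 1. Proof. by rewrite /modulus normr1. Qed.

Lemma one_sub_neq0 x : modulus x < 1 -> 1 - x != 0.
Proof.
by move=> x1; rewrite subr_eq0 eq_sym; apply: contraTneq x1 => ->; rewrite modulus1 ltxx.
Qed.

Lemma modulusX x n : modulus (x ^+ n) = modulus x ^+ n.
Proof. by apply: complexI; rewrite rmorphXn -!modulusE normrX. Qed.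

Lemma modulusV x : modulus x^-1 = (modulus x)^-1.
Proof. by apply: complexI; rewrite fmorphV -!modulusE normfV. Qed.

Lemma modulus_eq0 x : (modulus x == 0) = (x == 0).
Proof. by rewrite -(inj_eq (@complexI R)) -modulusE normr_eq0. Qed.

Lemma modulus_gt0 x : (0 < modulus x) = (x != 0).
Proof. by rewrite lt_neqAle modulus_ge0 andbT eq_sym modulus_eq0. Qed.

Lemma modulus_real (r : R) : modulus (r%:C : C) = `|r|.
Proof. by rewrite /modulus normc_def /= expr0n /= addr0 sqrtr_sqr. Qed.

Lemma Re_le_modulus x : `|complex.Re x| <= modulus x.
Proof. by rewrite -lecR -modulusE normc_ge_Re. Qed.

Lemma Im_le_modulus x : `|complex.Im x| <= modulus x.
Proof.
have := Re_le_modulus ((x : R[i]) * 'i%C).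
by rewrite ReiNIm normrN modulusM [modulus 'i%C](_ : _ = 1) ?mulr1 // /modulus normc_def /=
  expr0n expr1n add0r sqrtr1.
Qed.

Lemma modulus_le_ReIm x : modulus x <= `|complex.Re x| + `|complex.Im x|.
Proof.
rewrite [x in modulus x]complexE; apply: le_trans (modulusD _ _) _.
rewrite modulusM !modulus_real [modulus 'i%C](_ : _ = 1) ?mul1r // /modulus normc_def /=.
by rewrite expr0n expr1n add0r sqrtr1.
Qed.

(** The radii in R[i] that count are the positive ones, and those are real. *)
Lemma cvgCP (T : Type) (G : set_system T) {FG : Filter G} (u : T -> C) (l : C) :
  u @ G --> l <-> forall e : R, 0 < e -> \forall i \near G, modulus (u i - l) < e.
Proof.
split.
  move=> /cvgrPdist_lt h e e0; have e0' : 0 < (e%:C : C) by rewrite ltcR.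
  have := h _ e0'; apply: filterS => n.
  by rewrite modulusE ltcR modulus_dist.
move=> h; apply/cvgrPdist_lt => e; rewrite ltcE => /andP[/eqP /= ie re].
have := h _ re; apply: filterS => n; rewrite modulus_dist => hn.
by rewrite modulusE ltcE /= ie eqxx.
Qed.

Lemma cvgC_ext (T : Type) (G : set_system T) (u v : T -> C) (l : C) : (forall i, u i = v i) ->
  u @ G --> l -> v @ G --> l.
Proof. by move=> e; rewrite (_ : u = v) //; apply/funext. Qed.

Lemma cvgC_sub (u v : nat -> C) (l k : C) : u @ \oo --> l -> v @ \oo --> k ->
  (fun n => u n - v n) @ \oo --> l - k.
Proof. by move=> hu hv; exact: (cvgB hu hv). Qed.

Lemma cvgC_unique (u : nat -> C) (l k : C) : u @ \oo --> l -> u @ \oo --> k -> l = k.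
Proof. by move=> hu hv; exact: (cvg_unique _ hu hv). Qed.

Lemma cvgC_cst (l : C) : (fun _ : nat => l) @ \oo --> l.
Proof. exact: cvg_cst. Qed.

Lemma cvgC_dominated (u : nat -> C) (l : C) (v : nat -> R) :
  v @ \oo --> 0 -> (forall n, modulus (u n - l) <= v n) -> u @ \oo --> l.
Proof.
move=> hv huv; apply/cvgCP => e e0.
have /cvgrPdist_lt /(_ _ e0) := hv; apply: filterS => n; rewrite sub0r normrN => h.
by apply: le_lt_trans (huv n) (le_lt_trans (ler_norm _) h).
Qed.

Lemma cvgC_modulus_le (u : nat -> C) (l : C) (b : R) :
  u @ \oo --> l -> (\forall n \near \oo, modulus (u n) <= b) -> modulus l <= b.
Proof.
move=> /cvgCP hu hb; apply/ler_addgt0Pr => e e0.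
have [n [h1 h2]] : exists n, modulus (u n - l) < e /\ modulus (u n) <= b.
  have := filterI (hu _ e0) hb; case=> N _ hN; exists N; exact: (hN N (leqnn N)).
have := modulusB (u n) (u n - l); rewrite opprB addrCA subrr addr0 => h.
by apply: le_trans h _; apply: lerD => //; exact: ltW.
Qed.

Lemma cvg_geometric0 (c r : R) : 0 <= r < 1 -> (fun n => c * r ^+ n) @ \oo --> 0.
Proof.
by move=> /andP[r0 r1]; apply: cvg_geometric; rewrite ger0_norm.
Qed.

Lemma cvg_real_geometric (u : nat -> R) (c r : R) : 0 <= r < 1 ->
  (forall n, `|u n.+1 - u n| <= c * r ^+ n) -> cvgn u.
Proof.
move=> hr h.
have hs : cvgn (series (fun n => u n.+1 - u n)).
  apply: normed_cvg.
  apply: (@series_le_cvg _ _ (geometric c r)).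
  - by move=> n; rewrite /= normr_ge0.
  - by move=> n; rewrite /geometric /=; apply: le_trans (h n); exact: normr_ge0.
  - by move=> n; exact: h.
  - by move: hr => /andP[r0 r1]; apply: is_cvg_geometric_series; rewrite ger0_norm.
rewrite (_ : u = (fun n => u 0%N + series (fun n => u n.+1 - u n) n)).
  by apply: is_cvgD => //; exact: is_cvg_cst.
apply/funext => n; rewrite seriesEnat /= telescope_sumr //.
by rewrite addrC subrK.
Qed.

(** Completeness of R is applied to the real and imaginary parts, whose
    increments are bounded by those of the sequence. *)
Lemma cvgC_geometric (u : nat -> C) (c r : R) : 0 <= r < 1 ->
  (forall n, modulus (u n.+1 - u n) <= c * r ^+ n) -> cvgn u.
Proof.
move=> hr h.
have c1 : cvgn (fun n => complex.Re (u n)).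
  apply: (cvg_real_geometric hr) => n; apply: le_trans (h n).
  by rewrite -raddfB Re_le_modulus.
have c2 : cvgn (fun n => complex.Im (u n)).
  apply: (cvg_real_geometric hr) => n; apply: le_trans (h n).
  by rewrite -raddfB Im_le_modulus.
pose l : C := limn (fun n => complex.Re (u n)) +i* limn (fun n => complex.Im (u n)).
apply/cvg_ex; exists l; apply/cvgCP => e e0.
have e20 : 0 < e / 2 by rewrite divr_gt0.
have /cvgrPdist_lt /(_ _ e20) h1 := c1.
have /cvgrPdist_lt /(_ _ e20) h2 := c2.
apply: filterS2 h1 h2 => n k1 k2.
rewrite modulus_dist; apply: le_lt_trans (modulus_le_ReIm _) _.
rewrite [ltRHS]splitr; apply: ltrD.
  by apply: le_lt_trans k1; rewrite raddfB.
by apply: le_lt_trans k2; rewrite raddfB.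
Qed.

End Modulus.

(** * Expansions in powers of q along a q-orbit *)

Section Expansion.
Variables (R : realType) (q : R).
Hypotheses (q0 : 0 < q) (q1 : q < 1).
Local Notation C := (Cplx R).
Local Notation qC := (q%:C : C).
Implicit Types (u v : nat -> C) (p : {poly C}).

Lemma modulus_qX n : modulus (qC ^+ n) = q ^+ n.
Proof. by rewrite modulusX modulus_real ger0_norm // ltW. Qed.

Lemma qX_gt0 n : 0 < q ^+ n. Proof. by rewrite exprn_gt0. Qed.
Lemma qX_le1 n : q ^+ n <= 1. Proof. by rewrite exprn_ile1 // ltW. Qed.

(** A sequence is thought of as the values of a function on an orbit w q^n, with
    q^(m n) as the m-th power of the distance to the limit point 0. *)
Definition bigOq u (m : nat) := exists c : R, forall n, modulus (u n) <= c * q ^+ (m * n).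

Lemma bigOqD u v m : bigOq u m -> bigOq v m -> bigOq (fun n => u n + v n) m.
Proof.
move=> [c hc] [d hd]; exists (c + d) => n.
by apply: le_trans (modulusD _ _) _; rewrite mulrDl lerD.
Qed.

Lemma bigOqN u m : bigOq u m -> bigOq (fun n => - u n) m.
Proof. by move=> [c hc]; exists c => n; rewrite modulusN. Qed.

Lemma bigOqM u v m k : bigOq u m -> bigOq v k -> bigOq (fun n => u n * v n) (m + k).
Proof.
move=> [c hc] [d hd]; exists (c * d) => n.
rewrite modulusM mulnDl exprD mulrACA; apply: ler_pM => //; exact: modulus_ge0.
Qed.

Lemma bigOq_le u m k : (k <= m)%N -> bigOq u m -> bigOq u k.
Proof.
move=> km [c hc]; exists `|c| => n.
apply: le_trans (hc n) _; apply: le_trans (ler_wpM2r (ltW (qX_gt0 _)) (ler_norm c)) _.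
by rewrite ler_wpM2l // ler_wiXn2l ?ltW // leq_mul2r km orbT.
Qed.

Lemma bigOq_ext u v m : (forall n, u n = v n) -> bigOq u m -> bigOq v m.
Proof. by move=> e [c h]; exists c => n; rewrite -e. Qed.

Lemma bigOq_qX m : bigOq (fun n => qC ^+ (m * n)) m.
Proof. by exists 1 => n; rewrite modulus_qX mul1r. Qed.

Lemma bigOq_cst (a : C) : bigOq (fun=> a) 0.
Proof. by exists (modulus a) => n; rewrite mul0n expr0 mulr1. Qed.

Lemma bigOq_poly p : bigOq (fun n => p.[qC ^+ n]) 0.
Proof.
elim/poly_ind: p => [|p c IH].
  by apply: bigOq_ext (bigOq_cst 0) => n; rewrite horner0.
apply: (@bigOq_ext (fun n => p.[qC^+n] * qC^+n + c)).
  by move=> n; rewrite !hornerE.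
apply: bigOqD; last exact: bigOq_cst.
apply: (@bigOqM _ _ 0 0) => //.
apply: (@bigOq_le _ 1) => //.
by apply: bigOq_ext (bigOq_qX 1) => n; rewrite mul1n.
Qed.

(** Asymptotic power series in q^n. The polynomial may change with m, so neither
    convergence nor coherence between orders has to be carried along. *)
Definition expandable u := forall m, exists p, bigOq (fun n => u n - p.[qC ^+ n]) m.

Lemma expandable_ext u v : (forall n, u n = v n) -> expandable u -> expandable v.
Proof.
by move=> e h m; have [p hp] := h m; exists p; apply: bigOq_ext hp => n; rewrite e.
Qed.

Lemma expandable_cst (a : C) : expandable (fun=> a).
Proof.
by move=> m; exists a%:P; exists 0 => n; rewrite hornerC subrr modulus0 mul0r.
Qed.

Lemma expandable_qX : expandable (fun n => qC ^+ n).
Proof. by move=> m; exists 'X; exists 0 => n; rewrite hornerX subrr modulus0 mul0r. Qed.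

Lemma expandableD u v : expandable u -> expandable v -> expandable (fun n => u n + v n).
Proof.
move=> hu hv m; have [p hp] := hu m; have [r hr] := hv m; exists (p + r).
by apply: bigOq_ext (bigOqD hp hr) => n; rewrite hornerD; ring.
Qed.

Lemma expandable_bounded u : expandable u -> bigOq u 0.
Proof.
move=> /(_ 0%N) [p hp]; apply: bigOq_ext (bigOqD hp (bigOq_poly p)) => n.
by rewrite subrK.
Qed.

Lemma expandableM u v : expandable u -> expandable v -> expandable (fun n => u n * v n).
Proof.
move=> hu hv m; have [p hp] := hu m; have [r hr] := hv m; exists (p * r).
have h1 := bigOqM (expandable_bounded hu) hr.
have h2 := bigOqM (bigOq_poly r) hp.
by apply: bigOq_ext (bigOqD h1 h2) => n; rewrite hornerM; ring.
Qed.

Lemma expandableN u : expandable u -> expandable (fun n => - u n).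
Proof.
move=> h; apply: expandable_ext (expandableM (expandable_cst (-1)) h) => n.
by rewrite mulN1r.
Qed.

Lemma expandableB u v : expandable u -> expandable v -> expandable (fun n => u n - v n).
Proof. by move=> hu hv; apply: expandableD => //; exact: expandableN. Qed.

Lemma expandableX u k : expandable u -> expandable (fun n => u n ^+ k).
Proof.
move=> h; elim: k => [|k IH]; first by apply: expandable_ext (expandable_cst 1) => n; rewrite expr0.
by apply: expandable_ext (expandableM h IH) => n; rewrite exprS.
Qed.

Lemma expandable_prod (I : Type) (s : seq I) (u : I -> nat -> C) :
  (forall i, expandable (u i)) -> expandable (fun n => \prod_(i <- s) u i n).
Proof.
move=> h; elim: s => [|i s IH].
  by apply: expandable_ext (expandable_cst 1) => n; rewrite big_nil.
by apply: expandable_ext (expandableM (h i) IH) => n; rewrite big_cons.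
Qed.

Lemma expandable_sum (I : Type) (s : seq I) (u : I -> nat -> C) :
  (forall i, expandable (u i)) -> expandable (fun n => \sum_(i <- s) u i n).
Proof.
move=> h; elim: s => [|i s IH].
  by apply: expandable_ext (expandable_cst 0) => n; rewrite big_nil.
by apply: expandable_ext (expandableD (h i) IH) => n; rewrite big_cons.
Qed.

Lemma expandable_double u : expandable u -> expandable (fun n => u n.*2).
Proof.
move=> h m; have [p [c hp]] := h m; exists (p \Po 'X^2); exists `|c| => n.
rewrite horner_comp hornerXn -exprM muln2; apply: le_trans (hp _) _.
apply: le_trans (ler_wpM2r (ltW (qX_gt0 _)) (ler_norm c)) _.
rewrite ler_wpM2l // ler_wiXn2l ?ltW // -muln2 mulnA leq_pmulr //.
Qed.

Lemma poly_quo_X p : exists r, p = p.[0]%:P + r * 'X.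
Proof.
elim/poly_ind: p => [|p c _]; first by exists 0; rewrite horner0 mul0r addr0.
by exists p; rewrite !hornerE addrC.
Qed.

(** A truncation of the inverse power series; each step adds the coefficient that
    cancels the constant term of the error. *)
Lemma poly_truncated_inverse p m : p.[0] != 0 -> exists r s, p * r = 1 + s * 'X^m.
Proof.
move=> p0; elim: m => [|m [r [s IH]]].
  by exists 0, (-1); rewrite expr0 mulr0 mulr1 subrr.
have [t ht] := poly_quo_X (s - (s.[0] / p.[0])%:P * p).
exists (r - (s.[0]/p.[0])%:P * 'X^m), t.
have e : s - (s.[0] / p.[0])%:P * p = t * 'X.
  by rewrite {1}ht !hornerE divfK // subrr add0r.
rewrite exprS mulrA -e mulrBr IH; ring.
Qed.

Lemma bigOq_Xn m p : bigOq (fun n => (p * 'X^m).[qC ^+ n]) m.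
Proof.
apply: bigOq_ext (bigOqM (bigOq_poly p) (bigOq_qX m)) => n.
by rewrite !hornerE -exprM mulnC.
Qed.

Lemma bigOq1_cvg u : bigOq u 1 -> u @ \oo --> (0 : C).
Proof.
move=> [c hc]; apply: (@cvgC_dominated _ _ _ (fun n => c * q ^+ n)).
  by apply: cvg_geometric0; rewrite ltW.
by move=> n; rewrite subr0; have := hc n; rewrite mul1n.
Qed.

Lemma poly_cvg0 p : (fun n => p.[qC ^+ n]) @ \oo --> p.[0].
Proof.
have [r hr] := poly_quo_X p.
rewrite -[p.[0]]add0r.
rewrite (_ : (fun n => _) = (fun n => (r * 'X^1).[qC^+n] + p.[0])); last first.
  by apply/funext => n; rewrite [in LHS]hr hornerD hornerC addrC.
by apply: cvgD; [apply: bigOq1_cvg; exact: bigOq_Xn|exact: cvg_cst].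
Qed.

Lemma expandable_lim u m p : bigOq (fun n => u n - p.[qC ^+ n]) m.+1 -> u @ \oo --> p.[0].
Proof.
move=> h; have h1 := bigOq1_cvg (bigOq_le (ltn0Sn m) h).
rewrite -[X in _ --> X]add0r; apply: cvgC_ext (cvgD h1 (@poly_cvg0 p)) => n.
exact: subrK.
Qed.

(** A polynomial inverting the expansion modulo 'X^m inverts u up to O(q^(m n));
    the lower bound keeps the constant term of the expansion away from 0. *)
Lemma expandableV u (c : R) : 0 < c -> (forall n, c <= modulus (u n)) ->
  expandable u -> expandable (fun n => (u n)^-1).
Proof.
move=> c0 hc hu m; have [p hp] := hu m.+1.
have un0 n : u n != 0 by rewrite -modulus_gt0; exact: lt_le_trans c0 (hc n).
have p0 : p.[0] != 0.
  rewrite -modulus_gt0; apply: lt_le_trans c0 _.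
  have hl := expandable_lim hp; apply/ler_addgt0Pr => e e0.
  have /cvgCP /(_ _ e0) [N _ /(_ N (leqnn N)) /= hN] := hl.
  apply: le_trans (hc N) _.
  have -> : u N = p.[0] + (u N - p.[0]) by rewrite addrC subrK.
  by apply: le_trans (modulusD _ _) _; rewrite lerD2l ltW.
have [r [s hrs]] := poly_truncated_inverse m p0.
exists r.
have hV : bigOq (fun n => (u n)^-1) 0.
  exists c^-1 => n; rewrite mul0n expr0 mulr1 modulusV lef_pV2 ?posrE //.
  exact: lt_le_trans c0 (hc n).
have h1 := bigOqM (bigOq_poly r) (bigOq_le (leqnSn m) hp).
have h2 := bigOqM hV (bigOqN (bigOqD (bigOq_Xn m s) h1)).
apply: bigOq_ext h2 => n.
have e : p.[qC^+n] * r.[qC^+n] = 1 + (s*'X^m).[qC^+n].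
  by rewrite -hornerM hrs hornerD hornerC.
have -> : (s*'X^m).[qC^+n] = p.[qC^+n] * r.[qC^+n] - 1 by rewrite e addrAC subrr add0r.
have := un0 n; move: (u n) => x x0; move: (p.[_]) (r.[_]) => y z.
by field.
Qed.

(** The q-difference operator multiplies 'X^i by 1 - q^i, which is nonzero for
    i > 0. *)
Lemma poly_qdifference (p : {poly C}) : p.[0] = 0 ->
  exists P : {poly C}, forall x : C, P.[x] - P.[qC * x] = p.[x].
Proof.
move=> p0; exists (\poly_(i < size p) (p`_i / (1 - qC ^+ i))) => x.
rewrite !horner_poly -sumrB (horner_coef p); apply: eq_bigr => i _.
rewrite exprMn -mulrBr (_ : x ^+ i - qC ^+ i * x ^+ i = (1 - qC ^+ i) * x ^+ i); last by ring.
rewrite mulrA.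
case: (nat_of_ord i) => [|k].
  by rewrite expr0 subrr mulr0 mul0r -horner_coef0 p0 mul0r.
rewrite divfK // -modulus_gt0.
have : modulus (1 - qC^+k.+1) = 1 - q^+k.+1.
  by rewrite -rmorphXn -[1]/((1%:C : C)) -rmorphB modulus_real ger0_norm // subr_ge0 qX_le1.
by move->; rewrite subr_gt0 exprn_ilt1 // ltW.
Qed.

Lemma bigOq_shift u m : bigOq u m -> bigOq (fun n => u n.+1) m.
Proof.
move=> [c hc]; exists `|c| => n; apply: le_trans (hc _) _.
apply: le_trans (ler_wpM2r (ltW (qX_gt0 _)) (ler_norm c)) _.
by rewrite ler_wpM2l // ler_wiXn2l ?ltW // leq_mul2l leqnSn orbT.
Qed.

(** A sequence tending to 0 is the sum of its increments from n on, here the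
    tail of a geometric series. *)
Lemma bigOq_telescope u m : bigOq (fun n => u n - u n.+1) m.+1 -> u @ \oo --> (0 : C) ->
  bigOq u m.+1.
Proof.
move=> [c hc] hu; pose r := q ^+ m.+1.
have r0 : 0 < r by exact: qX_gt0.
have r1 : r < 1 by rewrite /r exprn_ilt1 // ltW.
have c0 : 0 <= c by have := hc 0%N; rewrite muln0 expr0 mulr1; apply: le_trans; exact: modulus_ge0.
exists (c / (1 - r)) => n.
have b k : modulus (u n - u (n + k)%N) <= c / (1 - r) * r ^+ n * (1 - r ^+ k).
  elim: k => [|k IH]; first by rewrite addn0 subrr modulus0 expr0 subrr mulr0.
  have -> : u n - u (n + k.+1)%N = (u n - u (n + k)%N) + (u (n+k)%N - u (n+k).+1).
    by rewrite addnS; ring.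
  apply: le_trans (modulusD _ _) _; apply: le_trans (lerD IH (hc _)) _.
  rewrite exprM -/r exprD exprS.
  rewrite -subr_ge0 (_ : _ - _ = 0) //.
  by field; rewrite subr_eq0 eq_sym lt_eqF.
rewrite exprM -/r.
have hl : (fun k => u n - u (n + k)%N) @ \oo --> u n.
  rewrite -[X in _ --> X]subr0; apply: cvgB; first exact: cvg_cst.
  by rewrite (_ : (fun k => u (n + k)%N) = [sequence u (k + n)%N]_k) ?cvg_shiftn //;
    apply/funext => k; rewrite addnC.
apply: (cvgC_modulus_le hl); exists 0%N => // k _ /=; apply: le_trans (b k) _.
rewrite ler_piMr //.
  apply: mulr_ge0; last by rewrite exprn_ge0 // ltW.
  by apply: divr_ge0 => //; rewrite subr_ge0 ltW.
by rewrite lerBlDr lerDl exprn_ge0 // ltW.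
Qed.

(** Summation gains one order because the increments carry a factor q^n. This
    lets a functional equation produce an expansion one order at a time. *)
Lemma expandable_antidifference u v (l : C) m p :
  u @ \oo --> l -> (forall n, u n - u n.+1 = qC ^+ n * v n) ->
  bigOq (fun n => v n - p.[qC ^+ n]) m ->
  exists P : {poly C}, bigOq (fun n => u n - P.[qC ^+ n]) m.+1.
Proof.
move=> hu huv hv; have [P hP] : exists P : {poly C}, forall x : C, P.[x] - P.[qC * x] = (p * 'X).[x].
  by apply: poly_qdifference; rewrite !hornerE.
exists (P + (l - P.[0])%:P).
apply: bigOq_telescope.
  apply: bigOq_ext (bigOqM (bigOq_qX 1) hv) => n.
  have := hP (qC^+n); rewrite -exprS => e.
  transitivity ((u n - u n.+1) - (P.[qC^+n] - P.[qC^+n.+1])).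
    by rewrite huv e mul1n !hornerE; ring.
  by rewrite !hornerD !hornerC; ring.
have e : l - (P + (l - P.[0])%:P).[0] = 0 by rewrite hornerD hornerC; ring.
have h : (fun n => u n - (P + (l - P.[0])%:P).[qC ^+ n]) @ \oo --> l - (P + (l - P.[0])%:P).[0].
  by apply: cvgB; [exact: hu|exact: poly_cvg0].
by rewrite e in h.
Qed.

Lemma qpoch_sum_le (v : R) k : 0 <= v -> \sum_(i < k) v * q ^+ i <= v / (1 - q).
Proof.
move=> v0; rewrite -mulr_sumr ler_wpM2l // -subr_ge0.
have q1' : 1 - q != 0 by rewrite subr_eq0 eq_sym lt_eqF.
have -> : \sum_(i < k) q ^+ i = (1 - q ^+ k) / (1 - q).
  apply: (mulfI q1'); rewrite mulrCA divff // mulr1.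
  by rewrite -[in RHS](expr1n _ k) subrXX; congr (_ * _); apply: eq_bigr => i _; rewrite expr1n mul1r.
have -> : (1 - q)^-1 - (1 - q ^+ k) / (1 - q) = q ^+ k / (1 - q) by field.
by rewrite divr_ge0 ?exprn_ge0 ?subr_ge0 // ltW.
Qed.

Lemma qpochS (u : C) k : qpoch q u k.+1 = qpoch q u k * (1 - u * qC ^+ k).
Proof. by rewrite /qpoch big_ord_recr. Qed.

Lemma qpochD (u : C) n k : qpoch q u (n + k) = qpoch q u n * qpoch q (u * qC ^+ n) k.
Proof.
rewrite /qpoch big_split_ord /=; congr (_ * _).
by apply: eq_bigr => i _; rewrite exprD mulrA.
Qed.

Lemma qpoch_le (u : C) k : modulus (qpoch q u k) <= expR (modulus u / (1 - q)).
Proof.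
apply: (@le_trans _ _ (expR (\sum_(i < k) modulus u * q ^+ i))); last first.
  by rewrite ler_expR qpoch_sum_le // modulus_ge0.
elim: k => [|k IH]; first by rewrite /qpoch !big_ord0 modulus1 expR0.
rewrite qpochS big_ord_recr /= expRD modulusM.
apply: ler_pM => //; try exact: modulus_ge0.
apply: le_trans (modulusB _ _) _; rewrite modulus1 modulusM modulus_qX.
exact: expR_ge1Dx.
Qed.

(** By induction on k, the product staying below 2 as long as the sum is below
    1 / 2. *)
Lemma qpoch_near1 (u : C) k : modulus u / (1 - q) <= 1 / 2 ->
  modulus (qpoch q u k - 1) <= 2 * (modulus u / (1 - q)).
Proof.
move=> hu; apply: (@le_trans _ _ (2 * (\sum_(i < k) modulus u * q ^+ i))); last first.
  by rewrite ler_wpM2l // qpoch_sum_le // modulus_ge0.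
elim: k => [|k IH]; first by rewrite /qpoch !big_ord0 subrr modulus0 mulr0.
rewrite qpochS big_ord_recr /=.
have hs : \sum_(i < k) modulus u * q ^+ i <= 1 / 2.
  by apply: le_trans hu; rewrite qpoch_sum_le // modulus_ge0.
have hP : modulus (qpoch q u k) <= 2.
  have -> : qpoch q u k = (qpoch q u k - 1) + 1 by rewrite subrK.
  by apply: le_trans (modulusD _ _) _; rewrite modulus1; lra.
have -> : qpoch q u k * (1 - u * qC^+k) - 1 = (qpoch q u k - 1) - qpoch q u k * (u * qC^+k) by ring.
apply: le_trans (modulusB _ _) _; rewrite [modulus (_ * (_ * _))]modulusM modulusM modulus_qX.
have : modulus (qpoch q u k) * (modulus u * q ^+ k) <= 2 * (modulus u * q ^+ k).
  by rewrite ler_wpM2r // mulr_ge0 ?modulus_ge0 // ltW // qX_gt0.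
lra.
Qed.

Lemma qX_eventually_small (a e : R) : 0 < e -> exists m, a * q ^+ m <= e.
Proof.
move=> e0; have /cvgrPdist_lt /(_ _ e0) [N _ /(_ N (leqnn N)) /=] :=
  @cvg_geometric0 R a q (introT andP (conj (ltW q0) q1)).
by rewrite sub0r normrN => h; exists N; apply: le_trans (ler_norm _) (ltW h).
Qed.

(** Products starting far enough along the orbit stay close to 1, so all the
    (u; q)_k are bounded below; a product starting at n is a quotient of two of
    these. *)
Lemma qpoch_lower (u : C) : (forall n, 1 - u * qC ^+ n != 0) ->
  exists2 c : R, 0 < c & forall n k, c <= modulus (qpoch q (u * qC ^+ n) k).
Proof.
move=> hu.
have un0 k : 0 < modulus (qpoch q u k).
  rewrite modulus_gt0 /qpoch; apply/prodf_neq0 => i _; exact: hu.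
pose B := expR (modulus u / (1 - q)).
have B0 : 0 < B by exact: expR_gt0.
have hq1 : 0 < 1 - q by rewrite subr_gt0.
have hB n k : modulus (qpoch q (u * qC ^+ n) k) <= B.
  apply: le_trans (qpoch_le _ _) _; rewrite ler_expR modulusM modulus_qX.
  by rewrite ler_wpM2r ?invr_ge0 ?(ltW hq1) // ler_piMr ?modulus_ge0 // qX_le1.
have [m hm] := @qX_eventually_small (modulus u / (1 - q)) (1/4) ltac:(by lra).
have half k : 1/2 <= modulus (qpoch q (u * qC^+m) k).
  have e : modulus (u * qC ^+ m) / (1 - q) <= 1 / 4.
    by rewrite modulusM modulus_qX mulrAC.
  have h1 := @qpoch_near1 (u * qC ^+ m) k ltac:(by lra).
  have : 1 <= modulus (qpoch q (u * qC ^+ m) k) + modulus (qpoch q (u * qC ^+ m) k - 1).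
    have := modulusB (qpoch q (u * qC ^+ m) k) (qpoch q (u * qC ^+ m) k - 1).
    by rewrite opprB addrCA subrr addr0 modulus1.
  lra.
(* B bounds all the products, so dividing by B + 2 covers both the products of at
   most m factors and, with half, the longer ones. *)
pose c1 := modulus (qpoch q u m) / (B + 2).
have hc1 k : c1 <= modulus (qpoch q u k).
  rewrite ler_pdivrMr ?addr_gt0 //.
  case: (leqP k m) => km.
    rewrite -{1}(subnKC km) qpochD modulusM ler_wpM2l ?modulus_ge0 //.
    by apply: le_trans (hB _ _) _; rewrite lerDl.
  rewrite -{1}[k](subnKC (ltnW km)) qpochD modulusM -mulrA ler_peMr ?modulus_ge0 //.
  have := half (k - m)%N => h; have := ltW B0; nra.
exists (c1 / B); first by rewrite !divr_gt0 ?addr_gt0.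
move=> n k; rewrite ler_pdivrMr //.
have := hc1 (n + k)%N; rewrite qpochD modulusM => h; apply: le_trans h _.
rewrite mulrC ler_wpM2l ?modulus_ge0 //.
by have := hB 0%N n; rewrite expr0 mulr1.
Qed.

Lemma cvg_qpoch (u : C) : qpoch q u @ \oo --> qpochoo q u.
Proof.
apply: (@cvgC_geometric _ _ (expR (modulus u / (1 - q)) * modulus u) q).
  by rewrite ltW.
move=> n; rewrite qpochS.
have -> : qpoch q u n * (1 - u * qC^+n) - qpoch q u n = - (qpoch q u n * (u * qC^+n)) by ring.
rewrite modulusN modulusM modulusM modulus_qX mulrA.
by rewrite !ler_wpM2r ?modulus_ge0 ?qpoch_le // ltW // qX_gt0.
Qed.

Lemma qpochoo_shift (u : C) : qpochoo q u = (1 - u) * qpochoo q (u * qC).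
Proof.
have h1 : (fun n => qpoch q u n.+1) @ \oo --> qpochoo q u.
  by rewrite (cvg_shiftS (qpoch q u)); exact: cvg_qpoch.
have h2 : (fun n => qpoch q u n.+1) @ \oo --> (1 - u) * qpochoo q (u * qC).
  rewrite (_ : (fun n => _) = (fun n => (1 - u) * qpoch q (u * qC) n)).
    by apply: cvgM; [exact: cvg_cst|exact: cvg_qpoch].
  apply/funext => n; rewrite -add1n qpochD expr1; congr (_ * _).
  by rewrite /qpoch big_ord1 expr0 mulr1.
exact: (cvgC_unique h1 h2).
Qed.

Lemma qpochoo_lower (u : C) : (forall n, 1 - u * qC ^+ n != 0) ->
  exists2 c : R, 0 < c & forall n, c <= modulus (qpochoo q (u * qC ^+ n)).
Proof.
move=> /qpoch_lower [c c0 hc]; exists c => // n.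
apply/ler_addgt0Pr => e e0.
have /cvgCP /(_ _ e0) [N _ /(_ N (leqnn N)) /= hN] := @cvg_qpoch (u * qC^+n).
apply: le_trans (hc n N) _.
set x := qpoch _ _ _ in hN *; set y := qpochoo _ _ in hN *.
have -> : x = y + (x - y) by ring.
by apply: le_trans (modulusD _ _) _; rewrite lerD2l ltW.
Qed.

Lemma qpochoo_cvg1 (u : C) : (fun n => qpochoo q (u * qC ^+ n)) @ \oo --> (1 : C).
Proof.
have hq1 : 0 < 1 - q by rewrite subr_gt0.
have [m hm] := @qX_eventually_small (modulus u / (1 - q)) (1/2) ltac:(by lra).
have b n : modulus (qpochoo q (u * qC ^+ (n + m)) - 1) <= (2 * (modulus u / (1 - q))) * q ^+ n.
  have h : (fun k => qpoch q (u * qC ^+ (n + m)) k - 1) @ \oo --> (qpochoo q (u * qC ^+ (n + m)) - 1 : C).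
    exact: cvgC_sub (@cvg_qpoch _) (@cvgC_cst _ 1).
  apply: (cvgC_modulus_le h); exists 0%N => // k _ /=.
  have e : modulus (u * qC ^+ (n+m)) / (1 - q) = modulus u / (1 - q) * q ^+ (n + m).
    by rewrite modulusM modulus_qX mulrAC.
  have e1 : modulus u / (1 - q) * q ^+ (n + m) <= modulus u / (1 - q) * q ^+ m.
    by rewrite ler_wpM2l ?divr_ge0 ?modulus_ge0 ?(ltW hq1) // ler_wiXn2l ?(ltW q0) ?(ltW q1) // leq_addl.
  have e2 : modulus u / (1 - q) * q ^+ (n + m) <= modulus u / (1 - q) * q ^+ n.
    by rewrite ler_wpM2l ?divr_ge0 ?modulus_ge0 ?(ltW hq1) // ler_wiXn2l ?(ltW q0) ?(ltW q1) // leq_addr.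
  apply: le_trans (@qpoch_near1 _ k _) _; first by rewrite e (le_trans e1).
  by rewrite e -[leRHS]mulrA ler_wpM2l.
rewrite -(cvg_shiftn m).
apply: (cvgC_dominated _ b).
by apply: cvg_geometric0; rewrite ltW.
Qed.

(** Since (u; q)_oo = (1 - u) (u q; q)_oo, the increments along the orbit are q^n
    times the function itself, and each order of the expansion yields the next. *)
Lemma expandable_qpochoo (u : C) : expandable (fun n => qpochoo q (u * qC ^+ n)).
Proof.
have hd n : qpochoo q (u * qC ^+ n) - qpochoo q (u * qC ^+ n.+1)
            = qC ^+ n * (- u * qpochoo q (u * qC ^+ n.+1)).
  by rewrite qpochoo_shift exprSr mulrA; ring.
elim=> [|m [p hp]].
  exists 0; exists (expR (modulus u / (1 - q))) => n.
  rewrite horner0 subr0 mul0n expr0 mulr1.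
  apply: (cvgC_modulus_le (@cvg_qpoch _)); exists 0%N => // k _ /=.
  apply: le_trans (qpoch_le _ _) _; rewrite ler_expR modulusM modulus_qX.
  have hq1 : 0 < 1 - q by rewrite subr_gt0.
  by rewrite ler_wpM2r ?invr_ge0 ?(ltW hq1) // ler_piMr ?modulus_ge0 // qX_le1.
apply: (@expandable_antidifference _ _ 1 m ((-u)%:P * (p \Po (qC%:P * 'X))) (@qpochoo_cvg1 u) hd).
apply: bigOq_ext (bigOqM (bigOq_cst (-u)) (bigOq_shift hp)) => n.
by rewrite hornerM hornerC horner_comp !hornerE -exprS; ring.
Qed.

Lemma cvg_series_geometric (f : nat -> C) (c r : R) : 0 <= r < 1 ->
  (forall k, modulus (f k) <= c * r ^+ k) -> cvgn (series f).
Proof.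
move=> hr hf; apply: (cvgC_geometric hr) => k.
by rewrite !seriesEnat /= big_nat_recr //= addrAC subrr add0r.
Qed.

(** The k-th term carries a factor q^(n k), so the terms from the m-th on are
    O(q^(m n)). *)
Lemma series_remainder (f : nat -> nat -> C) (c r : R) m : 0 <= r < 1 ->
  (forall k n, modulus (f k n) <= c * r ^+ k * q ^+ (n * k)) ->
  bigOq (fun n => limn (series (fun k => f k n)) - \sum_(k <- iota 0 m) f k n) m.
Proof.
move=> hr hb.
have c0 : 0 <= c.
  by have := hb 0%N 0%N; rewrite !expr0 !mulr1; apply: le_trans; exact: modulus_ge0.
have [r0 r1] := andP hr.
exists (c / (1 - r)) => n.
have hs : series (fun k => f k n) @ \oo --> limn (series (fun k => f k n)).
  apply: (@cvg_series_geometric _ c r hr) => k; apply: le_trans (hb _ _) _.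
  by rewrite ler_piMr ?qX_le1 // mulr_ge0 // exprn_ge0.
have hs' : (fun K => series (fun k => f k n) K - \sum_(k <- iota 0 m) f k n) @ \oo -->
   limn (series (fun k => f k n)) - \sum_(k <- iota 0 m) f k n.
  exact: (cvgC_sub hs (@cvgC_cst _ _)).
apply: (cvgC_modulus_le hs').
exists m => //= K /= mK.
rewrite seriesEnat /= (@big_cat_nat _ _ _ m) //= {1}/index_iota subn0 addrAC subrr add0r.
have hr1 : 1 - r != 0 by rewrite subr_eq0 eq_sym lt_eqF.
have b j : modulus (\sum_(m <= k < m + j) f k n) <= c / (1 - r) * q ^+ (m * n) * (r^+m * (1 - r ^+ j)).
  elim: j => [|j IH]; first by rewrite addn0 big_geq // modulus0 expr0 subrr !mulr0.
  rewrite addnS big_nat_recr ?leq_addr //=.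
  apply: le_trans (modulusD _ _) _; apply: le_trans (lerD IH (hb _ _)) _.
  have : c * r ^+ (m + j) * q ^+ (n * (m + j)) <= c * r ^+ (m + j) * q ^+ (m * n).
    rewrite ler_wpM2l ?mulr_ge0 ?exprn_ge0 // ler_wiXn2l ?ltW //.
    by rewrite mulnC leq_mul2l leq_addr orbT.
  move=> h; apply: le_trans (lerD (lexx _) h) _.
  by rewrite -subr_ge0 exprD exprS (_ : _ - _ = 0) //; field.
rewrite -(subnKC mK); apply: le_trans (b _) _.
rewrite ler_piMr //.
  apply: mulr_ge0; last by rewrite exprn_ge0 // ltW.
  by apply: divr_ge0 => //; rewrite subr_ge0 ltW.
have rm1 : r ^+ m <= 1 by rewrite exprn_ile1 // ltW.
have rk1 : r ^+ (K - m) <= 1 by rewrite exprn_ile1 // ltW.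
have rm0 : 0 <= r ^+ m by rewrite exprn_ge0.
have rk0 : 0 <= r ^+ (K - m) by rewrite exprn_ge0.
nra.
Qed.

(** Each order of the expansion involves finitely many terms of the series. *)
Lemma expandable_series (f : nat -> nat -> C) (c r : R) : 0 <= r < 1 ->
  (forall k, expandable (f k)) ->
  (forall k n, modulus (f k n) <= c * r ^+ k * q ^+ (n * k)) ->
  expandable (fun n => limn (series (fun k => f k n))).
Proof.
move=> hr hf hb m.
have [p hp] := @expandable_sum _ (iota 0 m) f hf m.
exists p; apply: bigOq_ext (bigOqD (series_remainder m hr hb) hp) => n.
by rewrite addrA subrK.
Qed.
End Expansion.

(** * Uniqueness for a three-term q-difference equation *)

Section Uniqueness.
Variables (R : realType) (q : R).
Hypotheses (q0 : 0 < q) (q1 : q < 1).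
Local Notation C := (Cplx R).
Local Notation qC := (q%:C : C).
Implicit Types (u v h : nat -> C) (p : {poly C}).

Lemma qC_neq0 : qC != 0.
Proof. by rewrite -modulus_gt0 modulus_real normr_gt0 gt_eqF. Qed.

Lemma bigOq_cst_eq0 (a : C) m : bigOq q (fun n => a * qC ^+ (m * n)) m.+1 -> a = 0.
Proof.
move=> [c hc].
have : bigOq q (fun=> a) 1.
  exists c => n; have := hc n.
  rewrite modulusM (modulus_qX q0) mulSn exprD mulrA mul1n ler_pM2r //.
  exact: qX_gt0.
move=> /(bigOq1_cvg q0 q1) h0.
exact: (cvgC_unique (@cvgC_cst _ a) h0).
Qed.

Lemma bigOq_poly_lead p m : bigOq q (fun n => p.[qC ^+ n]) m ->
  exists c, bigOq q (fun n => p.[qC ^+ n] - c * qC ^+ (m * n)) m.+1.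
Proof.
elim: m p => [|m IH] p hp; have [r hr] := poly_quo_X p.
  exists p.[0]; apply: bigOq_ext (bigOq_Xn q0 q1 1 r) => n.
  have := congr1 (horner^~ (qC ^+ n)) hr; rewrite /= hornerD hornerC => ->.
  by rewrite mul0n expr0 mulr1 expr1 addrAC subrr add0r.
have p0 : p.[0] = 0.
  apply: (cvgC_unique (@poly_cvg0 _ _ q0 q1 p)).
  exact: (bigOq1_cvg q0 q1 (bigOq_le q0 q1 (ltn0Sn m) hp)).
have pE n : p.[qC^+n] = r.[qC^+n] * qC^+n.
  have := congr1 (horner^~ (qC ^+ n)) hr; rewrite /= hornerD hornerC p0 add0r => ->.
  by rewrite !hornerE.
have : bigOq q (fun n => r.[qC ^+ n]) m.
  have [c hc] := hp; exists c => n; have := hc n.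
  rewrite pE modulusM (modulus_qX q0) mulSn [(n + _)%N]addnC exprD mulrA ler_pM2r //.
  exact: qX_gt0.
move=> /IH [c hc]; exists c.
have := bigOqM hc (bigOq_qX q0 1); rewrite addn1; apply: bigOq_ext => n.
by rewrite pE mul1n mulSn [(n + _)%N]addnC exprD; ring.
Qed.

(** Up to one order more the sequence is a polynomial in q^n, which the bound
    makes divisible by its m-th power. *)
Lemma expandable_lead h m : expandable q h -> bigOq q h m ->
  exists c, bigOq q (fun n => h n - c * qC ^+ (m * n)) m.+1.
Proof.
move=> /(_ m.+1) [p hp] hm.
have : bigOq q (fun n => p.[qC ^+ n]) m.
  have := bigOqD hm (bigOqN (bigOq_le q0 q1 (leqnSn m) hp)); apply: bigOq_ext => n.
  by ring.
move=> /bigOq_poly_lead [c hc]; exists c.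
by apply: bigOq_ext (bigOqD hp hc) => n; ring.
Qed.

(** Iterating the inequality j times bounds h 0 by (2 |K|)^j times a bound of h
    at indices from j on, and a fast enough decay of h outweighs the first factor. *)
Lemma bigOq_all_recurrence h (K : R) :
  (forall n, modulus (h n) <= K * (modulus (h n.+1) + modulus (h n.+2))) ->
  (forall m, bigOq q h m) -> h 0%N = 0.
Proof.
move=> hK hO.
have K0 : 0 <= `|K| by [].
have {}hK n : modulus (h n) <= `|K| * (modulus (h n.+1) + modulus (h n.+2)).
  apply: le_trans (hK n) _; rewrite ler_wpM2r ?ler_norm // addr_ge0 ?modulus_ge0 //.
have [m hm] := @qX_eventually_small _ _ q0 q1 (2 * `|K|) (1/2) ltac:(by lra).
have [c hc] := hO m.
have c0 : 0 <= c by have := hc 0%N; rewrite muln0 expr0 mulr1; apply: le_trans; exact: modulus_ge0.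
have b j n : modulus (h n) <= (2 * `|K|) ^+ j * (c * q ^+ (m * (n + j))).
  elim: j n => [|j IH] n; first by rewrite expr0 mul1r addn0.
  apply: le_trans (hK n) _.
  have h1 := IH n.+1; have h2 := IH n.+2.
  have h3 : (2 * `|K|) ^+ j * (c * q ^+ (m * (n.+2 + j)))
     <= (2 * `|K|) ^+ j * (c * q ^+ (m * (n.+1 + j))).
    rewrite ler_wpM2l ?exprn_ge0 ?mulr_ge0 // ler_wpM2l // ler_wiXn2l ?ltW //.
    by rewrite leq_mul2l addSn leqnSn orbT.
  rewrite exprS -[(n + j.+1)%N]addSnnS.
  apply: (@le_trans _ _ (`|K| * (2 * ((2 * `|K|) ^+ j * (c * q ^+ (m * (n.+1 + j))))))).
    by rewrite ler_wpM2l // mulr_natl mulr2n lerD // (le_trans h2).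
  by rewrite le_eqVlt; apply/orP; left; apply/eqP; ring.
have b2 j : modulus (h 0%N) <= c * (1/2) ^+ j.
  apply: le_trans (b j 0%N) _; rewrite add0n exprM mulrCA -exprMn ler_wpM2l //.
  by rewrite lerXn2r ?nnegrE ?mulr_ge0 // exprn_ge0 // ltW.
apply/eqP; rewrite -modulus_eq0 eq_le modulus_ge0 andbT.
apply/ler_addgt0Pr => e e0; rewrite add0r.
have h12 : 0 < (1/2 : R) < 1 by apply/andP; split; lra.
have [j hj] := @qX_eventually_small _ _ (andP h12).1 (andP h12).2 c e e0.
by apply: le_trans (b2 j) hj.
Qed.

(** The leading term c q^(M n) of h, inserted in the equation, gives
    c (1 - q^M) (1 - z^2 q^M) / z = 0. So h decays to every order, and since the
    equation bounds h n by its two successors, h 0 = 0. *)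
Lemma recurrence_unique h (Psi V : nat -> C) (z : C) : z != 0 ->
  (forall m, 1 - z ^+ 2 * qC ^+ m.+1 != 0) ->
  expandable q h -> h @ \oo --> (0 : C) ->
  bigOq q (fun n => Psi n - 1) 1 -> bigOq q V 1 ->
  (forall n, h n / z + z * Psi n * h n.+2 + V n * h n.+1 = (z + z^-1) * h n.+1) ->
  h 0%N = 0.
Proof.
move=> z0 hz hexp hlim hPsi hV hrec.
have hm m : bigOq q h m.+1.
  elim: m => [|m IH].
    have [c hc] := expandable_lead hexp (expandable_bounded q0 q1 hexp).
    suff c0 : c = 0 by apply: bigOq_ext hc => n; rewrite c0 mul0r subr0.
    have hc' := bigOq1_cvg q0 q1 hc.
    have := cvgC_sub hlim hc'; rewrite subr0 => hc2.
    apply: (cvgC_unique _ hc2).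
    by apply: cvgC_ext (@cvgC_cst _ c) => n; rewrite mul0n expr0 mulr1; ring.
  have [c hc] := expandable_lead hexp IH.
  suff c0 : c = 0 by apply: bigOq_ext hc => n; rewrite c0 mul0r subr0.
  set M := m.+1 in IH hc.
  have kn0 : (1 - qC ^+ M) * (1 - z ^+ 2 * qC ^+ M) / z != 0.
    rewrite mulf_neq0 ?invr_eq0 // mulf_neq0 //; last exact: hz.
    by apply: one_sub_neq0; rewrite (modulus_qX q0) exprn_ilt1 // ltW.
  suff : c * ((1 - qC ^+ M) * (1 - z ^+ 2 * qC ^+ M) / z) = 0.
    by move/eqP; rewrite mulf_eq0 (negPf kn0) orbF => /eqP.
  apply: (@bigOq_cst_eq0 _ M).
  have cu x := bigOq_cst q x.
  have hc1 := bigOq_shift q0 q1 hc.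
  have hc2 := bigOq_shift q0 q1 hc1.
  have Psi0 : bigOq q Psi 0.
    have := bigOqD (bigOq_le q0 q1 (leq0n 1) hPsi) (cu 1).
    by apply: bigOq_ext => n; rewrite subrK.
  have V0 := bigOq_le q0 q1 (leq0n 1) hV.
  have e1 := bigOqM (cu z^-1) hc.
  have e2 := bigOqM (bigOqM (cu z) Psi0) hc2.
  have e3 := bigOqM V0 hc1.
  have e4 := bigOqM (cu (z + z^-1)) hc1.
  have qM := bigOq_qX q0 M.
  have e5 := bigOqM (bigOqM (cu (c * z * qC ^+ (2 * M))) hPsi) qM.
  have e6 := bigOqM (bigOqM (cu (c * qC ^+ M)) hV) qM.
  rewrite ?add0n ?add1n in e1 e2 e3 e4 e5 e6.
  have := bigOqN (bigOqD (bigOqD (bigOqD e1 e2) (bigOqD e3 (bigOqN e4))) (bigOqD e5 e6)).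
  apply: bigOq_ext => n; have := hrec n => hr.
  rewrite /= [(M * n.+2)%N]mulnS [(M * n.+1)%N]mulnS mul2n -addnn !exprD.
  apply/eqP; rewrite -subr_eq0; apply/eqP.
  transitivity (- (h n / z + z * Psi n * h n.+2 + V n * h n.+1 - (z + z^-1) * h n.+1)).
    by field.
  by rewrite hr subrr oppr0.
have V0 := bigOq_le q0 q1 (leq0n 1) hV.
have Psi0 : bigOq q Psi 0.
  have := bigOqD (bigOq_le q0 q1 (leq0n 1) hPsi) (bigOq_cst q 1).
  by apply: bigOq_ext => n; rewrite subrK.
have [a ha] := V0; have [b hb] := Psi0.
have ha' n : modulus (V n) <= a by have := ha n; rewrite mul0n expr0 mulr1.
have hb' n : modulus (Psi n) <= b by have := hb n; rewrite mul0n expr0 mulr1.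
apply: (@bigOq_all_recurrence h (modulus z * (a + modulus (z + z^-1) + modulus z * b))).
  move=> n.
  have -> : h n = z * ((z + z^-1) * h n.+1 - z * Psi n * h n.+2 - V n * h n.+1).
    by rewrite -hrec; field.
  rewrite modulusM -[leRHS]mulrA ler_wpM2l ?modulus_ge0 //.
  apply: le_trans (modulusB _ _) _.
  have t1 := modulusB ((z + z^-1) * h n.+1) (z * Psi n * h n.+2).
  rewrite !modulusM in t1 *.
  have m1 := modulus_ge0 (h n.+1); have m2 := modulus_ge0 (h n.+2).
  have m3 := modulus_ge0 z; have m4 := modulus_ge0 (z + z^-1).
  have m5 := modulus_ge0 (V n); have m6 := modulus_ge0 (Psi n).
  have a0 := le_trans m5 (ha' n); have b0 := le_trans m6 (hb' n).
  have s1 : modulus (V n) * modulus (h n.+1) <= a * modulus (h n.+1) by rewrite ler_wpM2r.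
  have s2 : modulus z * modulus (Psi n) * modulus (h n.+2) <= modulus z * b * modulus (h n.+2).
    by rewrite ler_wpM2r // ler_wpM2l.
  have s3 : 0 <= a * modulus (h n.+2) by rewrite mulr_ge0.
  have s4 : 0 <= modulus (z + z^-1) * modulus (h n.+2) by rewrite mulr_ge0.
  have s5 : 0 <= modulus z * b * modulus (h n.+1) by rewrite !mulr_ge0.
  lra.
case=> [|m]; first exact: expandable_bounded.
exact: hm.
Qed.
End Uniqueness.

(** * A contiguous relation for very-well-poised series *)

Lemma cert_identity_algebra (F : fieldType) (q E d d1 n s v l p w x K : F) :
  q != 0 -> E != 0 -> d != 0 -> 1 - w != 0 -> q - w != 0 -> 1 - q*w != 0 ->
  let Z := q*w/E in
  (1-Z/q)/((1-w/q)*(1-w))*d1 + l * p/((1-w)*(1-q*w))*(1-q*x*K^+2)*K^+2*(1-x*K)*(1-E*K)/d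
  + (v/((1-w/q)*(1-q*w)) - (l+1))*K*(1-x*K^+2)
  = Z/q*n*(E/q/((1-w/q)*(1-w))*(1-Z/q) - (1-x*K)*(1-E*K)*s/((1-w)*(1-q*w))/d)
  + ((1-Z/q)*(1-q*w)*(d1-(w/q)*n) + (1-w/q)*(1-x*K)*(1-E*K)*
     ((Z/q*n*s + l * p*K^+2*(1-q*x*K^+2))/d)
  + (v - (l+1)*(1-w/q)*(1-q*w))*(1-w)*K*(1-x*K^+2))/((1-w/q)*(1-w)*(1-q*w)).
Proof.
move=> q0 E0 d0 h1 h2 h3 Z; rewrite /Z; field.
by rewrite q0 E0 d0 h1 h2 h3.
Qed.

(** The middle one of the three series has first parameter X, numerator parameters
    b1, ..., b4 and E, and argument Z; w2 is the square of the dual variable, and K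
    stands for q^k. *)
Section Cert.
Variable F : fieldType.
Variables q E y b1 b2 b3 b4 : F.
Hypotheses (q0 : q != 0) (E0 : E != 0) (b10 : b1 != 0) (b20 : b2 != 0)
  (b30 : b3 != 0) (b40 : b4 != 0).
Let e1 := b1 + b2 + b3 + b4.
Let e3 := b1*b2*b3 + b1*b2*b4 + b1*b3*b4 + b2*b3*b4.
Let P := b1*b2*b3*b4.
Let X := y * P / q.
Let w2 := y^+2 * P / q.
Let lam := X / E.
Let Z := q * w2 / E.
Let N K := (1-b1*K)*(1-b2*K)*(1-b3*K)*(1-b4*K).
Let D K := (1-X*K/b1)*(1-X*K/b2)*(1-X*K/b3)*(1-X*K/b4).
Let sig K := (1-y^+2*P) + X*K*(y^+2*e3-y*e1) + X^+2*K^+2*y*(1-y^+2*P).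
Let M K := lam*((y+K^+2)*(1-y^+2*P) + y*K*(y*e3-e1)).
Let P6 := (1-y*b1*b2)*(1-y*b1*b3)*(1-y*b1*b4)*(1-y*b2*b3)*(1-y*b2*b4)*(1-y*b3*b4).
Let Vn := (X * e3 / P + Z / q * e1) * (1 + w2) - (1+q)/q * w2 * (q * lam * e3 / P + e1).

(** Together with the next identity this expresses the auxiliary M K in two ways. *)
Lemma cert_quartic_identity K :
  Z / q * N K * sig (q * K) + lam * P6 * K^+2 * (1 - q * X * K^+2)
  = D (q * K) * M K.
Proof.
rewrite /Z /N /sig /P6 /D /M /lam /w2 /X /e1 /e3 /P. field.
by rewrite q0 E0 b10 b20 b30 b40.
Qed.

Lemma cert_quadratic_identity K :
  (1-Z/q)*(1-q*w2)*(D K-(w2/q)*N K) + (1-w2/q)*(1-X*K)*(1-E*K)*M K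
  + (Vn - (lam+1)*(1-w2/q)*(1-q*w2))*(1-w2)*K*(1-X*K^+2)
  = (1-w2/q)*(1-K)*(1-lam*K)*sig K.
Proof.
rewrite /Vn /Z /N /sig /D /M /lam /w2 /X /e1 /e3 /P. field.
by rewrite q0 E0 b10 b20 b30 b40.
Qed.

Hypotheses (hw1 : 1 - w2 != 0) (hwm : q - w2 != 0) (hwp : 1 - q*w2 != 0).

Let c3 := Vn / ((1-w2/q)*(1-q*w2)) - (lam+1).

(** Elimination of M K from the two preceding identities. *)
Lemma cert_identity K (hDq : D (q*K) != 0) :
  (1-Z/q)/((1-w2/q)*(1-w2))*D K
  + lam*P6/((1-w2)*(1-q*w2))*(1-q*X*K^+2)*K^+2*(1-X*K)*(1-E*K)/D (q*K)
  + c3*K*(1-X*K^+2)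
  = Z/q*N K*(E/q/((1-w2/q)*(1-w2))*(1-Z/q)
             - (1-X*K)*(1-E*K)*sig (q*K)/((1-w2)*(1-q*w2))/D (q*K))
  + (1-K)*(1-lam*K)*sig K/((1-w2)*(1-q*w2)).
Proof.
have h2 := cert_quadratic_identity K; have hs := cert_quartic_identity K.
have hm : M K = (Z / q * N K * sig (q * K) + lam * P6 * K^+2 * (1 - q * X * K^+2)) / D (q*K).
  by rewrite hs mulrAC divff // mul1r.
rewrite hm in h2.
rewrite (cert_identity_algebra (D K) (N K) (sig (q*K)) Vn lam P6 X K q0 E0 hDq hw1 hwm hwp) h2; congr (_ + _).
field; by rewrite hw1 hwm hwp q0.
Qed.

(** The ratios of shifted products enter as variables constrained by the
    equations that relate them to one another, so that the identity is one of
    rational functions. *)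
Lemma cert_step (K x0 xm xp em e0 ep ep1 d0 dm dp c zt be : F) :
  let u := x0*be*zt/((1-X)*c*d0) in
  let u' := x0*(1-X*K)*(be*N K)*(zt*Z)/((1-X)*(c*((1-q*K)*(1-q*lam*K)))*(d0*D (q*K))) in
  let C K u e0 e := u/K*(E/q/((1-w2/q)*(1-w2))*(1-Z/q)*D K*(1-K)*(1-lam*K)*e/(1-X*K/q)
     - (1-K)*(1-lam*K)*sig K*e0/((1-w2)*(1-q*w2))) in
  K != 0 -> 1 - X != 0 -> q - X != 0 -> q - X*K != 0 -> 1 - q*X != 0 -> 
  1 - X*K != 0 -> 1 - q*K != 0 -> 1 - q*lam*K != 0 -> c != 0 -> d0 != 0 -> 
  dm != 0 -> dp != 0 -> D K != 0 -> D (q*K) != 0 -> D 1 != 0 -> D q != 0 ->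
  xm*(1-X*K/q) = (1-X/q)*x0 -> xp*(1-X) = x0*(1-X*K) ->
  dm*D K = D 1*d0 -> dp*D q = d0*D (q*K) ->
  (1-E)*ep = e0*(1-E*K) ->
  em*(1-X*K^+2/q) + E/q*(1-K)*(1-lam*K)*ep1 = (1-X*K/q)*e0 ->
  (1-Z/q)*D 1/((1-w2/q)*(1-w2)*(1-X))*((1-X*K^+2/q)/(1-X/q)*(xm*em*be*(zt/K)/(c*dm)))
  + lam*(1-E)*P6*(1-q*X)/((1-w2)*(1-q*w2)*D q)*((1-q*X*K^+2)/(1-q*X)*(xp*ep*be*(zt*K)/(c*dp)))
  + c3*((1-X*K^+2)/(1-X)*(x0*e0*be*zt/(c*d0)))
  = C (q*K) u' (e0*(1-E*K)) e0 - C K u e0 ep1.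
Proof.
move=> u u' C K0 hX hXm hXKm hXp hXK hK hl c0 d00 dm0 dp0 hD hDq hD1 hDqq hxm hxp hdm hdp he he1.
have hXm' : 1 - X/q != 0 by rewrite -(divff q0) -mulrBl mulf_neq0 ?invr_eq0.
have hXKm' : 1 - X*K/q != 0 by rewrite -(divff q0) -mulrBl mulf_neq0 ?invr_eq0.
have Exm : xm = (1-X/q)*x0/(1-X*K/q) by rewrite -hxm mulfK.
have Exp : xp = x0*(1-X*K)/(1-X) by rewrite -hxp mulfK.
have Edm : dm = D 1*d0/D K by rewrite -hdm mulfK.
have Edp : dp = d0*D (q*K)/D q by rewrite -hdp mulfK.
have Eem : em*(1-X*K^+2/q) = (1-X*K/q)*e0 - E/q*(1-K)*(1-lam*K)*ep1 by rewrite -he1 addrK.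
have id := cert_identity hDq.
have E1 : (1-Z/q)*D 1/((1-w2/q)*(1-w2)*(1-X))*((1-X*K^+2/q)/(1-X/q)*(xm*em*be*(zt/K)/(c*dm)))
  = (em*(1-X*K^+2/q)) * ((1-Z/q)/((1-w2/q)*(1-w2))*D K*u/K/(1-X*K/q)).
  rewrite Exm Edm /u; move: (D K) (D 1) hD hD1 => dK d1 hD hD1.
  field; by rewrite d00 c0 hD hD1 hX K0 hw1 hwm q0 hXm hXKm.
have E2 : lam*(1-E)*P6*(1-q*X)/((1-w2)*(1-q*w2)*D q)*((1-q*X*K^+2)/(1-q*X)*(xp*ep*be*(zt*K)/(c*dp)))
  = ((1-E)*ep) * (lam*P6/((1-w2)*(1-q*w2))*(1-q*X*K^+2)*K*(1-X*K)/D (q*K)*u).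
  rewrite Exp Edp /u; move: (D (q*K)) (D q) hDq hDqq => dK d1 hD' hD1'.
  field; by rewrite d00 c0 hD' hD1' hX hw1 hwp hXp.
have E3 : (1-X*K^+2)/(1-X)*(x0*e0*be*zt/(c*d0)) = (1-X*K^+2)*u*e0.
  rewrite /u; field; by rewrite d00 c0 hX.
rewrite E1 E2 E3 Eem he.
have Eu' : u' = u * (1-X*K)*N K*Z/((1-q*K)*(1-q*lam*K)*D (q*K)).
  rewrite /u' /u; move: (D (q*K)) (N K) hDq => dK nK hD'.
  field; by rewrite d00 c0 hX hD' hK hl.
have -> : C (q*K) u' (e0*(1-E*K)) e0 = u/K*e0*(Z/q*N K*(E/q/((1-w2/q)*(1-w2))*(1-Z/q)
             - (1-X*K)*(1-E*K)*sig (q*K)/((1-w2)*(1-q*w2))/D (q*K))).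
  rewrite /C Eu'; clear E1 E2 E3 Eu'; clearbody u; move: (D (q*K)) (N K) (sig (q*K)) u hDq => dK nK sK uu hD'.
  field.
  by rewrite hD' hK hl K0 q0 hwp hw1 hwm hXK.
rewrite [X in _ = X - _](_ : _ = u/K*e0*((Z/q*N K*(E/q/((1-w2/q)*(1-w2))*(1-Z/q)
             - (1-X*K)*(1-E*K)*sig (q*K)/((1-w2)*(1-q*w2))/D (q*K))
  + (1-K)*(1-lam*K)*sig K/((1-w2)*(1-q*w2))) - (1-K)*(1-lam*K)*sig K/((1-w2)*(1-q*w2)))); last by rewrite addrK.
rewrite -id /C.
clear E1 E2 E3 Eu'; move: (D (q*K)) (D K) (sig K) u c3 hDq P6 => dK dK' sK uu c3' hD' p6.
field.
by rewrite hD' K0 q0 hwp hw1 hwm hXKm.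
Qed.

Definition poch (u : F) (k : nat) : F := \prod_(n < k) (1 - u * q ^+ n).

Lemma pochS u k : poch u k.+1 = poch u k * (1 - u * q ^+ k).
Proof. by rewrite /poch big_ord_recr. Qed.

Lemma poch0 u : poch u 0 = 1. Proof. by rewrite /poch big_ord0. Qed.

Lemma poch_shift u k : (1 - u) * poch (q * u) k = poch u k * (1 - u * q ^+ k).
Proof.
elim: k => [|k IH]; first by rewrite !poch0 expr0; ring.
rewrite !pochS mulrA IH exprS; ring.
Qed.

(** The k-th term of the very-well-poised series. *)
Definition vwp_term (a0 a1 a2 a3 a4 a5 z : F) (k : nat) : F :=
  let us := [:: a1; a2; a3; a4; a5] in
  (1 - a0 * q ^+ k.*2) / (1 - a0)
  * (\prod_(u <- a0 :: us) poch u k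
     / \prod_(u <- q :: [seq q * a0 / u | u <- us]) poch u k) * z ^+ k.

Definition certU n := poch X n * (poch b1 n * poch b2 n * poch b3 n * poch b4 n) * Z ^+ n
  / ((1-X)*(poch q n * poch (q*lam) n)
     * (poch (q*X/b1) n * poch (q*X/b2) n * poch (q*X/b3) n * poch (q*X/b4) n)).

(** The rational multiple of a term whose difference is the combination of terms
    in vwp_telescope; the factor 1 - q^n makes it vanish at n = 0. *)
Definition certC n := certU n / q^+n *
  (E/q/((1-w2/q)*(1-w2))*(1-Z/q)*D (q^+n)*(1-q^+n)*(1-lam*q^+n)*poch E n.-1/(1-X*q^+n/q)
     - (1-q^+n)*(1-lam*q^+n)*sig (q^+n)*poch E n/((1-w2)*(1-q*w2))).

Hypotheses (hX : forall n, 1 - X/q*q^+n != 0) (hq : forall n, 1 - q^+n.+1 != 0)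
  (hl : forall n, 1 - q*lam*q^+n != 0)
  (hb1 : forall n, 1 - X/b1*q^+n != 0) (hb2 : forall n, 1 - X/b2*q^+n != 0)
  (hb3 : forall n, 1 - X/b3*q^+n != 0) (hb4 : forall n, 1 - X/b4*q^+n != 0).

Lemma poch_neq0 u n : (forall n, 1 - u * q ^+ n != 0) -> poch u n != 0.
Proof. by move=> h; rewrite /poch prodf_seq_neq0; apply/allP => i _; rewrite h implybT. Qed.

Lemma poch_shift_down u k : (1 - u/q) * poch u k = poch (u/q) k * (1 - u/q * q ^+ k).
Proof. by rewrite -poch_shift; congr (_ * poch _ _); field. Qed.

Lemma cert_poch_identity n : poch (E/q) n * (1-X*(q^+n)^+2/q) + E/q*(1-q^+n)*(1-lam*q^+n)*poch E n.-1
  = (1-X*q^+n/q)*poch E n.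
Proof.
case: n => [|n]; first by rewrite !poch0 expr0; field.
rewrite [n.+1.-1]/=.
have -> : poch (E/q) n.+1 = (1-E/q)*poch E n.
  by rewrite poch_shift_down pochS.
rewrite pochS (exprS q n) /lam. field. by rewrite E0 q0.
Qed.

Lemma vwp_termE a0 c1 c2 c3' c4 c5 z k :
  vwp_term a0 c1 c2 c3' c4 c5 z k = (1-a0*(q^+k)^+2)/(1-a0) *
    (poch a0 k * poch c5 k * (poch c1 k * poch c2 k * poch c3' k * poch c4 k) * z ^+ k
    / ((poch q k * poch (q*a0/c5) k)
       * (poch (q*a0/c1) k * poch (q*a0/c2) k * poch (q*a0/c3') k * poch (q*a0/c4) k))).
Proof.
rewrite /vwp_term /= !big_cons !big_nil !mulr1 -muln2 exprM.
rewrite -mulrA; congr (_ * _); rewrite mulrAC; congr (_ / _); ring.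
Qed.

(** The three series have X, E and Z multiplied by 1/q, 1 and q. Their terms are
    rational multiples of one another, and the claim reduces to cert_step with
    K = q^n. *)
Lemma vwp_telescope n :
  (1-Z/q)*D 1/((1-w2/q)*(1-w2)*(1-X)) * vwp_term (X/q) b1 b2 b3 b4 (E/q) (Z/q) n
  + lam*(1-E)*P6*(1-q*X)/((1-w2)*(1-q*w2)*D q) * vwp_term (q*X) b1 b2 b3 b4 (q*E) (q*Z) n
  + c3 * vwp_term X b1 b2 b3 b4 E Z n
  = certC n.+1 - certC n.
Proof.
have qn0 n' : q^+n' != 0 by rewrite expf_neq0.
have hXn m : 1 - X*q^+m != 0 by have := hX m.+1; rewrite exprS mulrA mulfVK.
have hDn m : D (q^+m) != 0.
  rewrite /D !mulf_neq0 //; rewrite mulrAC; by [exact: hb1|exact: hb2|exact: hb3|exact: hb4].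
have X1 : 1 - X != 0 by have := hXn 0%N; rewrite expr0 mulr1.
have Xm : q - X != 0.
  have := hX 0%N; rewrite expr0 mulr1; apply: contraNneq => /eqP; rewrite subr_eq0 => /eqP <-.
  by rewrite divff // subrr.
have XKm : q - X*q^+n != 0.
  have := hX n; apply: contraNneq => /eqP; rewrite subr_eq0 => /eqP e.
  by rewrite (_ : X/q*q^+n = X*q^+n/q) ?[X/q*_]mulrAC // -e divff // subrr.
have Xp : 1 - q*X != 0 by have := hXn 1%N; rewrite expr1 mulrC.
have hqb m : forall b, (forall n, 1 - X/b*q^+n != 0) ->
    poch (X/b) m != 0 /\ poch (q*X/b) m != 0 /\ poch (q*(q*X)/b) m != 0.
  move=> b hb; split; first exact: poch_neq0.
  split; apply: poch_neq0 => k.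
    by have := hb k.+1; rewrite exprS; congr (_ != _); ring.
  by have := hb k.+2; rewrite !exprS; congr (_ != _); ring.
have st := @cert_step (q^+n) (poch X n) (poch (X/q) n) (poch (q*X) n) (poch (E/q) n) (poch E n)
  (poch (q*E) n) (poch E n.-1) 
  (poch (q*X/b1) n * poch (q*X/b2) n * poch (q*X/b3) n * poch (q*X/b4) n)
  (poch (X/b1) n * poch (X/b2) n * poch (X/b3) n * poch (X/b4) n)
  (poch (q*(q*X)/b1) n * poch (q*(q*X)/b2) n * poch (q*(q*X)/b3) n * poch (q*(q*X)/b4) n)
  (poch q n * poch (q*lam) n) (Z^+n) (poch b1 n * poch b2 n * poch b3 n * poch b4 n).
have shb b : poch (X/b) n * (1 - X*q^+n/b) = (1-X*1/b) * poch (q*X/b) n.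
  by rewrite -[q*X/b]mulrA mulr1 poch_shift; congr (_ * (1 - _)); rewrite mulrAC.
have shb2 b : poch (q*(q*X)/b) n * (1 - X*q/b) = poch (q*X/b) n * (1 - X*(q*q^+n)/b).
  have := poch_shift (q*X/b) n.
  rewrite (_ : q*(q*X/b) = q*(q*X)/b); last by rewrite !mulrA.
  rewrite mulrC => h; rewrite (_ : X*q/b = q*X/b); last by rewrite [X*q]mulrC.
  by rewrite h; congr (_ * (1 - _)); rewrite mulrA [X*q]mulrC mulrAC.
have [h11 [h12 h13]] := hqb n _ hb1.
have [h21 [h22 h23]] := hqb n _ hb2.
have [h31 [h32 h33]] := hqb n _ hb3.
have [h41 [h42 h43]] := hqb n _ hb4.
have hql : q * lam = q * X / E by rewrite /lam mulrA.
have {}st := st (qn0 n) X1 Xm XKm Xp (hXn n).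
rewrite -exprS in st.
have hqlK : 1 - q*lam*q^+n != 0 by [].
have {}st := st (hq n) hqlK.
have hc : poch q n * poch (q*lam) n != 0.
  rewrite mulf_neq0 //; apply: poch_neq0 => // k.
  by rewrite -exprS.
have D1 : D 1 != 0 by have := hDn 0%N; rewrite expr0.
have Dq : D q != 0 by have := hDn 1%N; rewrite expr1.
have {}st := st hc.
have {}st := st (mulf_neq0 (mulf_neq0 (mulf_neq0 h12 h22) h32) h42).
have {}st := st (mulf_neq0 (mulf_neq0 (mulf_neq0 h11 h21) h31) h41).
have {}st := st (mulf_neq0 (mulf_neq0 (mulf_neq0 h13 h23) h33) h43).
have {}st := st (hDn n) (hDn n.+1) D1 Dq.
have tel x : poch (x/q) n * (1 - x*q^+n/q) = (1-x/q)*poch x n.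
  by rewrite poch_shift_down // [x/q*_]mulrAC.
have {}st := st (tel X).
have {}st := st (etrans (mulrC _ _) (poch_shift X n)).
have mul4 (x1 x2 x3 x4 y1 y2 y3 y4 u1 u2 u3 u4 v1 v2 v3 v4 : F) :
  x1*y1=u1*v1 -> x2*y2=u2*v2 -> x3*y3=u3*v3 -> x4*y4=u4*v4 ->
  x1*x2*x3*x4*(y1*y2*y3*y4) = u1*u2*u3*u4*(v1*v2*v3*v4).
  move=> h1 h2 h3 h4; transitivity ((x1*y1)*(x2*y2)*(x3*y3)*(x4*y4)); first by ring.
  by rewrite h1 h2 h3 h4; ring.
have {}st := st (mul4 _ _ _ _ _ _ _ _ _ _ _ _ _ _ _ _ (shb b1) (shb b2) (shb b3) (shb b4)).
rewrite exprS in st.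
have {}st := st (mul4 _ _ _ _ _ _ _ _ _ _ _ _ _ _ _ _ (shb2 b1) (shb2 b2) (shb2 b3) (shb2 b4)).
have {}st := st (poch_shift E n) (cert_poch_identity n).
rewrite !vwp_termE.
have a1 : q * (X/q) / (E/q) = q*lam by rewrite /lam; field; rewrite q0 E0.
have a2 : q * (q*X) / (q*E) = q*lam by rewrite /lam; field; rewrite q0 E0.
have a3 b : q*(X/q)/b = X/b by rewrite [X/q]mulrC mulVKf.
rewrite a1 a2 -hql !a3 (expr_div_n Z q n) (exprMn n q Z).
have a4 m : X/q * m = X * m/q by rewrite mulrAC.
rewrite a4 [q^+n*Z^+n]mulrC st; congr (_ - _).
have U1 : certU n.+1 = poch X n * (1 - X * q ^+ n) *
  (poch b1 n * poch b2 n * poch b3 n * poch b4 n * N (q ^+ n)) * (Z ^+ n * Z) /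
  ((1 - X) * (poch q n * poch (q * lam) n * ((1 - q * q ^+ n) * (1 - q * lam * q ^+ n))) *
   (poch (q * X / b1) n * poch (q * X / b2) n * poch (q * X / b3) n *
    poch (q * X / b4) n * D (q * q ^+ n))).
  rewrite /certU !pochS exprSr; congr (_ / _); first by rewrite /N; ring.
  have a5 b : 1 - q*X/b*q^+n = 1 - X*(q*q^+n)/b.
    by congr (1 - _); rewrite mulrA [X*q]mulrC mulrAC.
  by rewrite !a5 /D; move: (q*q^+n) => t; ring.
by rewrite /certC U1 -[q*q^+n]exprS [poch E n.+1]pochS.
Qed.

Lemma certC0 : certC 0 = 0.
Proof. by rewrite /certC expr0 subrr !(mulr0, mul0r) subrr mulr0. Qed.

Lemma vwp_partial_sum n :
  (1-Z/q)*D 1/((1-w2/q)*(1-w2)*(1-X)) * \sum_(k < n) vwp_term (X/q) b1 b2 b3 b4 (E/q) (Z/q) k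
  + lam*(1-E)*P6*(1-q*X)/((1-w2)*(1-q*w2)*D q)
    * \sum_(k < n) vwp_term (q*X) b1 b2 b3 b4 (q*E) (q*Z) k
  + c3 * \sum_(k < n) vwp_term X b1 b2 b3 b4 E Z k
  = certC n.
Proof.
rewrite !mulr_sumr -!big_split /=.
under eq_bigr do rewrite vwp_telescope.
by rewrite -(big_mkord xpredT (fun i => certC i.+1 - certC i)) telescope_sumr // certC0 subr0.
Qed.
End Cert.

Section Contiguous.
Variable F : fieldType.
Variables q E y b1 b2 b3 b4 X w2 lam Z : F.
Hypotheses (q0 : q != 0) (E0 : E != 0) (b10 : b1 != 0) (b20 : b2 != 0)
  (b30 : b3 != 0) (b40 : b4 != 0).
Let e1 := b1 + b2 + b3 + b4.
Let e3 := b1*b2*b3 + b1*b2*b4 + b1*b3*b4 + b2*b3*b4.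
Let P := b1*b2*b3*b4.
Hypotheses (hX : X = y * P / q) (hw2 : w2 = y^+2 * P / q) (hlam : lam = X / E)
  (hZ : Z = q * w2 / E).
Let D K := (1-X*K/b1)*(1-X*K/b2)*(1-X*K/b3)*(1-X*K/b4).
Let P6 := (1-y*b1*b2)*(1-y*b1*b3)*(1-y*b1*b4)*(1-y*b2*b3)*(1-y*b2*b4)*(1-y*b3*b4).
Let Vn := (X * e3 / P + Z / q * e1) * (1 + w2) - (1+q)/q * w2 * (q * lam * e3 / P + e1).
Hypotheses (hw1 : 1 - w2 != 0) (hwm : q - w2 != 0) (hwp : 1 - q*w2 != 0).
Hypotheses (gX : forall n, 1 - X/q*q^+n != 0) (gq : forall n, 1 - q^+n.+1 != 0)
  (gl : forall n, 1 - q*lam*q^+n != 0)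
  (gb1 : forall n, 1 - X/b1*q^+n != 0) (gb2 : forall n, 1 - X/b2*q^+n != 0)
  (gb3 : forall n, 1 - X/b3*q^+n != 0) (gb4 : forall n, 1 - X/b4*q^+n != 0).

(** Here X, w2, lam and Z are variables subject to equations, so that expressions
    in other parameters can be matched with them. *)
Lemma vwp_contiguous_sum n :
  (1-Z/q)*D 1/((1-w2/q)*(1-w2)*(1-X)) * \sum_(k < n) vwp_term q (X/q) b1 b2 b3 b4 (E/q) (Z/q) k
  + lam*(1-E)*P6*(1-q*X)/((1-w2)*(1-q*w2)*D q)
    * \sum_(k < n) vwp_term q (q*X) b1 b2 b3 b4 (q*E) (q*Z) k
  + (Vn / ((1-w2/q)*(1-q*w2)) - (lam+1)) * \sum_(k < n) vwp_term q X b1 b2 b3 b4 E Z k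
  = poch q X n * (poch q b1 n * poch q b2 n * poch q b3 n * poch q b4 n) * Z ^+ n
    / ((1-X)*(poch q q n * poch q (q*lam) n)
     * (poch q (q*X/b1) n * poch q (q*X/b2) n * poch q (q*X/b3) n * poch q (q*X/b4) n)) / q^+n
    * (E/q/((1-w2/q)*(1-w2))*(1-Z/q)*D (q^+n)*(1-q^+n)*(1-lam*q^+n)*poch q E n.-1/(1-X*q^+n/q)
     - (1-q^+n)*(1-lam*q^+n)
       *((1-y^+2*P) + X*q^+n*(y^+2*e3-y*e1) + X^+2*(q^+n)^+2*y*(1-y^+2*P))
       *poch q E n/((1-w2)*(1-q*w2))).
Proof.
rewrite /Vn /D /P6.
move: hw1 hwm hwp gX gl gb1 gb2 gb3 gb4.
rewrite hZ hlam hw2 hX => *.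
exact: vwp_partial_sum.
Qed.
End Contiguous.

(** * The Askey-Wilson function in the dual variable *)

Lemma mul5_rearrange (F : comNzRingType) (x n t u d : F) : x * (n * (t * u) * d) = x * (n * d) * t * u.
Proof. by ring. Qed.

Lemma prefactor_rearrange (F : fieldType)
  (x1 x2 x3 x4 x5 y1 y2 y3 y4 y5 u1 u2 u3 v1 v2 : F) :
  x1 * y1 * (x2 * y2 * (x3 * y3 * (x4 * y4 * (x5 * y5)))) / (u1 * u2 * v1 * (u3 * v2))
  = x1 * x2 * x3 * x4 * x5 / (u1 * u2 * u3) * (y1 * (y2 * (y3 * (y4 * y5))) / (v1 * v2)).
Proof. rewrite !invfM; ring. Qed.

Lemma cert_rearrange (F : fieldType)
  (u T Q den k d q1 q2 p r y1 X y2 Q' y3 y4 p' k2 : F) : Q != 0 ->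
  u * (T * Q) / den / Q * (k * d * q1 * q2 * p / r
    - q1 * q2 * (y1 + X * Q' * y2 + X ^+ 2 * Q' ^+ 2 * y3 * y4) * p' / k2)
  = u / den * (k * (d * q1 * q2 * p * r^-1)
    + - (q1 * q2 * (y1 + X * y2 * Q' + X ^+ 2 * y3 * y4 * Q' ^+ 2) * p' * k2^-1)) * T.
Proof.
move=> Q0; have -> : u * (T * Q) / den / Q = u / den * T.
  by rewrite mulrA [u * T * Q / den]mulrAC mulfK // mulrAC.
ring.
Qed.

Section DualOperator.
Variable F : fieldType.
Implicit Types q a b c d t w z : F.

(** Together with dualV, the coefficients of the difference equation in the dual
    variable, normalised to be 1 and 0 at w = 0. *)
Definition dualPsi q a b c d t w : F :=
  (1 - t * w) * (1 - q * w / t) * (1 - a * b / t * w) * (1 - q * w / (a * b / t))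
  * (1 - a * c / t * w) * (1 - q * w / (a * c / t))
  * (1 - a * d / t * w) * (1 - q * w / (a * d / t))
  / ((1 - w ^+ 2) * (1 - q * w ^+ 2) ^+ 2 * (1 - q ^+ 2 * w ^+ 2)).

Definition dualV1 a b c d t : F :=
  (a / t + t / a) + (b / t + t / b) + (c / t + t / c) + (d / t + t / d).

Definition dualV2 q a b c d : F :=
  - (1 + q) / q * (a + b + c + d + q * (a^-1 + b^-1 + c^-1 + d^-1)).

Definition dualV q (v1 v2 : F) w : F :=
  w * (v1 * (1 + w ^+ 2) + v2 * w) / ((1 - w ^+ 2 / q) * (1 - q * w ^+ 2)).

End DualOperator.

(** The coefficient of the contiguous relation in the parameters of the
    Askey-Wilson function. *)
Lemma dualV_cert (F : fieldType) (q a b c d t z W : F) :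
  q != 0 -> a != 0 -> b != 0 -> c != 0 -> d != 0 -> t != 0 -> z != 0 ->
  let X := q * z ^+ 2 * W / t in
  let b1 := q * z / a in let b2 := q * z / b in
  let b3 := q * z / c in let b4 := q * z / d in
  let e1 := b1 + b2 + b3 + b4 in
  let e3 := b1*b2*b3 + b1*b2*b4 + b1*b3*b4 + b2*b3*b4 in
  (X * e3 / (b1*b2*b3*b4) + t * (W / q) * e1) * (1 + W^+2)
     - (1+q)/q * W^+2 * (q * z^+2 * e3 / (b1*b2*b3*b4) + e1)
  = z * (W * (dualV1 a b c d t * (1 + W ^+ 2) + dualV2 q a b c d * W)).
Proof.
move=> q0 a0 b0 c0 d0 t0 z0 X b1 b2 b3 b4 e1 e3.
rewrite /e1 /e3 /b1 /b2 /b3 /b4 /X /dualV1 /dualV2; field.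
by rewrite q0 a0 b0 c0 d0 t0 z0.
Qed.

(** Of the six pairs of numerator parameters in P6, three give the factors
    1 - q w t / (a b) and the like, and the complementary three give the factors
    1 - a b w / t, because a b c d = q t^2. *)
Lemma dualPsi_cert (F : fieldType) (q a b c d t z W : F) :
  q != 0 -> a != 0 -> b != 0 -> c != 0 -> d != 0 -> t != 0 -> z != 0 ->
  t ^+ 2 * q = a * b * c * d ->
  let y := t * (W / q) / z ^+ 2 in
  let b1 := q * z / a in let b2 := q * z / b in
  let b3 := q * z / c in let b4 := q * z / d in
  let P6 := (1-y*b1*b2)*(1-y*b1*b3)*(1-y*b1*b4)*(1-y*b2*b3)*(1-y*b2*b4)*(1-y*b3*b4) in
  dualPsi q a b c d t W =
  (1 - t * W) * (1 - q * W / t) * P6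
  / ((1 - W ^+ 2) * (1 - q * W ^+ 2) ^+ 2 * (1 - q ^+ 2 * W ^+ 2)).
Proof.
move=> q0 a0 b0 c0 d0 t0 z0 habcd y b1 b2 b3 b4 P6.
have lo u v : u != 0 -> v != 0 -> y * (q * z / u) * (q * z / v) = q * W / (u * v / t).
  by move=> u0 v0; rewrite /y; field; rewrite q0 u0 v0 t0 z0.
have up u v u' v' : u != 0 -> v != 0 -> t ^+ 2 * q = u' * v' * u * v ->
    y * (q * z / u) * (q * z / v) = u' * v' / t * W.
  move=> u0 v0 h; transitivity ((t ^+ 2 * q) / (u * v) / t * W).
    by rewrite /y; field; rewrite q0 u0 v0 t0 z0.
  by rewrite h; field; rewrite u0 v0 t0.
rewrite /dualPsi /P6 /b1 /b2 /b3 /b4 !lo //.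
rewrite -[q * W / (b * c / t)]lo // -[q * W / (b * d / t)]lo // -[q * W / (c * d / t)]lo //.
rewrite (up b c a d) ?(up b d a c) ?(up c d a b) //; try by rewrite habcd; ring.
congr (_ / _); ring.
Qed.

Lemma recurrence_assembly (F : fieldType) (q z t W x1 x2 x3 x4 X P6 N D2 p1 s0 s1 s2 : F) :
  q != 0 -> z != 0 -> 1 - t * W != 0 -> 1 - W ^+ 2 != 0 -> q - W ^+ 2 != 0 ->
  1 - q * W ^+ 2 != 0 -> 1 - q ^+ 2 * W ^+ 2 != 0 -> 1 - X != 0 -> 1 - q * X != 0 ->
  1 - q * x1 != 0 -> 1 - q * x2 != 0 -> 1 - q * x3 != 0 -> 1 - q * x4 != 0 ->
  (1 - t * (W / q)) * ((1 - x1) * (1 - x2) * (1 - x3) * (1 - x4))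
    / ((1 - W ^+ 2 / q) * (1 - W ^+ 2) * (1 - X)) * s0
  + z ^+ 2 * D2 * P6 * (1 - q * X) / ((1 - W ^+ 2) * (1 - q * W ^+ 2)
      * ((1 - q * x1) * (1 - q * x2) * (1 - q * x3) * (1 - q * x4))) * s2
  + (z * N / ((1 - W ^+ 2 / q) * (1 - q * W ^+ 2)) - (z ^+ 2 + 1)) * s1 = 0 ->
  let p0 := (1 - t * W) * (1 - q * x1) * (1 - q * x2) * (1 - q * x3) * (1 - q * x4)
     / ((1 - q * W ^+ 2) * (1 - q ^+ 2 * W ^+ 2) * (1 - q * X)) * p1 in
  (1 - t * (W / q)) * (1 - x1) * (1 - x2) * (1 - x3) * (1 - x4)
    / ((1 - W ^+ 2 / q) * (1 - W ^+ 2) * (1 - X)) * p0 * s0 / z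
  + z * ((1 - t * W) * D2 * P6 / ((1 - W ^+ 2) * (1 - q * W ^+ 2) ^+ 2 * (1 - q ^+ 2 * W ^+ 2)))
    * (p1 * s2)
  + N / ((1 - W ^+ 2 / q) * (1 - q * W ^+ 2)) * (p0 * s1) = (z + z^-1) * (p0 * s1).
Proof.
move=> q0 z0 h1 h2 h3 h4 h5 h6 h7 h8 h9 h10 h11.
move=> H p0; apply/eqP; rewrite -subr_eq0; apply/eqP.
match type of H with ?S = _ => transitivity (p0 / z * S) end; last by rewrite H mulr0.
rewrite /p0; field.
by rewrite exprMn q0 z0 h2 h3 h4 h5 h6 h7 h8 h9 h10 h11.
Qed.

Section AWfunction.
Variables (R : realType) (q : R).
Hypotheses (q0 : 0 < q) (q1 : q < 1).
Local Notation C := (Cplx R).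
Local Notation qC := (q%:C : C).
Variables (a b c d t : C).
Hypotheses (a0 : a != 0) (b0 : b != 0) (c0 : c != 0) (d0 : d != 0) (t0 : t != 0).
Hypothesis (habcd : t ^+ 2 * qC = a * b * c * d).

Definition AWprefactor (z w : C) : C :=
  qpochsoo q [:: t * w; qC * a * z * w / t; qC * b * z * w / t;
                 qC * c * z * w / t; qC * d * z * w / t]
  / qpochsoo q [:: qC * w ^+ 2; qC ^+ 2 * z ^+ 2 * w / t].

Definition AWseries (z w : C) : C :=
  W87 q (qC * z ^+ 2 * w / t) (qC * z / a) (qC * z / b) (qC * z / c) (qC * z / d)
    (qC * w / t) (t * w).

(** The function psi without the factor q^(x xh). The parameter t is the dual of
    a, and a, b, c, d may be any complex numbers with a b c d = q t^2. *)
Definition AWred (z w : C) : C := AWprefactor z w * AWseries z w.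

Definition AWgen (z w : C) := modulus (t * w) < 1 /\
  forall (u : C) (n : nat),
    u \in [:: qC * z ^+ 2 * w / t; qC * w ^+ 2;
              qC * a * z * w / t; qC * b * z * w / t;
              qC * c * z * w / t; qC * d * z * w / t; qC * z ^+ 2] ->
    1 - u * qC ^+ n != 0.

Let qn0 := qC_neq0 q0.

Definition AWterm (z w : C) (k : nat) : C :=
  vwp_term qC (qC * z ^+ 2 * w / t) (qC * z / a) (qC * z / b) (qC * z / c) (qC * z / d)
    (qC * w / t) (t * w) k.

(** Multiplying w by q^n moves each excluded u along its own q-orbit. *)
Lemma AWgen_orbit z w n : AWgen z w -> AWgen z (w * qC ^+ n).
Proof.
move=> [h1 h2]; split.
  rewrite mulrA modulusM (modulus_qX q0); apply: le_lt_trans h1.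
  by rewrite ler_piMr ?modulus_ge0 // (qX_le1 q0 q1).
move=> u m; rewrite !inE => /or4P[/eqP->|/eqP->|/eqP->|/or4P[/eqP->|/eqP->|/eqP->|/eqP->]].
- have := h2 (qC * z ^+ 2 * w / t) (n + m)%N; rewrite !inE eqxx /= => /(_ isT).
  by rewrite exprD; congr (_ != _); ring.
- have := h2 (qC * w ^+ 2) (n + n + m)%N; rewrite !inE eqxx ?orbT /= => /(_ isT).
  by rewrite !exprD; congr (_ != _); ring.
- have := h2 (qC * a * z * w / t) (n + m)%N; rewrite !inE eqxx ?orbT /= => /(_ isT).
  by rewrite exprD; congr (_ != _); ring.
- have := h2 (qC * b * z * w / t) (n + m)%N; rewrite !inE eqxx ?orbT /= => /(_ isT).
  by rewrite exprD; congr (_ != _); ring.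
- have := h2 (qC * c * z * w / t) (n + m)%N; rewrite !inE eqxx ?orbT /= => /(_ isT).
  by rewrite exprD; congr (_ != _); ring.
- have := h2 (qC * d * z * w / t) (n + m)%N; rewrite !inE eqxx ?orbT /= => /(_ isT).
  by rewrite exprD; congr (_ != _); ring.
- have := h2 (qC * z ^+ 2) m; rewrite !inE eqxx ?orbT /= => /(_ isT) //.
Qed.

Section Orbit.
Variables (z w : C).
Hypotheses (z0 : z != 0) (w0 : w != 0) (hg : AWgen z w).

Lemma AWgen_a0 n : 1 - qC * z ^+ 2 * w / t * qC ^+ n != 0.
Proof. by apply: hg.2; rewrite !inE eqxx. Qed.
Lemma AWgen_w2 n : 1 - qC * w ^+ 2 * qC ^+ n != 0.
Proof. by apply: hg.2; rewrite !inE eqxx ?orbT. Qed.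
Lemma AWgen_a n : 1 - qC * a * z * w / t * qC ^+ n != 0.
Proof. by apply: hg.2; rewrite !inE eqxx ?orbT. Qed.
Lemma AWgen_b n : 1 - qC * b * z * w / t * qC ^+ n != 0.
Proof. by apply: hg.2; rewrite !inE eqxx ?orbT. Qed.
Lemma AWgen_c n : 1 - qC * c * z * w / t * qC ^+ n != 0.
Proof. by apply: hg.2; rewrite !inE eqxx ?orbT. Qed.
Lemma AWgen_d n : 1 - qC * d * z * w / t * qC ^+ n != 0.
Proof. by apply: hg.2; rewrite !inE eqxx ?orbT. Qed.
Lemma AWgen_z2 n : 1 - qC * z ^+ 2 * qC ^+ n != 0.
Proof. by apply: hg.2; rewrite !inE eqxx ?orbT. Qed.

Lemma q_orbit_neq1 n : 1 - qC * qC ^+ n != 0.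
Proof.
by rewrite -exprS; apply: one_sub_neq0; rewrite (modulus_qX q0) exprn_ilt1 // ltW.
Qed.

Let A0 := qC * z ^+ 2 * w / t.
Let E0 := qC * w / t.

Lemma AWterm_orbitE k n : AWterm z (w * qC ^+ n) k =
  (1 - A0 * qC ^+ n * (qC ^+ k) ^+ 2) / (1 - A0 * qC ^+ n)
  * (poch qC (A0 * qC ^+ n) k * poch qC (E0 * qC ^+ n) k
     * (poch qC (qC * z / a) k * poch qC (qC * z / b) k * poch qC (qC * z / c) k * poch qC (qC * z / d) k)
     / ((poch qC qC k * poch qC (qC * z ^+ 2) k)
       * (poch qC (qC * a * z * w / t * qC ^+ n) k * poch qC (qC * b * z * w / t * qC ^+ n) k
         * poch qC (qC * c * z * w / t * qC ^+ n) k * poch qC (qC * d * z * w / t * qC ^+ n) k)))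
  * (t * w) ^+ k * (qC ^+ n) ^+ k.
Proof.
rewrite /AWterm vwp_termE.
have qn : qC ^+ n != 0 by rewrite expf_neq0.
have e1 : qC * z ^+ 2 * (w * qC ^+ n) / t = A0 * qC ^+ n by rewrite /A0; ring.
have e2 : qC * (w * qC ^+ n) / t = E0 * qC ^+ n by rewrite /E0; ring.
have e3 : qC * (A0 * qC ^+ n) / (E0 * qC ^+ n) = qC * z ^+ 2.
  by rewrite /A0 /E0; field; rewrite w0 qn0 t0 qn.
have e4 x : x != 0 -> qC * (A0 * qC ^+ n) / (qC * z / x) = qC * x * z * w / t * qC ^+ n.
  by move=> x0; rewrite /A0; field; rewrite x0 z0 t0 qn0.
rewrite e1 e2 e3 !e4 // [t * (w * _)]mulrA exprMn.
exact: mul5_rearrange.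
Qed.

Definition bounded2 (g : nat -> nat -> C) := exists B : R, forall k n, modulus (g k n) <= B.

Lemma bounded2M g h : bounded2 g -> bounded2 h -> bounded2 (fun k n => g k n * h k n).
Proof.
move=> [B hB] [D hD]; exists (B * D) => k n; rewrite modulusM.
by apply: ler_pM => //; exact: modulus_ge0.
Qed.

Lemma bounded2_poch (u : C) : bounded2 (fun k n => poch qC (u * qC ^+ n) k).
Proof.
exists (expR (modulus u / (1 - q))) => k n.
apply: le_trans (qpoch_le q0 q1 _ _) _; rewrite ler_expR modulusM (modulus_qX q0).
have hq1 : 0 < 1 - q by rewrite subr_gt0.
by rewrite ler_wpM2r ?invr_ge0 ?(ltW hq1) // ler_piMr ?modulus_ge0 // (qX_le1 q0 q1).
Qed.

Lemma bounded2_poch_cst (u : C) : bounded2 (fun k _ => poch qC u k).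
Proof. by exists (expR (modulus u / (1 - q))) => k n; exact: qpoch_le. Qed.

Lemma bounded2_pochV (u : C) : (forall n, 1 - u * qC ^+ n != 0) ->
  bounded2 (fun k n => (poch qC (u * qC ^+ n) k)^-1).
Proof.
move=> /(qpoch_lower q0 q1) [e e0 he]; exists e^-1 => k n.
rewrite modulusV lef_pV2 ?posrE //; first exact: he.
exact: lt_le_trans e0 (he _ _).
Qed.

Lemma bounded2_pochV_cst (u : C) : (forall n, 1 - u * qC ^+ n != 0) ->
  bounded2 (fun k _ => (poch qC u k)^-1).
Proof.
move=> /bounded2_pochV [e he]; exists e => k n.
by have := he k 0%N; rewrite expr0 mulr1.
Qed.

Lemma bounded2_1Bq (u : C) : bounded2 (fun k n => 1 - u * qC ^+ n * (qC ^+ k) ^+ 2).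
Proof.
exists (1 + modulus u) => k n; apply: le_trans (modulusB _ _) _; rewrite modulus1 lerD2l.
rewrite -exprM -mulrA -exprD modulusM (modulus_qX q0) ler_piMr ?modulus_ge0 //.
exact: (qX_le1 q0 q1).
Qed.

Lemma bounded2_1BqV (u : C) : (forall n, 1 - u * qC ^+ n != 0) ->
  bounded2 (fun k n => (1 - u * qC ^+ n)^-1).
Proof.
move=> /bounded2_pochV [e he]; exists e => k n.
by have := he 1%N n; rewrite /poch big_ord1 expr0 mulr1.
Qed.

(** All factors of a term are products that stay bounded, except for (t w)^k and
    for the factor (q^n)^k gained along the orbit. *)
Lemma AWterm_bound : exists B : R, forall k n,
  modulus (AWterm z (w * qC ^+ n) k) <= B * modulus (t * w) ^+ k * q ^+ (n * k).
Proof.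
suff [B hB] : bounded2 (fun k n =>
  (1 - A0 * qC ^+ n * (qC ^+ k) ^+ 2) / (1 - A0 * qC ^+ n)
  * (poch qC (A0 * qC ^+ n) k * poch qC (E0 * qC ^+ n) k
     * (poch qC (qC * z / a) k * poch qC (qC * z / b) k * poch qC (qC * z / c) k * poch qC (qC * z / d) k)
     / ((poch qC qC k * poch qC (qC * z ^+ 2) k)
       * (poch qC (qC * a * z * w / t * qC ^+ n) k * poch qC (qC * b * z * w / t * qC ^+ n) k
         * poch qC (qC * c * z * w / t * qC ^+ n) k * poch qC (qC * d * z * w / t * qC ^+ n) k)))).
  exists B => k n; rewrite AWterm_orbitE (modulusM _ ((qC ^+ n) ^+ k)) (modulusM _ ((t * w) ^+ k)).
  rewrite -[(qC ^+ n) ^+ k]exprM (modulus_qX q0) modulusX; apply: ler_wpM2r; first by rewrite exprn_ge0 // ltW.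
  by apply: ler_wpM2r; [rewrite exprn_ge0 // modulus_ge0|exact: hB].
have inv : bounded2 (fun k n => ((poch qC qC k * poch qC (qC * z ^+ 2) k)
       * (poch qC (qC * a * z * w / t * qC ^+ n) k * poch qC (qC * b * z * w / t * qC ^+ n) k
         * poch qC (qC * c * z * w / t * qC ^+ n) k * poch qC (qC * d * z * w / t * qC ^+ n) k))^-1).
  under [X in bounded2 X]eq_fun do under eq_fun do rewrite !invfM.
  apply: bounded2M; apply: bounded2M; try apply: bounded2M; try apply: bounded2M.
  - exact: bounded2_pochV_cst q_orbit_neq1.
  - exact: bounded2_pochV_cst AWgen_z2.
  - exact: bounded2_pochV AWgen_a.
  - exact: bounded2_pochV AWgen_b.
  - exact: bounded2_pochV AWgen_c.
  - exact: bounded2_pochV AWgen_d.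
apply: bounded2M.
  by apply: bounded2M; [exact: bounded2_1Bq|exact: bounded2_1BqV AWgen_a0].
apply: bounded2M => //; apply: bounded2M.
  by apply: bounded2M; exact: bounded2_poch.
by do !apply: bounded2M; exact: bounded2_poch_cst.
Qed.

Lemma expandable_1Bq (u : C) : expandable q (fun n => 1 - u * qC ^+ n).
Proof.
by apply: (expandableB q0 q1); [exact: expandable_cst|apply: (expandableM q0 q1);
  [exact: expandable_cst|exact: expandable_qX]].
Qed.

Lemma expandable_poch (u : C) k : expandable q (fun n => poch qC (u * qC ^+ n) k).
Proof.
apply: (expandable_prod q0 q1) => i.
apply: expandable_ext (@expandable_1Bq (u * qC ^+ i)) => n /=.
by rewrite mulrAC.
Qed.

Lemma expandable_pochV (u : C) k : (forall n, 1 - u * qC ^+ n != 0) ->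
  expandable q (fun n => (poch qC (u * qC ^+ n) k)^-1).
Proof.
move=> /(qpoch_lower q0 q1) [e e0 he].
by apply: (expandableV q0 q1 e0 _ (@expandable_poch u k)) => n; exact: he.
Qed.

Lemma expandable_AWterm k : expandable q (fun n => AWterm z (w * qC ^+ n) k).
Proof.
apply: (@expandable_ext _ q _ _ (fun n => esym (AWterm_orbitE k n))).
have cst x := @expandable_cst _ q x.
have M := @expandableM _ _ q0 q1.
have hA0 : expandable q (fun n => 1 - A0 * qC ^+ n * (qC ^+ k) ^+ 2).
  apply: expandable_ext (@expandable_1Bq (A0 * (qC ^+ k) ^+ 2)) => n.
  by rewrite [A0 * _ * _]mulrAC.
have hA0V : expandable q (fun n => (1 - A0 * qC ^+ n)^-1).
  apply: expandable_ext (@expandable_pochV A0 1 AWgen_a0) => n.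
  by rewrite /poch big_ord1 expr0 mulr1.
have hX : expandable q (fun n => (qC ^+ n) ^+ k).
  by apply: (expandableX q0 q1); exact: expandable_qX.
have up := M _ _ (M _ _ (@expandable_poch A0 k) (@expandable_poch E0 k))
  (cst (poch qC (qC * z / a) k * poch qC (qC * z / b) k * poch qC (qC * z / c) k * poch qC (qC * z / d) k)).
have lo := M _ _ (cst ((poch qC qC k * poch qC (qC * z ^+ 2) k)^-1))
  (M _ _ (M _ _ (M _ _ (expandable_pochV k AWgen_a) (expandable_pochV k AWgen_b))
    (expandable_pochV k AWgen_c)) (expandable_pochV k AWgen_d)).
have h := M _ _ (M _ _ (M _ _ (M _ _ hA0 hA0V) (M _ _ up lo)) (cst ((t * w) ^+ k))) hX.
by apply: expandable_ext h => n /=; rewrite !invfM.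
Qed.

Lemma AWseries_expandable : expandable q (fun n => AWseries z (w * qC ^+ n)).
Proof.
have [B hB] := AWterm_bound.
apply: (expandable_series q0 q1 _ expandable_AWterm hB).
by rewrite modulus_ge0 hg.1.
Qed.

Lemma AWseries_cvg1 : (fun n => AWseries z (w * qC ^+ n)) @ \oo --> (1 : C).
Proof.
have [B hB] := AWterm_bound.
have hr : 0 <= modulus (t * w) < 1 by rewrite modulus_ge0 hg.1.
have := bigOq1_cvg q0 q1 (series_remainder q0 q1 1 hr hB) => h.
apply/cvgCP => e e0; have /cvgCP /(_ _ e0) := h; apply: filterS => n.
rewrite subr0 /= big_seq1.
rewrite (_ : AWterm z (w * qC ^+ n) 0 = 1) //.
rewrite AWterm_orbitE /poch !big_ord0 !expr0 !expr1n !mulr1 divff ?AWgen_a0 //.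
by rewrite mulr1 divff // AWgen_a0.
Qed.

Lemma AWseries_cvg : cvgn (series (AWterm z w)).
Proof.
have [B hB] := AWterm_bound.
have hr : 0 <= modulus (t * w) < 1 by rewrite modulus_ge0 hg.1.
apply: (@cvg_series_geometric _ _ B (modulus (t * w)) hr) => k.
by have := hB k 0%N; rewrite expr0 mulr1 mul0n expr0 mulr1.
Qed.

Lemma AWprefactor_orbitE n : AWprefactor z (w * qC ^+ n) =
  (qpochoo q (t * w * qC ^+ n) * (qpochoo q (qC * a * z * w / t * qC ^+ n)
   * (qpochoo q (qC * b * z * w / t * qC ^+ n) * (qpochoo q (qC * c * z * w / t * qC ^+ n)
   * qpochoo q (qC * d * z * w / t * qC ^+ n)))))
  / (qpochoo q (qC * w ^+ 2 * qC ^+ n.*2) * qpochoo q (qC * A0 * qC ^+ n)).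
Proof.
rewrite /AWprefactor /qpochsoo !big_cons !big_nil !mulr1.
have e x : qC * x * z * (w * qC ^+ n) / t = qC * x * z * w / t * qC ^+ n by ring.
have e2 : qC * (w * qC ^+ n) ^+ 2 = qC * w ^+ 2 * qC ^+ n.*2.
  by rewrite exprMn -exprM muln2 mulrA.
have e3 : qC ^+ 2 * z ^+ 2 * (w * qC ^+ n) / t = qC * A0 * qC ^+ n by rewrite /A0; ring.
by rewrite !e e2 e3 [t * (w * _)]mulrA.
Qed.

Lemma AWgen_qa0 n : 1 - qC * A0 * qC ^+ n != 0.
Proof. by rewrite -mulrA mulrCA -exprS; exact: AWgen_a0. Qed.

Lemma AWprefactor_expandable : expandable q (fun n => AWprefactor z (w * qC ^+ n)).
Proof.
have M := @expandableM _ _ q0 q1.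
have ee x := @expandable_qpochoo _ _ q0 q1 x.
have h1 := M _ _ (ee (t * w)) (M _ _ (ee (qC * a * z * w / t)) (M _ _ (ee (qC * b * z * w / t))
  (M _ _ (ee (qC * c * z * w / t)) (ee (qC * d * z * w / t))))).
have [e e0 he] := qpochoo_lower q0 q1 AWgen_w2.
have [f f0 hf] := qpochoo_lower q0 q1 AWgen_qa0.
have h2 := expandableV q0 q1 e0 (fun n => he n.*2) (expandable_double q0 q1 (ee (qC * w ^+ 2))).
have h3 := expandableV q0 q1 f0 hf (ee (qC * A0)).
apply: expandable_ext (M _ _ h1 (M _ _ h2 h3)) => n.
by rewrite AWprefactor_orbitE invfM.
Qed.

Lemma AWprefactor_cvg1 : (fun n => AWprefactor z (w * qC ^+ n)) @ \oo --> (1 : C).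
Proof.
have ee x := @qpochoo_cvg1 _ _ q0 q1 x.
have M (u v : nat -> C) : u @ \oo --> (1 : C) -> v @ \oo --> (1 : C) ->
    (fun n => u n * v n) @ \oo --> (1 : C).
  by move=> hu hv; rewrite -[1 in X in _ --> X]mulr1; exact: (cvgM hu hv).
have h1 := M _ _ (ee (t * w)) (M _ _ (ee (qC * a * z * w / t)) (M _ _ (ee (qC * b * z * w / t))
  (M _ _ (ee (qC * c * z * w / t)) (ee (qC * d * z * w / t))))).
have h2 : (fun n => qpochoo q (qC * w ^+ 2 * qC ^+ n.*2)) @ \oo --> (1 : C).
  apply/cvgCP => e e0; have /cvgCP /(_ _ e0) [N _ hN] := ee (qC * w ^+ 2).
  exists N => // n /= hn; apply: hN => /=; apply: leq_trans hn _.
  by rewrite -addnn leq_addr.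
have h3 := M _ _ h2 (ee (qC * A0)).
have h4 : (fun n => (qpochoo q (qC * w ^+ 2 * qC ^+ n.*2) * qpochoo q (qC * A0 * qC ^+ n))^-1) @ \oo --> (1 : C).
  by rewrite -[1 in X in _ --> X]invr1; exact: (cvgV (oner_neq0 _) h3).
by apply: cvgC_ext (M _ _ h1 h4) => n; rewrite AWprefactor_orbitE.
Qed.

Lemma AWred_expandable : expandable q (fun n => AWred z (w * qC ^+ n)).
Proof. exact: (expandableM q0 q1 AWprefactor_expandable AWseries_expandable). Qed.

Lemma AWred_cvg1 : (fun n => AWred z (w * qC ^+ n)) @ \oo --> (1 : C).
Proof.
by rewrite -[1 in X in _ --> X]mulr1; exact: (cvgM AWprefactor_cvg1 AWseries_cvg1).
Qed.

Lemma AWgen_tw n : 1 - t * w * qC ^+ n != 0.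
Proof.
apply: one_sub_neq0; rewrite modulusM (modulus_qX q0).
by apply: le_lt_trans hg.1; rewrite ler_piMr ?modulus_ge0 // (qX_le1 q0 q1).
Qed.

Lemma AWprefactor_shift :
  AWprefactor z w = (1 - t * w) * (1 - qC * a * z * w / t) * (1 - qC * b * z * w / t)
    * (1 - qC * c * z * w / t) * (1 - qC * d * z * w / t)
    / ((1 - qC * w ^+ 2) * (1 - qC ^+ 2 * w ^+ 2) * (1 - qC ^+ 2 * z ^+ 2 * w / t))
  * AWprefactor z (w * qC).
Proof.
have := AWprefactor_orbitE 0; have := AWprefactor_orbitE 1.
rewrite !expr1 !expr0 !mulr1 => -> ->.
have e2 : qpochoo q (qC * w ^+ 2) = (1 - qC * w ^+ 2) * (1 - qC ^+ 2 * w ^+ 2)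
   * qpochoo q (qC * w ^+ 2 * qC ^+ 2).
  rewrite (qpochoo_shift q0 q1 (qC * w ^+ 2)) (qpochoo_shift q0 q1 (qC * w ^+ 2 * qC)) mulrA.
  by rewrite -[qC * w ^+ 2 * qC * qC]mulrA -expr2 [qC * w ^+ 2 * qC]mulrAC -expr2.
have e3 : qpochoo q (qC * A0) = (1 - qC ^+ 2 * z ^+ 2 * w / t) * qpochoo q (qC * A0 * qC).
  by rewrite (qpochoo_shift q0 q1) /A0; congr (_ * _); rewrite !mulrA -expr2.
rewrite e2 e3 (qpochoo_shift q0 q1 (t * w)) (qpochoo_shift q0 q1 (qC * a * z * w / t))
  (qpochoo_shift q0 q1 (qC * b * z * w / t)) (qpochoo_shift q0 q1 (qC * c * z * w / t))
  (qpochoo_shift q0 q1 (qC * d * z * w / t)).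
exact: prefactor_rearrange.
Qed.

End Orbit.

Let bd u := @bigOq R q u 0.

Lemma bdM u v : bd u -> bd v -> bd (fun n => u n * v n).
Proof. exact: (@bigOqM _ _ _ _ 0 0). Qed.

Lemma bd_poch (u : C) (f : nat -> nat) : bd (fun n => poch qC u (f n)).
Proof.
exists (expR (modulus u / (1 - q))) => n; rewrite mul0n expr0 mulr1; exact: qpoch_le.
Qed.

Lemma bd_pochV (u : C) : (forall n, 1 - u * qC ^+ n != 0) -> bd (fun n => (poch qC u n)^-1).
Proof.
move=> /(qpoch_lower q0 q1) [e e0 he]; exists e^-1 => n; rewrite mul0n expr0 mulr1.
have := he 0%N n; rewrite expr0 mulr1 => h.
by rewrite modulusV lef_pV2 ?posrE // (lt_le_trans e0).
Qed.

Lemma bd_1Bq (u : C) : bd (fun n => 1 - u * qC ^+ n).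
Proof. exact: (expandable_bounded q0 q1 (@expandable_1Bq u)). Qed.

Lemma bd_1BqV (u : C) : (forall n, 1 - u * qC ^+ n != 0) -> bd (fun n => (1 - u * qC ^+ n)^-1).
Proof.
move=> /(qpoch_lower q0 q1) [e e0 he]; exists e^-1 => n; rewrite mul0n expr0 mulr1.
have := he n 1%N; rewrite /qpoch big_ord1 expr0 mulr1 => h.
by rewrite modulusV lef_pV2 ?posrE // (lt_le_trans e0).
Qed.

Lemma bd_qpoly2 (s0 s1 s2 : C) : bd (fun n => s0 + s1 * qC ^+ n + s2 * (qC ^+ n) ^+ 2).
Proof.
have := bigOq_poly q0 q1 (s0%:P + s1 *: 'X + s2 *: 'X^2); apply: bigOq_ext => n.
by rewrite !hornerE.
Qed.

Section Recurrence.
Variables (z w : C).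
Hypotheses (z0 : z != 0) (w0 : w != 0) (hg : AWgen z w).

(** The limit of vwp_contiguous_sum: the right-hand side there is (t w)^n times a
    bounded sequence, and |t w| < 1. *)
Lemma AWseries_contiguous :
  let W := w * qC in
  let y := t * w / z ^+ 2 in
  let X := qC * z ^+ 2 * W / t in
  let b1 := qC * z / a in let b2 := qC * z / b in
  let b3 := qC * z / c in let b4 := qC * z / d in
  let e1 := b1 + b2 + b3 + b4 in
  let e3 := b1*b2*b3 + b1*b2*b4 + b1*b3*b4 + b2*b3*b4 in
  let D K := (1-X*K/b1)*(1-X*K/b2)*(1-X*K/b3)*(1-X*K/b4) in
  let P6 := (1-y*b1*b2)*(1-y*b1*b3)*(1-y*b1*b4)*(1-y*b2*b3)*(1-y*b2*b4)*(1-y*b3*b4) in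
  let Vn := (X * e3 / (b1*b2*b3*b4) + t * w * e1) * (1 + W^+2)
     - (1+qC)/qC * W^+2 * (qC * z^+2 * e3 / (b1*b2*b3*b4) + e1) in
  (1-t*w)*D 1/((1-W^+2/qC)*(1-W^+2)*(1-X)) * AWseries z w
  + z^+2*(1-qC*W/t)*P6*(1-qC*X)/((1-W^+2)*(1-qC*W^+2)*D qC) * AWseries z (W * qC)
  + (Vn / ((1-W^+2/qC)*(1-qC*W^+2)) - (z^+2+1)) * AWseries z W = 0.
Proof.
move=> W y X b1 b2 b3 b4 e1 e3 D P6 Vn.
have b10 : b1 != 0 by rewrite /b1 !mulf_neq0 ?invr_eq0.
have b20 : b2 != 0 by rewrite /b2 !mulf_neq0 ?invr_eq0.
have b30 : b3 != 0 by rewrite /b3 !mulf_neq0 ?invr_eq0.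
have b40 : b4 != 0 by rewrite /b4 !mulf_neq0 ?invr_eq0.
have E0 : qC * W / t != 0 by rewrite !mulf_neq0 ?invr_eq0.
have hP : b1 * b2 * b3 * b4 = qC ^+ 3 * z ^+ 4 / t ^+ 2.
  have -> : b1 * b2 * b3 * b4 = qC ^+ 4 * z ^+ 4 / (a * b * c * d).
    by rewrite /b1 /b2 /b3 /b4; field; rewrite a0 b0 c0 d0.
  by rewrite -habcd; field; rewrite t0 qn0.
have hX : X = y * (b1 * b2 * b3 * b4) / qC.
  by rewrite hP /X /y /W; field; rewrite t0 qn0 z0.
have hw2 : W ^+ 2 = y ^+ 2 * (b1 * b2 * b3 * b4) / qC.
  by rewrite hP /y /W; field; rewrite t0 qn0 z0.
have hlam : z ^+ 2 = X / (qC * W / t).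
  by rewrite /X /W; field; rewrite t0 qn0 w0.
have hZ : t * W = qC * W ^+ 2 / (qC * W / t).
  by rewrite /W; field; rewrite t0 qn0 w0.
have hw1 : 1 - W ^+ 2 != 0.
  by have := AWgen_w2 hg 1; rewrite /W; congr (_ != _); ring.
have hwm : qC - W ^+ 2 != 0.
  have -> : qC - W ^+ 2 = qC * (1 - qC * w ^+ 2 * qC ^+ 0) by rewrite /W; ring.
  by rewrite mulf_neq0 // (AWgen_w2 hg).
have hwp : 1 - qC * W ^+ 2 != 0.
  by have := AWgen_w2 hg 2; rewrite /W; congr (_ != _); ring.
have eX : X / qC = qC * z ^+ 2 * w / t by rewrite /X /W; field; rewrite t0 qn0.
have gX n : 1 - X / qC * qC ^+ n != 0 by rewrite eX; exact: AWgen_a0.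
have gl n : 1 - qC * z ^+ 2 * qC ^+ n != 0 by exact: (AWgen_z2 hg).
have eb x : x != 0 -> X / (qC * z / x) = qC * x * z * w / t.
  by move=> x0; rewrite /X /W; field; rewrite t0 qn0 z0 x0.
have gb1 n : 1 - X / b1 * qC ^+ n != 0 by rewrite eb //; exact: AWgen_a.
have gb2 n : 1 - X / b2 * qC ^+ n != 0 by rewrite eb //; exact: AWgen_b.
have gb3 n : 1 - X / b3 * qC ^+ n != 0 by rewrite eb //; exact: AWgen_c.
have gb4 n : 1 - X / b4 * qC ^+ n != 0 by rewrite eb //; exact: AWgen_d.
have gq n : 1 - qC ^+ n.+1 != 0 by rewrite exprS; exact: q_orbit_neq1.
have hsum := vwp_contiguous_sum qn0 E0 b10 b20 b30 b40 hX hw2 hlam hZ hw1 hwm hwp gX gq gl gb1 gb2 gb3 gb4.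
have eE : qC * W / t / qC = qC * w / t by rewrite /W; field; rewrite t0 qn0.
have eZ : t * W / qC = t * w by rewrite /W; field; rewrite qn0.
have eX2 : qC * X = qC * z ^+ 2 * (W * qC) / t by rewrite /X; ring.
have eE2 : qC * (qC * W / t) = qC * (W * qC) / t by ring.
have eZ2 : qC * (t * W) = t * (W * qC) by ring.
rewrite !eE !eZ in hsum.
have c1 : series (AWterm z w) @ \oo --> AWseries z w by exact: (AWseries_cvg z0 w0 hg).
have W0 : W != 0 by rewrite mulf_neq0.
have hgW : AWgen z W by have := @AWgen_orbit z w 1 hg; rewrite expr1.
have hgW2 : AWgen z (W * qC) by have := @AWgen_orbit z W 1 hgW; rewrite expr1.
have c2 : series (AWterm z W) @ \oo --> AWseries z W by exact: (AWseries_cvg z0 W0 hgW).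
have c3 : series (AWterm z (W * qC)) @ \oo --> AWseries z (W * qC).
  by apply: (AWseries_cvg z0 _ hgW2); rewrite mulf_neq0.
pose r1 := (1-t*w)*D 1/((1-W^+2/qC)*(1-W^+2)*(1-X)).
pose r2 := z^+2*(1-qC*W/t)*P6*(1-qC*X)/((1-W^+2)*(1-qC*W^+2)*D qC).
pose r3 := Vn / ((1-W^+2/qC)*(1-qC*W^+2)) - (z^+2+1).
have hl : (fun n => r1 * series (AWterm z w) n + r2 * series (AWterm z (W * qC)) n
     + r3 * series (AWterm z W) n) @ \oo -->
    r1 * AWseries z w + r2 * AWseries z (W * qC) + r3 * AWseries z W.
  have m x (u : nat -> C) (l : C) : u @ \oo --> l -> (fun n => x * u n) @ \oo --> x * l.
    by move=> hu; exact: (cvgM (@cvgC_cst _ x) hu).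
  exact: (cvgD (cvgD (m r1 _ _ c1) (m r2 _ _ c3)) (m r3 _ _ c2)).
apply: (cvgC_unique hl).
have htw : 0 <= modulus (t * w) < 1 by rewrite modulus_ge0 hg.1.
pose K1 := qC * w / t/((1-W^+2/qC)*(1-W^+2))*(1-t*w).
pose K2 := ((1 - W ^+ 2) * (1 - qC * W ^+ 2))^-1.
pose dn n := D (qC ^+ n) * (1 - qC ^+ n) * (1 - z ^+ 2 * qC ^+ n) * poch qC (qC * W / t) n.-1
  * (1 - X / qC * qC ^+ n)^-1.
pose sn n := (1 - qC ^+ n) * (1 - z ^+ 2 * qC ^+ n) *
   ((1-y^+2*(b1*b2*b3*b4)) + X*(y^+2*e3-y*e1)*qC ^+ n + X^+2*y*(1-y^+2*(b1*b2*b3*b4))*(qC ^+ n)^+2)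
   * poch qC (qC * W / t) n.
pose un n := poch qC X n * (poch qC b1 n * poch qC b2 n * poch qC b3 n * poch qC b4 n)
   * ((1 - X) * (poch qC qC n * poch qC (qC*z^+2) n)
     * (poch qC (qC*X/b1) n * poch qC (qC*X/b2) n * poch qC (qC*X/b3) n * poch qC (qC*X/b4) n))^-1.
have hpb x : (forall n, 1 - X / x * qC ^+ n != 0) -> bd (fun n => (poch qC (qC*X/x) n)^-1).
  move=> hb; apply: bd_pochV => n; have := hb n.+1.
  by rewrite exprS mulrA [X / x * _]mulrC mulrA.
have hun : bd un.
  have bp x := @bd_poch x id.
  have := (bdM (bdM (bp X) (bdM (bdM (bdM (bp b1) (bp b2)) (bp b3)) (bp b4)))
    (bdM (bdM (bigOq_cst q (1 - X)^-1) (bdM (bd_pochV q_orbit_neq1) (bd_pochV gl)))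
     (bdM (bdM (bdM (hpb _ gb1) (hpb _ gb2)) (hpb _ gb3)) (hpb _ gb4)))).
  by apply: bigOq_ext => n /=; rewrite /un !invfM.
have h1Bq : bd (fun n => 1 - qC ^+ n).
  by apply: bigOq_ext (@bd_1Bq 1) => n; rewrite mul1r.
have hdn : bd dn.
  have bD x : bd (fun n => 1 - X * qC ^+ n / x).
    by apply: bigOq_ext (@bd_1Bq (X / x)) => n; rewrite [X / x * _]mulrAC.
  exact: (bdM (bdM (bdM (bdM (bdM (bdM (bdM (bD b1) (bD b2)) (bD b3)) (bD b4)) h1Bq)
    (@bd_1Bq (z ^+ 2))) (@bd_poch _ predn)) (bd_1BqV gX)).
have hsn : bd sn.
  exact: (bdM (bdM (bdM h1Bq (@bd_1Bq (z ^+ 2))) (@bd_qpoly2 _ _ _)) (@bd_poch _ id)).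
have cst x := bigOq_cst q x.
have [B hB] := bdM hun (bigOqD (bdM (cst K1) hdn) (bigOqN (bdM hsn (cst K2)))).
apply: (@cvgC_dominated _ _ _ (fun n => B * modulus (t * w) ^+ n)).
  exact: cvg_geometric0.
move=> n; rewrite subr0.
have -> : r1 * series (AWterm z w) n + r2 * series (AWterm z (W * qC)) n + r3 * series (AWterm z W) n
  = (un n * (K1 * dn n + - (sn n * K2))) * (t * w) ^+ n.
  rewrite !seriesEnat /= !big_mkord /r1 /r2 /r3 /AWterm -eX -eX2 -eE2 -eZ2 hsum.
  have -> : (t * W) ^+ n = (t * w) ^+ n * qC ^+ n by rewrite /W mulrA exprMn.
  have qnn : qC ^+ n != 0 by rewrite expf_neq0.
  have -> : X * qC ^+ n / qC = X / qC * qC ^+ n by rewrite mulrAC.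
  exact: cert_rearrange.
rewrite (modulusM _ ((t * w) ^+ n)) modulusX ler_wpM2r ?exprn_ge0 ?modulus_ge0 //.
by have := hB n; rewrite mul0n expr0 mulr1.
Qed.

(** The quotients of the prefactors at w, q w and q^2 w turn the coefficients of
    the contiguous relation into dualPsi and dualV. *)
Lemma AWred_recurrence :
  let W := w * qC in
  AWred z w / z + z * dualPsi qC a b c d t W * AWred z (W * qC)
  + dualV qC (dualV1 a b c d t) (dualV2 qC a b c d) W * AWred z W = (z + z^-1) * AWred z W.
Proof.
move=> W; have hgW : AWgen z W by have := @AWgen_orbit z w 1 hg; rewrite expr1.
have W0 : W != 0 by rewrite mulf_neq0.
have H := AWseries_contiguous.
rewrite -/W /= in H.
have wE : w = W / qC by rewrite /W mulfK.
have hVn := @dualV_cert _ qC a b c d t z W qn0 a0 b0 c0 d0 t0 z0.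
have hPsi := @dualPsi_cert _ qC a b c d t z W qn0 a0 b0 c0 d0 t0 z0 habcd.
rewrite /= -wE in hVn hPsi.
rewrite hVn in H.
have eb x : x != 0 -> qC * z ^+ 2 * W / t / (qC * z / x) = x * z * W / t.
  by move=> x0; field; rewrite t0 qn0 z0 x0.
have eb1 x : x != 0 -> qC * z ^+ 2 * W / t * 1 / (qC * z / x) = x * z * W / t.
  by move=> x0; rewrite mulr1 eb.
have ebq x : x != 0 -> qC * z ^+ 2 * W / t * qC / (qC * z / x) = qC * (x * z * W / t).
  by move=> x0; rewrite [_ * qC / _]mulrAC eb // mulrC.
rewrite !eb1 // !ebq // in H.
have ew x : qC * x * z * w / t = x * z * W / t by rewrite /W; ring.
have eW x : qC * x * z * W / t = qC * (x * z * W / t) by ring.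
have ew2 : qC * w ^+ 2 = W ^+ 2 / qC by rewrite wE; field; rewrite qn0.
have ew3 : qC ^+ 2 * w ^+ 2 = W ^+ 2 by rewrite /W; ring.
have ew4 : qC ^+ 2 * z ^+ 2 * w / t = qC * z ^+ 2 * W / t by rewrite /W; ring.
have eW4 : qC ^+ 2 * z ^+ 2 * W / t = qC * (qC * z ^+ 2 * W / t) by ring.
have hp := AWprefactor_shift z W.
rewrite hPsi /AWred (AWprefactor_shift z w) -/W hp !ew !eW ew2 ew3 ew4 eW4 wE -wE.
have g1 := AWgen_tw hgW 0; rewrite expr0 mulr1 in g1.
have g2 := AWgen_w2 hg 1; have g3 := AWgen_w2 hgW 0; have g4 := AWgen_w2 hgW 1.
rewrite expr1 mulrAC -expr2 ew3 in g2.
rewrite expr0 mulr1 in g3.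
rewrite expr1 mulrAC -expr2 in g4.
have g5 := AWgen_w2 hg 0; rewrite expr0 mulr1 ew2 in g5.
have g6 : qC - W ^+ 2 != 0.
  have -> : qC - W ^+ 2 = qC * (1 - W ^+ 2 / qC) by field; rewrite qn0.
  by rewrite mulf_neq0.
have g7 := AWgen_a0 hgW 0; rewrite expr0 mulr1 in g7.
have g8 := AWgen_a0 hgW 1; rewrite expr1 [_ * qC]mulrC in g8.
have ga := AWgen_a hgW 0; have gb := AWgen_b hgW 0; have gc := AWgen_c hgW 0; have gd := AWgen_d hgW 0.
rewrite expr0 mulr1 eW in ga; rewrite expr0 mulr1 eW in gb.
rewrite expr0 mulr1 eW in gc; rewrite expr0 mulr1 eW in gd.
rewrite wE in H *.
exact: (recurrence_assembly _ qn0 z0 g1 g2 g6 g3 g4 g7 g8 ga gb gc gd H).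
Qed.

End Recurrence.
End AWfunction.

(** * The dual difference operator on polynomials *)

Section Rev.
Variables (F : numFieldType) (N : nat).
Implicit Types (p : {poly F}) (x : F).

(** The polynomial x^N p(1/x), where N is a fixed bound of the degree. *)
Definition rev_poly p : {poly F} := \poly_(i < N.+1) p`_(N - i).

Lemma rev_polyE p : rev_poly p = \sum_(i < N.+1) p`_i *: 'X^(N - i).
Proof.
rewrite /rev_poly poly_def (reindex_inj rev_ord_inj) /=.
by apply: eq_bigr => i _; rewrite subSS subKn // -ltnS.
Qed.

Lemma poly_sum_widen p : (size p <= N.+1)%N -> p = \sum_(i < N.+1) p`_i *: 'X^i.
Proof.
move=> hp; rewrite -(poly_def N.+1 (fun i => p`_i)); apply/polyP => i.
rewrite coef_poly; case: ltnP => // hi; rewrite nth_default //.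
exact: leq_trans hp hi.
Qed.

Lemma horner_rev_poly p x : (size p <= N.+1)%N -> x != 0 ->
  (rev_poly p).[x] = x ^+ N * p.[x^-1].
Proof.
move=> hp x0; rewrite rev_polyE [in RHS](poly_sum_widen hp) !horner_sum mulr_sumr.
apply: eq_bigr => i _; rewrite !hornerZ !hornerXn exprVn.
have hi : (i <= N)%N by rewrite -ltnS.
have xi : x ^+ i != 0 by rewrite expf_neq0.
have -> : x ^+ N = x ^+ i * x ^+ (N - i) by rewrite -exprD subnKC.
by field.
Qed.

Lemma deriv_rev_poly p x : (size p <= N.+1)%N -> x != 0 ->
  (rev_poly p)^`().[x] = x ^+ N / x * (N%:R * p.[x^-1] - x^-1 * p^`().[x^-1]).
Proof.
move=> hp x0; rewrite rev_polyE [in RHS](poly_sum_widen hp).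
have ds (f : 'I_N.+1 -> {poly F}) : (\sum_i f i)^`() = \sum_i (f i)^`().
  by rewrite raddf_sum.
rewrite !ds !horner_sum.
rewrite !mulr_sumr -sumrB mulr_sumr; apply: eq_bigr => i _.
rewrite !derivZ !derivXn !hornerZ !hornerMn !hornerXn !exprVn.
have hi : (i <= N)%N by rewrite -ltnS.
have e1 : x ^+ N = x ^+ i * x ^+ (N - i) by rewrite -exprD subnKC.
have e2 : N%:R = i%:R + (N - i)%:R :> F by rewrite -natrD subnKC.
rewrite e1 e2; move: (N - i)%N => m.
have xi : x ^+ i != 0 by rewrite expf_neq0.
have -> : x ^+ m.-1 *+ m = m%:R * (x ^+ m / x).
  by case: m => [|m]; rewrite ?mulr0n ?mul0r // exprSr mulfK // mulr_natl.
have -> : x ^- i.-1 *+ i = i%:R * (x / x ^+ i).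
  by case: (nat_of_ord i) => [|k]; rewrite ?mulr0n ?mul0r //= exprS invfM mulVKf // mulr_natl.
by field; rewrite x0 xi.
Qed.

Lemma poly_eq_away0 (p r : {poly F}) : (forall x, x != 0 -> p.[x] = r.[x]) -> p = r.
Proof.
move=> h; apply/eqP; rewrite -subr_eq0; apply/negPn/negP => pr0.
have /max_poly_roots := pr0 => /(_ [seq (i.+1)%:R | i <- iota 0 (size (p - r))]).
have hall : all (root (p - r)) [seq (i.+1)%:R | i <- iota 0 (size (p - r))].
  apply/allP => x /mapP[i _ ->]; by rewrite rootE hornerD hornerN h ?subrr ?pnatr_eq0.
move=> /(_ hall); rewrite map_inj_uniq ?iota_uniq.
  by move=> /(_ isT); rewrite size_map size_iota ltnn.
by move=> i j /eqP; rewrite eqr_nat eqSS => /eqP.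
Qed.
End Rev.

Section DualPolyOp.
Variables (F : numFieldType) (N : nat) (q v1 v2 e1 e2 e3 e4 : F).
Hypotheses (q0 : q != 0) (e10 : e1 != 0) (e20 : e2 != 0) (e30 : e3 != 0) (e40 : e4 != 0).
Hypothesis (he : e1 * e2 * e3 * e4 * q = q ^+ N).
Implicit Types (p : {poly F}) (x z : F).

Definition numU : {poly F} := (1 - e1 *: 'X) * (1 - e2 *: 'X) * (1 - e3 *: 'X) * (1 - e4 *: 'X).
Definition numU' : {poly F} :=
  (1 - e1^-1 *: 'X) * (1 - e2^-1 *: 'X) * (1 - e3^-1 *: 'X) * (1 - e4^-1 *: 'X).

Definition numV z : {poly F} :=
  ('X * (v1 *: (1 + 'X^2) + v2 *: 'X)
   - (z + z^-1) *: ((1 - q^-1 *: 'X^2) * (1 - q *: 'X^2))) * (1 - 'X^2).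

(** The difference operator acting on F times the product of the 1 - mu_t x, with
    the denominator (1 - x^2) (1 - q x^2) (1 - x^2/q) cleared. *)
Definition dualOp z p : {poly F} :=
  z^-1 *: (numU * (1 - q *: 'X^2) * (p \Po (q^-1 *: 'X)))
  + z *: (numU' * (1 - q^-1 *: 'X^2) * (p \Po (q *: 'X)))
  + numV z * p.

Lemma numUE x : numU.[x] = (1 - e1 * x) * (1 - e2 * x) * (1 - e3 * x) * (1 - e4 * x).
Proof. by rewrite /numU !hornerE. Qed.

Lemma numU'E x : numU'.[x] = (1 - e1^-1 * x) * (1 - e2^-1 * x) * (1 - e3^-1 * x) * (1 - e4^-1 * x).
Proof. by rewrite /numU' !hornerE. Qed.

Lemma numVE z x : (numV z).[x] =
  (x * (v1 * (1 + x ^+ 2) + v2 * x) - (z + z^-1) * ((1 - q^-1 * x ^+ 2) * (1 - q * x ^+ 2)))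
  * (1 - x ^+ 2).
Proof. by rewrite /numV !hornerE. Qed.

Lemma dualOpE z p x : (dualOp z p).[x] =
  z^-1 * (numU.[x] * (1 - q * x ^+ 2) * p.[q^-1 * x])
  + z * (numU'.[x] * (1 - q^-1 * x ^+ 2) * p.[q * x]) + (numV z).[x] * p.[x].
Proof.
rewrite /dualOp !hornerD !hornerZ !hornerM !horner_comp !hornerD !hornerN !hornerZ !hornerXn.
by rewrite !hornerC !hornerX.
Qed.

(** The product condition on the e_i makes reversal exchange numU and numU' up
    to a power of q. *)
Lemma numU'_rev x : x != 0 -> q ^+ N * numU'.[x] = q * (x ^+ 4 * numU.[x^-1]).
Proof.
move=> x0; rewrite -he numUE numU'E.
by field; rewrite x0 e10 e20 e30 e40.
Qed.

Lemma size_1BX (c : F) : (size (1 - c *: 'X)%R <= 2)%N.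
Proof.
apply: leq_trans (size_polyD _ _) _; rewrite size_polyN geq_max size_poly1 /=.
by apply: leq_trans (size_scale_leq _ _) _; rewrite size_polyX.
Qed.

Lemma size_1BX2 (c : F) : (size (1 - c *: 'X^2)%R <= 3)%N.
Proof.
apply: leq_trans (size_polyD _ _) _; rewrite size_polyN geq_max size_poly1 /=.
by apply: leq_trans (size_scale_leq _ _) _; rewrite size_polyXn.
Qed.

Lemma size_mulp (p r : {poly F}) m n : (size p <= m.+1)%N -> (size r <= n.+1)%N ->
  (size (p * r)%R <= (m + n).+1)%N.
Proof.
move=> hp hr; apply: leq_trans (size_polyMleq _ _) _.
by rewrite -ltnS; case: (size p + size r)%N (leq_add hp hr) => //= k; rewrite addSn addnS.
Qed.

Lemma size_comp_scale (p : {poly F}) c : (size (p \Po (c *: 'X))%R <= size p)%N.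
Proof.
have [->|p0] := eqVneq p 0; first by rewrite comp_poly0.
apply: leq_trans (size_comp_poly_leq _ _) _.
have h : (size (c *: 'X : {poly F}) <= 2)%N.
  by apply: leq_trans (size_scale_leq _ _) _; rewrite size_polyX.
have : ((size p).-1 * (size (c *: 'X : {poly F})).-1 <= (size p).-1)%N.
  by rewrite -[X in (_ <= X)%N]muln1 leq_mul2l; case: size h => [|[|[]]] //=; rewrite ?orbT.
by move=> h2; apply: leq_trans (_ : (size p).-1.+1 <= _)%N; rewrite ?ltnS // prednK // size_poly_gt0.
Qed.

Lemma size_dualOp z p : (size p <= N.+1)%N -> (size (dualOp z p) <= (6 + N).+1)%N.
Proof.
move=> hp.
have hc c : (size (p \Po (c *: 'X))%R <= N.+1)%N by exact: leq_trans (size_comp_scale _ _) hp.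
have U4 a b c d : (size ((1 - a *: 'X) * (1 - b *: 'X) * (1 - c *: 'X) * (1 - d *: 'X) : {poly F})%R <= 5)%N.
  exact: (size_mulp (m := 3) (n := 1) (size_mulp (m := 2) (n := 1) (size_mulp (m := 1) (n := 1)
    (size_1BX _) (size_1BX _)) (size_1BX _)) (size_1BX _)).
have D (p1 p2 : {poly F}) k : (size p1 <= k)%N -> (size p2 <= k)%N -> (size (p1 + p2)%R <= k)%N.
  by move=> h1 h2; apply: leq_trans (size_polyD _ _) _; rewrite geq_max h1.
have Z c (p1 : {poly F}) k : (size p1 <= k)%N -> (size (c *: p1)%R <= k)%N.
  exact: leq_trans (size_scale_leq _ _).
apply: (D _ _ _); first apply: (D _ _ _).
- apply: (Z _ _ _); apply: (size_mulp (m := 6) (n := N)) => //.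
  exact: (size_mulp (m := 4) (n := 2) (U4 _ _ _ _) (size_1BX2 _)).
- apply: (Z _ _ _); apply: (size_mulp (m := 6) (n := N)) => //.
  exact: (size_mulp (m := 4) (n := 2) (U4 _ _ _ _) (size_1BX2 _)).
apply: (size_mulp (m := 6) (n := N)) => //.
apply: (size_mulp (m := 4) (n := 2)); last first.
  by have := size_1BX2 1; rewrite scale1r.
apply: (D _ _ _); last first.
  rewrite size_polyN; apply: (Z _ _ _).
  exact: (size_mulp (m := 2) (n := 2) (size_1BX2 _) (size_1BX2 _)).
apply: (size_mulp (m := 1) (n := 3)); first by rewrite size_polyX.
apply: (D _ _ _); apply: (Z _ _ _); last by rewrite size_polyX.
apply: (@leq_trans 3) => //; apply: (D _ _ _); first by rewrite size_poly1.
by rewrite size_polyXn.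
Qed.

(** The substitution w -> 1/w exchanges the two shifts, and thereby z and 1/z. *)
Lemma dualOp_rev z p x : z != 0 -> x != 0 -> (size p <= N.+1)%N ->
  (dualOp z^-1 (rev_poly N p)).[x] = - (x ^+ (6 + N) * (dualOp z p).[x^-1]).
Proof.
move=> z0 x0 hp; rewrite !dualOpE !horner_rev_poly ?mulf_neq0 ?invr_eq0 // !numVE invrK !invfM !invrK.
have h1 := numU'_rev x0.
have h2 : q ^+ N * numU'.[x^-1] = q * (x ^- 4 * numU.[x]).
  by rewrite numU'_rev ?invr_eq0 // invrK exprVn.
have qN0 : q ^+ N != 0 by rewrite expf_neq0.
have -> : numU'.[x] = q * (x ^+ 4 * numU.[x^-1]) / q ^+ N by rewrite -h1 mulrC mulKf.
have -> : numU'.[x^-1] = q * (x ^- 4 * numU.[x]) / q ^+ N by rewrite -h2 mulrC mulKf.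
rewrite !exprMn !exprVn exprD.
move: (p.[q / x]) (p.[q^-1 / x]) (p.[x^-1]) (numU.[x]) (numU.[x^-1]) => pa pb p1 u1 u2.
move: (q ^+ N) qN0 (x ^+ N) => qN qN0' xN.
by field; rewrite x0 q0 qN0' z0.
Qed.

Lemma numV_inv z : numV z^-1 = numV z.
Proof. by rewrite /numV invrK [z^-1 + z]addrC. Qed.

Section Nodes.
Variables (r z : F) (s : 'I_N -> F) (j : 'I_N -> nat) (tau : F -> F).
Hypotheses (hr : r ^+ 2 = q) (hq : forall k, 1 - q ^+ k.+1 != 0) (z0 : z != 0).
Hypotheses (hs : forall t, s t ^+ 2 = 1) (hj : forall t, (0 < j t)%N)
  (hinj : forall t u, s t = s u -> j t = j u -> t = u)
  (hclosed : forall t, (2 < j t)%N -> exists2 u, s u = s t & j t = (j u).+2)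
  (htau : forall e, tau e ^+ 2 = 1).
Let mu t := s t * r ^+ j t.
Let c t := s t ^+ N * (tau (s t) * z) ^+ j t.
Hypothesis hU : forall x, numU.[x] * \prod_t (1 - mu t * (x / q))
  = (1 - x ^+ 2) * (1 - x ^+ 2 / q) * \prod_t (1 - mu t * x).
Hypothesis hV : forall e, e ^+ 2 = 1 ->
  e * r * (v1 * (1 + q) + v2 * (e * r)) = - (tau e * r ^- N * (1 + q) * numU.[e * r]).
Variable P : {poly F}.
Hypotheses (hP : (size P <= N.+1)%N) (hPc : forall t, (rev_poly N P).[mu t] = c t * P.[mu t]).

Let r0 : r != 0. Proof. by move: q0; rewrite -hr expf_eq0. Qed.

Lemma sign_neq0 (e : F) : e ^+ 2 = 1 -> e != 0.
Proof. by move=> h; apply/eqP => e0; move: h; rewrite e0 expr0n /= => /eqP; rewrite eq_sym oner_eq0. Qed.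

Lemma sign_inv (e : F) : e ^+ 2 = 1 -> e^-1 = e.
Proof. by move=> h; apply: (mulfI (sign_neq0 h)); rewrite -expr2 h divff // sign_neq0. Qed.

Lemma q_expI k l : q ^+ k = q ^+ l -> k = l.
Proof.
wlog kl : k l / (k <= l)%N => [H|].
  by case: (leqP k l) => [|/ltnW] kl h; [exact: H|symmetry; exact: H].
move=> h; apply/eqP; rewrite eqn_leq kl /= -subn_eq0; case e : (l - k)%N => [|m] //.
have := hq m; rewrite -e; suff -> : q ^+ (l - k) = 1 by rewrite subrr eqxx.
have qk : q ^+ k != 0 by rewrite expf_neq0.
by apply: (mulfI qk); rewrite mulr1 -exprD subnKC.
Qed.

Lemma node_inj e f k l : e ^+ 2 = 1 -> f ^+ 2 = 1 -> e * r ^+ k = f * r ^+ l -> e = f /\ k = l.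
Proof.
move=> he2 hf2 h.
have kl : k = l.
  apply: q_expI; rewrite -hr -!exprM ![(2 * _)%N]mulnC !exprM.
  by have := congr1 (fun x => x ^+ 2) h; rewrite /= !exprMn he2 hf2 !mul1r.
split=> //; move: h; rewrite kl => /mulIf; apply; exact: expf_neq0.
Qed.

Lemma mu_neq0 t : mu t != 0.
Proof. by rewrite mulf_neq0 ?expf_neq0 // (sign_neq0 (hs t)). Qed.

(** Either the symmetry condition holds at e r^k, or U vanishes at the point
    that the operator couples to it. *)
Lemma numU_or_condition e k x : e ^+ 2 = 1 -> x / q = (e * r ^+ k)^-1 ->
  (1 - x ^+ 2) * (1 - x ^+ 2 / q) * \prod_t (1 - mu t * x) = 0 ->
  numU.[x] = 0 \/
  (rev_poly N P).[e * r ^+ k] = e ^+ N * (tau e * z) ^+ k * P.[e * r ^+ k].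
Proof.
move=> he2 hx h0.
have ek0 : e * r ^+ k != 0 by rewrite mulf_neq0 ?expf_neq0 // sign_neq0.
case: (boolP [exists t, (s t == e) && (j t == k)]).
  by move=> /existsP[t /andP[/eqP <- /eqP <-]]; right; exact: hPc.
rewrite negb_exists => /forallP hn; left.
have := hU x; rewrite h0 hx => /eqP; rewrite mulf_eq0 => /orP[/eqP //|/prodf_eq0[t _]].
rewrite subr_eq0 => /eqP h1; have /= := hn t.
have : mu t = e * r ^+ k by rewrite -[LHS](mulfVK ek0) -h1 mul1r.
by move=> /(node_inj (hs t) he2) [-> ->]; rewrite !eqxx.
Qed.

Lemma horner_revP x : x != 0 -> (rev_poly N P).[x] = x ^+ N * P.[x^-1].
Proof. exact: horner_rev_poly. Qed.

Lemma one_sub_q_neq0 : 1 - q != 0. Proof. exact: (hq 0). Qed.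

Lemma sign_exprN (e : F) : e ^+ 2 = 1 -> e ^+ N * e ^+ N = 1.
Proof. by move=> h; rewrite -exprMn -expr2 h expr1n. Qed.

(** The points e / q and e q are inverse to one another, so that the symmetry
    condition at e q relates the values of P at the two shifts of e. *)
Lemma dualOp_root_sign e : e ^+ 2 = 1 -> (dualOp z P).[e] = 0.
Proof.
move=> he2; have e0 := sign_neq0 he2; have ei := sign_inv he2.
have qN0 : q ^+ N != 0 by rewrite expf_neq0.
rewrite dualOpE numVE he2 subrr mulr0 mul0r addr0 !mulr1.
have h1 : numU'.[e] = q * numU.[e] / q ^+ N.
  have := numU'_rev e0; rewrite ei (exprM e 2 2) he2 expr1n mul1r => <-.
  by rewrite mulrC mulKf.
have hx : e / q = (e * r ^+ 2)^-1 by rewrite hr invfM ei.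
case: (numU_or_condition he2 hx).
- by rewrite he2 subrr !mul0r.
- by move=> h; rewrite h1 h !(mulr0, mul0r) addr0.
rewrite hr horner_revP ?mulf_neq0 // exprMn invfM ei exprMn htau mul1r => h.
have eN := sign_exprN he2.
have hPe : P.[e / q] = z ^+ 2 * P.[e * q] / q ^+ N.
  apply: (mulfI qN0); rewrite [RHS]mulrC divfK //.
  by have := congr1 (fun y => e ^+ N * y) h; rewrite /= !mulrA eN !mul1r -expr2.
rewrite h1 [q^-1 * e]mulrC [q * e]mulrC hPe.
by field; rewrite qN0 z0 q0.
Qed.

Lemma numV_er e : e ^+ 2 = 1 ->
  (numV z).[e * r] = - (tau e * r ^- N * (1 - q ^+ 2) * numU.[e * r]).
Proof.
move=> he2; rewrite numVE.
have -> : (e * r) ^+ 2 = q by rewrite exprMn he2 hr mul1r.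
rewrite mulVf // subrr mul0r mulr0 subr0 hV //; ring.
Qed.

Lemma er_inv e : e ^+ 2 = 1 -> q^-1 * (e * r) = (e * r)^-1.
Proof.
by move=> he2; rewrite invfM (sign_inv he2) mulrCA -hr; congr (_ * _); rewrite expr2 invfM mulfVK.
Qed.

Lemma numU_or_condition1 e : e ^+ 2 = 1 -> numU.[e * r] = 0 \/
  (rev_poly N P).[e * r] = e ^+ N * (tau e * z) * P.[e * r].
Proof.
move=> he2; have hx : e * r / q = (e * r ^+ 1)^-1 by rewrite mulrC er_inv.
case: (numU_or_condition he2 hx).
- by rewrite exprMn he2 hr mul1r mulfV // subrr mulr0 mul0r.
- by left.
by rewrite !expr1; right.
Qed.

(** The shift of e r by 1/q is the inverse of e r, so that the symmetry condition
    at e r relates the two values of P that occur. *)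
Lemma dualOp_root_r e : e ^+ 2 = 1 -> (dualOp z P).[e * r] = 0.
Proof.
move=> he2; have e0 := sign_neq0 he2; have er0 : e * r != 0 by rewrite mulf_neq0.
have er2 : (e * r) ^+ 2 = q by rewrite exprMn he2 hr mul1r.
rewrite dualOpE numV_er // er2 mulVf // subrr mulr0 mul0r mulr0 addr0 er_inv //.
case: (numU_or_condition1 he2) => [->|]; first by rewrite !(mul0r, mulr0) oppr0 mul0r addr0.
rewrite horner_revP // => h.
have rN : r ^+ N != 0 by rewrite expf_neq0.
have -> : P.[(e * r)^-1] = r ^- N * tau e * z * P.[e * r].
  have := congr1 (fun y => e ^+ N * y) h; rewrite /= exprMn !mulrA sign_exprN // !mul1r => h'.
  by apply: (mulfI rN); rewrite h' !mulrA mulfV // mul1r.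
by field; rewrite rN z0.
Qed.

Lemma dualOp_root_rV e : e ^+ 2 = 1 -> (dualOp z P).[(e * r)^-1] = 0.
Proof.
move=> he2; have e0 := sign_neq0 he2; have er0 : e * r != 0 by rewrite mulf_neq0.
have er2 : (e * r) ^+ 2 = q by rewrite exprMn he2 hr mul1r.
have h6 : (e * r) ^+ (6 + N) != 0 by rewrite expf_neq0.
apply: (mulfI h6); rewrite mulr0; apply/eqP; rewrite -oppr_eq0; apply/eqP.
rewrite -dualOp_rev // dualOpE numV_inv numV_er // er2 mulVf // subrr mulr0 mul0r mulr0 addr0 er_inv // invrK.
case: (numU_or_condition1 he2) => [->|->]; first by rewrite !(mul0r, mulr0) oppr0 mul0r addr0.
rewrite horner_revP ?invr_eq0 // invrK exprVn exprMn invfM.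
have -> : (e ^+ N)^-1 = e ^+ N.
  by apply: (mulfI (expf_neq0 N e0)); rewrite sign_exprN // mulfV // expf_neq0.
have rN : r ^+ N != 0 by rewrite expf_neq0.
have ht := htau e.
transitivity (z * (numU.[e * r] * (1 - q * q)) * e ^+ N * r ^- N * P.[e * r] * (1 - tau e ^+ 2)).
  by field.
by rewrite ht subrr mulr0.
Qed.

(** The zeros of (1 - x^2) (1 - q x^2) (1 - x^2/q). *)
Definition singular_points := [:: 1; -1; r; - r; r^-1; - r^-1].

Lemma sqrN1 : (-1 : F) ^+ 2 = 1. Proof. by rewrite sqrrN expr1n. Qed.

Lemma uniq_singular_points : uniq singular_points.
Proof.
have n1 : (-1 : F) != 1 by rewrite eqr_oppLR -subr_eq0 opprK -(natrD _ 1 1) pnatr_eq0.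
have sq (x y : F) : x ^+ 2 != y ^+ 2 -> x != y by apply: contraNneq => ->.
have q11 : 1 != q by rewrite -subr_eq0 one_sub_q_neq0.
have q2 : 1 != q ^+ 2 by rewrite -subr_eq0 hq.
have qV : 1 != q^-1 by rewrite -(inj_eq invr_inj) invr1 invrK.
have qqV : q != q^-1 by apply: contra q2 => /eqP h; rewrite expr2 {1}h mulVf.
have nx (x : F) : x != 0 -> x != - x.
  by move=> x0; rewrite -{1}(mul1r x) -mulN1r (inj_eq (mulIf x0)) eq_sym.
have hrV : r^-1 ^+ 2 = q^-1 by rewrite exprVn hr.
rewrite /= !inE !negb_or -!andbA.
rewrite (eq_sym 1 (-1)) n1 (nx r) // (nx r^-1) ?invr_eq0 //.
have f x y : (x ^+ 2 == y ^+ 2) = false -> x != y by move=> h; apply: sq; rewrite h.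
rewrite !(f 1) ?(f (-1)) ?(f r) ?(f (- r)) //; rewrite ?sqrrN ?expr1n ?hr ?hrV; exact: negbTE.
Qed.

Definition singular_poly : {poly F} := \prod_(x <- singular_points) ('X - x%:P).

Lemma singular_polyE x : singular_poly.[x] = (x ^+ 2 - 1) * (x ^+ 2 - q) * (x ^+ 2 - q^-1).
Proof.
rewrite /singular_poly !big_cons big_nil mulr1 !hornerM !hornerXsubC -hr -exprVn.
ring.
Qed.

Lemma singular_poly_rev x : x != 0 -> x ^+ 6 * singular_poly.[x^-1] = - singular_poly.[x].
Proof. by move=> x0; rewrite !singular_polyE; field; rewrite x0 q0. Qed.

Lemma dualOp_factor : exists2 R : {poly F}, (size R <= N.+1)%N & dualOp z P = R * singular_poly.
Proof.
have hall : all (root (dualOp z P)) singular_points.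
  have h1 : (1 : F) ^+ 2 = 1 by rewrite expr1n.
  have := dualOp_root_sign h1; have := dualOp_root_sign sqrN1.
  have := dualOp_root_r h1; have := dualOp_root_r sqrN1.
  have := dualOp_root_rV h1; have := dualOp_root_rV sqrN1.
  by rewrite !mul1r !mulN1r invrN /= /root => -> -> -> -> -> ->; rewrite eqxx.
have := uniq_singular_points; rewrite -uniq_rootsE => hu.
have [R hR] := uniq_roots_prod_XsubC hall hu.
exists R => //; have [->|R0] := eqVneq R 0; first by rewrite size_poly0.
have := size_dualOp z hP; rewrite hR size_Mmonic ?monic_prod_XsubC //.
by rewrite size_prod_XsubC /= !addnS addn0.
Qed.

Hypothesis huniq : forall R : {poly F}, (size R <= N.+1)%N -> R.[0] = 0 ->
  (forall t, (rev_poly N R).[mu t] = c t * R.[mu t]) -> R = 0.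

Lemma dualOp_rev_factor (R : {poly F}) : (size R <= N.+1)%N -> dualOp z P = R * singular_poly ->
  dualOp z^-1 (rev_poly N P) = rev_poly N R * singular_poly.
Proof.
move=> sR hR; apply: poly_eq_away0 => x x0.
rewrite dualOp_rev // hR !hornerM horner_rev_poly // exprD.
rewrite -[singular_poly.[x]]opprK -singular_poly_rev //; ring.
Qed.

(** The quotient of dualOp z P by singular_poly satisfies the symmetry conditions
    and vanishes at 0. At a node with j_t > 1 this follows by evaluating the
    operator on P and on its reversal; at a node with j_t = 1 singular_poly has a
    simple zero, and first derivatives are compared instead. *)
Lemma dualOp_eq0 : dualOp z P = 0.
Proof.
have [R sR hR] := dualOp_factor.
suff R0 : R = 0 by rewrite hR R0 mul0r.
have hR' := dualOp_rev_factor sR hR.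
apply: huniq => //.
  have : (dualOp z P).[0] = 0.
    by rewrite dualOpE numUE numU'E numVE !(mulr0, expr0n) /= !(subr0, mulr1, mul1r); field.
  rewrite hR hornerM singular_polyE expr0n /= !sub0r => /eqP.
  by rewrite !mulf_eq0 !oppr_eq0 oner_eq0 invr_eq0 (negPf q0) !orbF => /eqP.
move=> t; have het := hs t; have mut0 := mu_neq0 t.
pose X := z *: (rev_poly N P \Po (q^-1 *: 'X)) - (c t / z) *: (P \Po (q^-1 *: 'X)).
pose W := z^-1 *: (rev_poly N P \Po (q *: 'X)) - (c t * z) *: (P \Po (q *: 'X)).
pose Y := rev_poly N P - c t *: P.
have hT : (rev_poly N R - c t *: R) * singular_poly
   = numU * (1 - q *: 'X^2) * X + numU' * (1 - q^-1 *: 'X^2) * W + numV z * Y.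
  rewrite mulrBl -scalerAl -hR -hR' /dualOp invrK numV_inv /X /W /Y.
  rewrite -!mul_polyC; ring.
have Y0 : Y.[mu t] = 0 by rewrite /Y hornerD hornerN hornerZ hPc subrr.
suff : (rev_poly N R - c t *: R).[mu t] = 0.
  by rewrite hornerD hornerN hornerZ => /eqP; rewrite subr_eq0 => /eqP.
(* the W-term vanishes at mu t *)
have W0 : numU'.[mu t] * W.[mu t] = 0.
  have hx : (mu t)^-1 / q = (s t * r ^+ (j t).+2)^-1.
    by rewrite /mu -invfM -hr -mulrA -exprD addn2.
  case: (numU_or_condition het hx).
  - apply/eqP; rewrite mulf_eq0; apply/orP; right; apply/prodf_eq0; exists t => //.
    by rewrite mulfV // subrr.
  - move=> h; have qN0 : q ^+ N != 0 by rewrite expf_neq0.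
    suff -> : numU'.[mu t] = 0 by rewrite mul0r.
    by apply: (mulfI qN0); rewrite numU'_rev // h !mulr0.
  have -> : s t * r ^+ (j t).+2 = q * mu t by rewrite /mu -hr -[(j t).+2]addn2 exprD; ring.
  move=> h; rewrite /W hornerD hornerN !hornerZ !horner_comp !hornerZ !hornerX h /c.
  have := htau (s t) => ht.
  have -> : (tau (s t) * z) ^+ (j t).+2 = (tau (s t) * z) ^+ j t * (tau (s t) ^+ 2 * z ^+ 2).
    by rewrite -addn2 exprD [(_ * z) ^+ 2]exprMn.
  by rewrite ht mul1r; apply/eqP; rewrite mulf_eq0; apply/orP; right; apply/eqP; field.
(* At a node with j t > 1 the value of singular_poly can be divided out. *)
case: (ltnP 1 (j t)) => hjt.
  have Zn : singular_poly.[mu t] != 0.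
    rewrite singular_polyE.
    have -> : mu t ^+ 2 = q ^+ j t by rewrite /mu exprMn het mul1r -exprM mulnC exprM hr.
    have [m ->] : exists m, j t = m.+2 by case: (j t) hjt => [|[|m]] // _; exists m.
    have h1 := hq m.+1; have h2 := hq m; have h3 := hq m.+2.
    have -> : (q ^+ m.+2 - 1) * (q ^+ m.+2 - q) * (q ^+ m.+2 - q^-1) =
       - ((1 - q ^+ m.+2) * q * (1 - q ^+ m.+1) * (1 - q ^+ m.+3) / q).
      by rewrite !exprS; field.
    by rewrite oppr_eq0 !mulf_neq0 // invr_eq0.
  have hM3 (p1 p2 p3 : {poly F}) x : (p1 * p2 * p3).[x] = p1.[x] * p2.[x] * p3.[x].
    by rewrite !hornerM.
  apply: (mulIf Zn); rewrite mul0r -hornerM hT !hornerD (hM3 numU) (hM3 numU') (hornerM (numV z)).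
  rewrite Y0 mulr0 addr0 (mulrAC numU'.[mu t]) W0 mul0r addr0.
  suff -> : X.[mu t] = 0 by rewrite mulr0.
  rewrite /X hornerD hornerN !hornerZ !horner_comp !hornerZ !hornerX.
  have [m em] : exists m, j t = m.+2 by case: (j t) hjt => [|[|m]] // _; exists m.
  have emu : q^-1 * mu t = s t * r ^+ m.
    by rewrite /mu em -hr -[m.+2]addn2 exprD; field.
  have ec : c t = s t ^+ N * (tau (s t) * z) ^+ m * z ^+ 2.
    by rewrite /c em -[m.+2]addn2 exprD [(_ * z) ^+ 2]exprMn htau mul1r mulrA.
  have hc : (rev_poly N P).[s t * r ^+ m] = s t ^+ N * (tau (s t) * z) ^+ m * P.[s t * r ^+ m].
    case: m em {emu ec} => [|m] em.
      by rewrite !expr0 !mulr1 horner_revP ?sign_neq0 // sign_inv.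
    have [|u hu1 hu2] := @hclosed t; first by rewrite em.
    have := hPc u; rewrite /c /mu hu1; suff -> : j u = m.+1 by [].
    by move: hu2; rewrite em => -[].
  by rewrite emu hc ec; field.
have jt1 : j t = 1%N by apply/eqP; rewrite eqn_leq hjt hj.
have emu : mu t = s t * r by rewrite /mu jt1 expr1.
set w := mu t in mut0 Y0 W0 *.
have w2 : w ^+ 2 = q by rewrite /w emu exprMn het hr mul1r.
have wV : q^-1 * w = w^-1 by rewrite /w emu er_inv.
have htau2 := htau (s t).
have ctE : c t = s t ^+ N * (tau (s t) * z) by rewrite /c jt1 expr1.
have st0 := sign_neq0 het; have tau0 : tau (s t) != 0.
  by apply/eqP => e; move: htau2; rewrite e expr0n /= => /eqP; rewrite eq_sym oner_eq0.
have c2 : c t ^+ 2 = z ^+ 2.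
  by rewrite ctE exprMn [X in _ * X]exprMn htau2 mul1r expr2 sign_exprN // mul1r.
have c0 : c t != 0 by rewrite ctE !mulf_neq0 // expf_neq0.
have wN0 : w ^+ N != 0 by rewrite expf_neq0.
have hPw : (rev_poly N P).[w] = c t * P.[w] by exact: hPc.
have hPi : P.[w^-1] = c t * P.[w] / w ^+ N by rewrite -hPw horner_revP // mulrC mulKf.
have X0 : X.[w] = 0.
  rewrite /X hornerD hornerN !hornerZ !horner_comp !hornerZ !hornerX wV horner_revP ?invr_eq0 //.
  rewrite invrK exprVn hPi.
  transitivity (P.[w] / w ^+ N / z * (z ^+ 2 - c t ^+ 2)); first by field; rewrite wN0 z0.
  by rewrite c2 subrr mulr0.
have dX : X^`().[w] = q^-1 * (z * (w / w ^+ N * (N%:R * P.[w] - w * P^`().[w])) - c t / z * P^`().[w^-1]).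
  rewrite /X derivB !derivZ !deriv_comp derivZ derivX hornerD hornerN !hornerZ !hornerM.
  rewrite !horner_comp !hornerZ !hornerX hornerC wV.
  rewrite deriv_rev_poly ?invr_eq0 // !invrK exprVn.
  by field; rewrite q0 z0 wN0.
have dY : Y^`().[w] = w ^+ N / w * (N%:R * P.[w^-1] - w^-1 * P^`().[w^-1]) - c t * P^`().[w].
  by rewrite /Y derivB derivZ hornerD hornerN hornerZ deriv_rev_poly.
(* The derivatives are proportional because the symmetry relates the values of P
   and of its derivative at w and at its inverse. *)
have key : X^`().[w] = z / (c t * w ^+ N) * Y^`().[w].
  apply/eqP; rewrite -subr_eq0; apply/eqP.
  transitivity (P^`().[w^-1] / w ^+ 2 / (c t * z) * (z ^+ 2 - c t ^+ 2)).
    by rewrite dX dY hPi -w2; field; rewrite wN0 z0 c0 mut0.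
  by rewrite c2 subrr mulr0.
have hUV : (numV z).[w] = - (z / (c t * w ^+ N) * (1 - q ^+ 2) * numU.[w]).
  rewrite /w emu numV_er // ctE exprMn.
  have rN : r ^+ N != 0 by rewrite expf_neq0.
  have sN : s t ^+ N != 0 by rewrite expf_neq0.
  congr (- (_ * _ * _)).
  transitivity (tau (s t) ^+ 2 * (s t ^+ N * s t ^+ N) * (z / (s t ^+ N * (tau (s t) * z) * (s t ^+ N * r ^+ N)))).
    by field; rewrite rN sN tau0 z0.
  by rewrite htau2 sign_exprN // !mul1r.
have Zw : singular_poly.[w] = 0 by rewrite singular_polyE w2 subrr mulr0 mul0r.
have sE : singular_poly = ('X^2 - q%:P) * (('X^2 - 1) * ('X^2 - (q^-1)%:P)).
  apply: poly_eq_away0 => x _; rewrite singular_polyE !hornerM !hornerD !hornerN !hornerXn !hornerC.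
  ring.
have dZ : singular_poly^`().[w] != 0.
  rewrite sE derivM hornerD [X in _ + X]hornerM hornerD hornerN hornerXn hornerC w2 subrr mul0r addr0.
  rewrite derivB derivC derivXn subr0 hornerM hornerMn hornerM !hornerD !hornerN !hornerXn !hornerC w2 expr1.
  have h2 := hq 1; have h1 := one_sub_q_neq0.
  have -> : w *+ 2 * ((q - 1) * (q - q^-1)) = w * 2 * ((1 - q) * (1 - q ^+ 2) / q).
    by rewrite -mulr_natr; field.
  have t0 : (2 : F) != 0 by rewrite pnatr_eq0.
  exact: mulf_neq0 (mulf_neq0 mut0 t0) (mulf_neq0 (mulf_neq0 h1 h2) (invr_neq0 q0)).
have dXw (p1 p2 : {poly F}) : p2.[w] = 0 -> (p1 * p2)^`().[w] = p1.[w] * p2^`().[w].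
  by move=> h; rewrite derivM hornerD !hornerM h mulr0 add0r.
apply: (mulIf dZ); rewrite mul0r -dXw // hT !derivD !hornerD dXw // [in X in _ + X]dXw //.
have -> : (numU' * (1 - q^-1 *: 'X^2) * W)^`().[w] = 0.
  rewrite mulrAC derivM hornerD [X in _ + X]hornerM (hornerM numU' W) W0 mul0r addr0 hornerM.
  have -> : (1 - q^-1 *: 'X^2 : {poly F}).[w] = 0.
    by rewrite hornerD hornerN hornerZ hornerXn hornerC w2 mulVf // subrr.
  by rewrite mulr0.
rewrite addr0 key hUV (hornerM numU) hornerD hornerN hornerZ hornerXn hornerC w2.
ring.
Qed.
End Nodes.
End DualPolyOp.

(** * Determinants of Cauchy type *)

Section DetLemma.
Variable F : fieldType.

(** Two triangular factorisations of the same block matrix. *)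
Lemma det_1_rank1 n (u : 'cV[F]_n) (v : 'rV[F]_n) :
  \det (1%:M + u *m v) = 1 + (v *m u) 0 0.
Proof.
pose m1 := block_mx (1%:M : 'M[F]_1) (- v) u (1%:M : 'M[F]_n).
have h1 : m1 = block_mx 1%:M 0 u 1%:M *m block_mx 1%:M (- v) 0 (1%:M + u *m v).
  rewrite mulmx_block; do !rewrite ?mul1mx ?mulmx1 ?mul0mx ?mulmx0 ?addr0 ?mulmxN.
  by rewrite addrCA addNr addr0.
have h2 : m1 = block_mx 1%:M (- v) 0 1%:M *m block_mx (1%:M + v *m u) 0 u 1%:M.
  rewrite mulmx_block; do !rewrite ?mul1mx ?mulmx1 ?mul0mx ?mulmx0 ?addr0 ?add0r ?mulNmx.
  by rewrite addrK.
have := congr1 determinant h1; rewrite h2 !det_mulmx !det_lblock !det_ublock !det1 !mul1r !mulr1.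
move=> <-; rewrite det_mx11 !mxE eqxx mulr1n; congr (_ + _).
Qed.

Lemma det_rank1 n (M : 'M[F]_n) (u : 'cV[F]_n) (v : 'rV[F]_n) : M \in unitmx ->
  \det (M + u *m v) = \det M * (1 + (v *m (invmx M *m u)) 0 0).
Proof.
move=> hM; have -> : M + u *m v = M *m (1%:M + (invmx M *m u) *m v).
  by rewrite mulmxDr mulmx1 -!mulmxA mulKVmx.
by rewrite det_mulmx det_1_rank1.
Qed.

(** The two matrices are conjugate by A. *)
Lemma det_1_swap n (A B : 'M[F]_n) : A \in unitmx ->
  \det (1%:M + A *m B) = \det (1%:M + B *m A).
Proof.
move=> hA; have h : A *m (1%:M + B *m A) = (1%:M + A *m B) *m A.
  by rewrite mulmxDr mulmxDl mulmx1 mul1mx mulmxA.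
have := congr1 determinant h; rewrite !det_mulmx mulrC => /mulIf ->//.
by rewrite -unitfE -unitmxE.
Qed.
End DetLemma.

Section Baker.
Variables (F : numFieldType) (N : nat) (mu B : 'I_N -> F).
Hypotheses (mu0 : forall t, mu t != 0) (mu1 : forall t u, 1 - mu t * mu u != 0)
  (muI : injective mu).

Definition cauchy_mx : 'M[F]_N := \matrix_(t, u) (1 - mu t * mu u)^-1.
Definition baker_mx : 'M[F]_N := 1%:M + diag_mx (\row_t B t) *m cauchy_mx.
Definition residue_coef : 'cV[F]_N := - (invmx baker_mx *m \col_t (B t / mu t)).
(** The determinant ratio as a function with value 1 at w = 0 and simple poles at
    the points 1 / mu_t. *)
Definition baker (w : F) := 1 + \sum_t residue_coef t 0 * (w / (1 - mu t * w)).

Hypothesis hM : baker_mx \in unitmx.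

(** After the diagonal matrix of the 1 / (1 - mu_t w) is moved to the right, the
    matrix differs from baker_mx by a matrix of rank one, because
    ((1 - w / mu_t) / (1 - mu_u w) - 1) / (1 - mu_t mu_u) is a function of t times
    a function of u. *)
Lemma det_baker w : (forall t, 1 - mu t * w != 0) ->
  \det (1%:M + diag_mx (\row_t ((1 - w / mu t) / (1 - mu t * w))) *m diag_mx (\row_t B t) *m cauchy_mx)
  = \det baker_mx * baker w.
Proof.
move=> hw.
pose D1 := diag_mx (\row_t (1 - w / mu t)); pose D2 : 'M[F]_N := diag_mx (\row_t (1 - mu t * w)^-1).
have hD : diag_mx (\row_t ((1 - w / mu t) / (1 - mu t * w))) *m diag_mx (\row_t B t) *m cauchy_mx
   = D2 *m (diag_mx (\row_t B t) *m D1 *m cauchy_mx).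
  apply/matrixP => t u; rewrite -!mulmxA !mul_diag_mx !mxE; ring.
have uD2 : D2 \in unitmx.
  rewrite unitmxE det_diag unitfE; apply/prodf_neq0 => t _; rewrite !mxE invr_eq0 //.
rewrite hD det_1_swap //.
have -> : 1%:M + diag_mx (\row_t B t) *m D1 *m cauchy_mx *m D2
  = baker_mx + (\col_t (B t / mu t)) *m (- \row_t (w / (1 - mu t * w))).
  rewrite /baker_mx -addrA; congr (_ + _); apply/matrixP => t u.
  rewrite mulmxN -!mulmxA mul_mx_diag !mul_diag_mx !mxE big_ord1 !mxE.
  by have h1 := hw u; have h2 := mu1 t u; have h3 := mu0 t; field; rewrite h1 h2 h3.
rewrite det_rank1 // /baker; congr (_ * (1 + _)).
rewrite mulNmx mxE mxE /residue_coef -sumrN; apply: eq_bigr => t _.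
by rewrite !mxE mulrC mulNr.
Qed.

(** The linear system that defines the residues says that each is proportional to
    the value of the function at mu_r. *)
Lemma residue_coefE r : residue_coef r 0 = - (B r / mu r) * baker (mu r).
Proof.
have h : baker_mx *m residue_coef = - \col_t (B t / mu t).
  by rewrite /residue_coef mulmxN mulKVmx.
rewrite /baker_mx mulmxDl mul1mx -mulmxA mul_diag_mx in h.
move: h; rewrite /baker; move: residue_coef => g h.
have := congr1 (fun m : 'cV_N => m r 0) h; rewrite !mxE; set S := \sum_j _ => h2.
have -> : g r 0 = - (B r / mu r) - B r * S by rewrite -h2 addrK.
have -> : \sum_t g t 0 * (mu r / (1 - mu t * mu r)) = mu r * S.
  rewrite /S mulr_sumr; apply: eq_bigr => t _; rewrite !mxE [mu t * mu r]mulrC; ring.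
by have h4 := mu0 r; field; rewrite h4.
Qed.

Definition node_poly : {poly F} := \prod_t (1 - mu t *: 'X).
Definition node_poly' t : {poly F} := \prod_(u | u != t) (1 - mu u *: 'X).

Lemma node_polyE x : node_poly.[x] = \prod_t (1 - mu t * x).
Proof. by rewrite /node_poly horner_prod; apply: eq_bigr => t _; rewrite !hornerE. Qed.

Lemma node_poly'E t x : (node_poly' t).[x] = \prod_(u | u != t) (1 - mu u * x).
Proof. by rewrite /node_poly' horner_prod; apply: eq_bigr => u _; rewrite !hornerE. Qed.

Lemma node_polyD t x : node_poly.[x] = (1 - mu t * x) * (node_poly' t).[x].
Proof. by rewrite node_polyE node_poly'E (bigD1 t). Qed.

Lemma size_node_poly_gen (p : pred 'I_N) :
  (size (\prod_(u | p u) (1 - mu u *: 'X) : {poly F})%R <= #|p|.+1)%N.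
Proof.
rewrite -sum1_card; elim/big_rec2: _ => [|u k P _ IH]; first by rewrite size_poly1.
by rewrite add1n; exact: (size_mulp (m := 1) (size_1BX _) IH).
Qed.

Definition partial_frac_poly (e : 'I_N -> F) : {poly F} := \sum_t e t *: ('X * node_poly' t).

Lemma size_partial_frac_poly e : (size (partial_frac_poly e) <= N.+1)%N.
Proof.
apply: leq_trans (size_sum _ _ _) _; apply/bigmax_leqP => t _.
apply: leq_trans (size_scale_leq _ _) _.
have h : (size (node_poly' t) <= N)%N.
  apply: leq_trans (size_node_poly_gen _) _.
  have := cardC1 t; rewrite card_ord => h.
  have -> : #|(fun u => u != t)| = N.-1 by rewrite -h; apply: eq_card => u; rewrite !inE.
  by rewrite prednK //; case: t {h} => m; case: N.
apply: leq_trans (size_polyMleq _ _) _; rewrite size_polyX.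
exact: h.
Qed.

Lemma partial_frac_poly0 e : (partial_frac_poly e).[0] = 0.
Proof. by rewrite horner_sum big1 // => t _; rewrite hornerZ hornerM hornerX mul0r mulr0. Qed.

Lemma partial_frac_polyE e x : (forall t, 1 - mu t * x != 0) ->
  (partial_frac_poly e).[x] = node_poly.[x] * \sum_t e t * (x / (1 - mu t * x)).
Proof.
move=> hx; rewrite horner_sum mulr_sumr; apply: eq_bigr => t _.
rewrite hornerZ hornerM hornerX (node_polyD t); field; exact: hx.
Qed.

Lemma partial_frac_poly_pole e r :
  (partial_frac_poly e).[(mu r)^-1] = e r / mu r * (node_poly' r).[(mu r)^-1].
Proof.
rewrite horner_sum (bigD1 r) //= big1 ?addr0 => [|t tr].
  by rewrite hornerZ hornerM hornerX mulrA.
rewrite hornerZ hornerM node_poly'E (bigD1 r) //=; last by rewrite eq_sym.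
by rewrite mulfV // subrr mul0r !mulr0.
Qed.

Lemma node_poly'_neq0 r : (node_poly' r).[(mu r)^-1] != 0.
Proof.
rewrite node_poly'E; apply/prodf_neq0 => u ur; rewrite subr_eq0 eq_sym.
apply: contra ur => /eqP h; apply/eqP/muI.
by rewrite -[LHS](mulfVK (mu0 r)) h mul1r.
Qed.

Variable c : 'I_N -> F.
Hypothesis hc : forall r, c r * node_poly.[mu r]
  = - (B r / mu r ^+ 2) * (mu r ^+ N * (node_poly' r).[(mu r)^-1]).

Definition baker_poly : {poly F} := node_poly + partial_frac_poly (fun t => residue_coef t 0).

Lemma size_baker_poly : (size baker_poly <= N.+1)%N.
Proof.
apply: leq_trans (size_polyD _ _) _; rewrite geq_max size_partial_frac_poly andbT.
by apply: leq_trans (size_node_poly_gen _) _; rewrite card_ord.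
Qed.

Lemma baker_polyE x : (forall t, 1 - mu t * x != 0) -> baker_poly.[x] = node_poly.[x] * baker x.
Proof. by move=> hx; rewrite hornerD partial_frac_polyE // /baker mulrDr mulr1. Qed.

(** By residue_coefE, since the value of the polynomial at 1 / mu_r is given by
    the residue there. *)
Lemma baker_poly_symmetry r : (rev_poly N baker_poly).[mu r] = c r * baker_poly.[mu r].
Proof.
rewrite (horner_rev_poly size_baker_poly) // (@baker_polyE (mu r)); last by move=> t; exact: mu1.
rewrite mulrA hc hornerD partial_frac_poly_pole residue_coefE.
rewrite [node_poly.[_]](node_polyD r) mulfV // subrr mul0r add0r.
by have h := mu0 r; field; rewrite h.
Qed.

(** Such a polynomial is the product of the 1 - mu_t w times a combination of the
    w / (1 - mu_t w), whose coefficients solve the homogeneous linear system with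
    the invertible matrix baker_mx. *)
Lemma baker_unique (R : {poly F}) : (size R <= N.+1)%N -> R.[0] = 0 ->
  (forall r, (rev_poly N R).[mu r] = c r * R.[mu r]) -> R = 0.
Proof.
move=> sR R0 hR.
pose e t := R.[(mu t)^-1] * mu t / (node_poly' t).[(mu t)^-1].
have RE : R = partial_frac_poly e.
  apply/eqP; rewrite -subr_eq0; apply/negPn/negP => hd.
  (* N + 1 points, at which the two polynomials of degree at most N agree *)
  pose rs := 0 :: [seq (mu t)^-1 | t <- enum 'I_N].
  have hroot : all (root (R - partial_frac_poly e)) rs.
    rewrite /= rootE hornerD hornerN R0 partial_frac_poly0 subrr eqxx /=.
    apply/allP => x /mapP[t _ ->]; rewrite rootE hornerD hornerN partial_frac_poly_pole /e.
    have h1 := node_poly'_neq0 t; have h2 := mu0 t.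
    by apply/eqP; field; rewrite h1 h2.
  have hu : uniq rs.
    rewrite /= map_inj_uniq ?enum_uniq ?andbT; last by move=> t u /invr_inj /muI.
    apply/negP => /mapP[t _] /esym /eqP; rewrite invr_eq0; exact/negP.
  have := max_poly_roots hd hroot hu; rewrite /= size_map size_enum_ord ltnNge.
  apply/negP/negPn; apply: leq_trans (size_polyD _ _) _.
  by rewrite size_polyN geq_max sR size_partial_frac_poly.
have he r : e r + B r * (\sum_t (1 - mu r * mu t)^-1 * e t) = 0.
  have := hR r; rewrite horner_rev_poly // RE partial_frac_poly_pole.
  rewrite partial_frac_polyE; last by move=> t; exact: mu1.
  rewrite [c r * _]mulrA hc => h.
  have h1 := node_poly'_neq0 r; have h2 := mu0 r.
  have h3 : mu r ^+ N != 0 by rewrite expf_neq0.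
  set S := \sum_t _ * e t.
  have hS : \sum_t e t * (mu r / (1 - mu t * mu r)) = mu r * S.
    by rewrite /S mulr_sumr; apply: eq_bigr => t _; rewrite [mu t * mu r]mulrC; ring.
  rewrite hS in h.
  have h4 : mu r ^+ N * (node_poly' r).[(mu r)^-1] / mu r != 0.
    by rewrite !mulf_neq0 // invr_eq0.
  apply: (mulfI h4); rewrite mulr0 mulrDr; apply/eqP; rewrite addr_eq0; apply/eqP.
  transitivity (mu r ^+ N * (e r / mu r * (node_poly' r).[(mu r)^-1])); first by ring.
  by rewrite h; field; rewrite h2.
have e0 : (\col_t e t : 'cV[F]_N) = 0.
  have : baker_mx *m \col_t e t = 0.
    apply/matrixP => t k; rewrite /baker_mx mulmxDl mul1mx -mulmxA mul_diag_mx !mxE.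
    by rewrite -[RHS](he t); congr (_ + _ * _); apply: eq_bigr => u _; rewrite !mxE.
  by move=> h; rewrite -(mulKmx hM (\col_t e t)) h mulmx0.
rewrite RE /partial_frac_poly big1 // => t _.
by have := congr1 (fun m : 'cV_N => m t 0) e0; rewrite !mxE => ->; rewrite scale0r.
Qed.
End Baker.

(** * The difference equation of the determinant ratio *)

Section BakerRecurrence.
Variables (F : numFieldType) (N : nat) (q v1 v2 e1 e2 e3 e4 r z : F).
Variables (s : 'I_N -> F) (j : 'I_N -> nat) (tau : F -> F).
Hypotheses (q0 : q != 0) (e10 : e1 != 0) (e20 : e2 != 0) (e30 : e3 != 0) (e40 : e4 != 0)
  (he : e1 * e2 * e3 * e4 * q = q ^+ N) (hr : r ^+ 2 = q) (hq : forall k, 1 - q ^+ k.+1 != 0)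
  (z0 : z != 0) (hs : forall t, s t ^+ 2 = 1) (hj : forall t, (0 < j t)%N)
  (hinj : forall t u, s t = s u -> j t = j u -> t = u)
  (hclosed : forall t, (2 < j t)%N -> exists2 u, s u = s t & j t = (j u).+2)
  (htau : forall e, tau e ^+ 2 = 1).
Let mu t := s t * r ^+ j t.
Let nU x := (numU e1 e2 e3 e4).[x].
Let nU' x := (numU' e1 e2 e3 e4).[x].
Hypothesis hU : forall x, nU x * \prod_t (1 - mu t * (x / q))
  = (1 - x ^+ 2) * (1 - x ^+ 2 / q) * \prod_t (1 - mu t * x).
Hypothesis hV : forall e, e ^+ 2 = 1 ->
  e * r * (v1 * (1 + q) + v2 * (e * r)) = - (tau e * r ^- N * (1 + q) * nU (e * r)).
Hypothesis mu1 : forall t u, 1 - mu t * mu u != 0.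
Variable B : 'I_N -> F.
Hypothesis hB : forall t, B t = - (s t ^+ N.+1 * (tau (s t) * (r * z)) ^+ j t * (1 - mu t ^+ 2)
   * \prod_(u | u != t) ((1 - mu t * mu u) / (mu t - mu u))).
Hypothesis hM : baker_mx mu B \in unitmx.

Lemma node_sign_neq0 t : s t != 0.
Proof.
by apply/eqP => e; have := hs t; rewrite e expr0n /= => /eqP; rewrite eq_sym oner_eq0.
Qed.

Lemma node_r_neq0 : r != 0. Proof. by move: q0; rewrite -hr expf_eq0. Qed.

Lemma node_mu_neq0 t : mu t != 0.
Proof. by rewrite mulf_neq0 ?node_sign_neq0 // expf_neq0 // node_r_neq0. Qed.

Lemma node_mu_inj : injective mu.
Proof.
by move=> t u /(node_inj q0 hr hq (hs t) (hs u)) [h1 h2]; exact: hinj.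
Qed.

(** The products in the formula for B t are the values of the node polynomials at
    mu_t and at its inverse. *)
Lemma baker_coef_condition t :
  s t ^+ N * (tau (s t) * z) ^+ j t * (node_poly mu).[mu t]
  = - (B t / mu t ^+ 2) * (mu t ^+ N * (node_poly' mu t).[(mu t)^-1]).
Proof.
have m0 := node_mu_neq0 t; have s0 := node_sign_neq0 t; have r0 := node_r_neq0.
have hN : (0 < N)%N by apply: leq_ltn_trans (ltn_ord t).
rewrite (node_polyD mu t) !node_poly'E hB.
have -> : \prod_(u | u != t) (1 - mu u * (mu t)^-1)
   = (mu t / mu t ^+ N) * \prod_(u | u != t) (mu t - mu u).
  under eq_bigr => u _.
    have -> : 1 - mu u * (mu t)^-1 = (mu t)^-1 * (mu t - mu u) by field.
    over.
  rewrite big_split /= prodr_const; congr (_ * _).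
  have -> : #|(fun u : 'I_N => u != t)| = N.-1.
    by rewrite -[N in RHS]card_ord -(cardC1 t); apply: eq_card => u; rewrite !inE.
  have -> : mu t ^+ N = mu t * mu t ^+ N.-1 by rewrite -exprS prednK.
  by rewrite exprVn; field; rewrite m0 expf_neq0.
have -> : \prod_(u | u != t) (1 - mu u * mu t) =
   \prod_(u | u != t) ((1 - mu t * mu u) / (mu t - mu u)) * \prod_(u | u != t) (mu t - mu u).
  rewrite -big_split /=; apply: eq_bigr => u ut; rewrite divfK 1?mulrC //.
  by rewrite subr_eq0 eq_sym (inj_eq node_mu_inj).
move: (\prod_(u | _) _) => p1; move: (\prod_(u | _) _) => p2.
rewrite [(_ * (r * z)) ^+ _]exprMn [(r * z) ^+ _]exprMn [(_ * z) ^+ _]exprMn.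
have -> : s t ^+ N.+1 * (tau (s t) ^+ j t * (r ^+ j t * z ^+ j t))
   = s t ^+ N * (tau (s t) ^+ j t * z ^+ j t) * mu t.
  by rewrite exprSr /mu; ring.
have mN : mu t ^+ N != 0 by rewrite expf_neq0.
by field; rewrite m0 mN.
Qed.

(** Evaluation of dualOp_eq0 at w; the hypothesis on numU turns quotients of the
    node polynomial into the coefficients of the equation. *)
Theorem baker_recurrence w :
  (forall t, 1 - mu t * (w / q) != 0) -> (forall t, 1 - mu t * w != 0) ->
  (forall t, 1 - mu t * (q * w) != 0) ->
  1 - w ^+ 2 != 0 -> q - w ^+ 2 != 0 -> 1 - q * w ^+ 2 != 0 -> 1 - q ^+ 2 * w ^+ 2 != 0 ->
  baker mu B (w / q) / z
  + z * (nU' w * nU (q * w) / ((1 - w ^+ 2) * (1 - q * w ^+ 2) ^+ 2 * (1 - q ^+ 2 * w ^+ 2)))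
    * baker mu B (q * w)
  + w * (v1 * (1 + w ^+ 2) + v2 * w) / ((1 - w ^+ 2 / q) * (1 - q * w ^+ 2)) * baker mu B w
  = (z + z^-1) * baker mu B w.
Proof.
move=> hwm hw hwp h1 h2 h3 h4.
have h0 : dualOp q v1 v2 e1 e2 e3 e4 z (baker_poly mu B) = 0.
  apply: (@dualOp_eq0 F N q v1 v2 e1 e2 e3 e4 q0 e10 e20 e30 e40 he r z s j tau
     hr hq z0 hs hj hclosed htau hU hV (baker_poly mu B) (size_baker_poly mu B)).
    by move=> t; apply: (baker_poly_symmetry node_mu_neq0 mu1 hM
      (c := fun t => s t ^+ N * (tau (s t) * z) ^+ j t));
      exact: baker_coef_condition.
  by move=> R sR R0 hR; apply: (baker_unique node_mu_neq0 mu1 node_mu_inj hM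
     (c := fun t => s t ^+ N * (tau (s t) * z) ^+ j t)) => //; exact: baker_coef_condition.
have := congr1 (fun p => p.[w]) h0; rewrite /= dualOpE horner0 numVE.
have eqw : q^-1 * w = w / q by rewrite mulrC.
rewrite eqw !baker_polyE //.
have u1 := hU w; have u2 := hU (q * w).
rewrite -!(node_polyE mu) in u1 u2.
have Pw : (node_poly mu).[w] != 0 by rewrite node_polyE; apply/prodf_neq0.
have Pm : (node_poly mu).[w / q] != 0 by rewrite node_polyE; apply/prodf_neq0.
have Pq : (node_poly mu).[q * w] != 0 by rewrite node_polyE; apply/prodf_neq0.
rewrite [q * w / q]mulrC mulKf // in u2.
move: u1 u2; rewrite -/(nU w) -/(nU' w).
move: (nU w) (nU' w) (nU (q * w)) (baker mu B (w / q)) (baker mu B (q * w)) (baker mu B w).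
move: ((node_poly mu).[w]) ((node_poly mu).[w / q]) ((node_poly mu).[q * w]) Pw Pm Pq.
move=> p1 pm pq hp1 hpm hpq n1 n2 n3 b1 b2 b3 u1 u2 H.
have n1E : n1 = (1 - w ^+ 2) * (1 - w ^+ 2 / q) * p1 / pm by rewrite -u1 mulfK.
have n3E : n3 = (1 - (q * w) ^+ 2) * (1 - (q * w) ^+ 2 / q) * pq / p1 by rewrite -u2 mulfK.
apply/eqP; rewrite -subr_eq0; apply/eqP.
match type of H with ?S = _ =>
  transitivity (S / (p1 * (1 - w ^+ 2) * (1 - w ^+ 2 / q) * (1 - q * w ^+ 2))) end; last first.
  by rewrite H mul0r.
rewrite n1E n3E; field.
by rewrite exprMn q0 h3 h2 h1 hp1 z0 hpm h4.
Qed.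
End BakerRecurrence.

(** * The reduced Askey-Wilson function is a determinant ratio *)

Lemma dualPsi_orbit (F : fieldType) (q a b c d t w Q : F) :
  (1 - t * w * q * Q) * (1 - q * w * q / t * Q) * (1 - a * b / t * w * q * Q)
  * (1 - q * w * q / (a * b / t) * Q)
  * ((1 - a * c / t * w * q * Q) * (1 - q * w * q / (a * c / t) * Q))
  * ((1 - a * d / t * w * q * Q) * (1 - q * w * q / (a * d / t) * Q))
  * (1 - q * w ^+ 2 * q ^+ 1 * Q ^+ 2)^-1
  * ((1 - q * w ^+ 2 * q ^+ 2 * Q ^+ 2)^-1 * (1 - q * w ^+ 2 * q ^+ 2 * Q ^+ 2)^-1
     * (1 - q * w ^+ 2 * q ^+ 3 * Q ^+ 2)^-1)
  = dualPsi q a b c d t (w * (Q * q)).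
Proof.
have e x : x * (w * (Q * q)) = x * w * q * Q by ring.
have e' x : q * (w * (Q * q)) / x = q * w * q / x * Q by ring.
have g1 : (w * (Q * q)) ^+ 2 = q * w ^+ 2 * q ^+ 1 * Q ^+ 2 by ring.
have g2 : q * (q * w ^+ 2 * q ^+ 1 * Q ^+ 2) = q * w ^+ 2 * q ^+ 2 * Q ^+ 2 by ring.
have g3 : q ^+ 2 * (q * w ^+ 2 * q ^+ 1 * Q ^+ 2) = q * w ^+ 2 * q ^+ 3 * Q ^+ 2 by ring.
rewrite /dualPsi !e' !e g1 g2 g3.
move: (1 - q * w ^+ 2 * q ^+ 1 * Q ^+ 2) (1 - q * w ^+ 2 * q ^+ 2 * Q ^+ 2)
  (1 - q * w ^+ 2 * q ^+ 3 * Q ^+ 2) => D1 D2 D3.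
by rewrite !(invfM (D1 * _)) (invfM D1) -exprVn expr2 !mulrA.
Qed.

Lemma dualV_orbit (F : fieldType) (q v1 v2 w Q : F) : q != 0 ->
  w * q * Q * (v1 * (1 + w * q * Q * (w * q * Q)) + v2 * (w * q * Q))
  * ((1 - q * w ^+ 2 * q ^+ 0 * Q ^+ 2)^-1 * (1 - q * w ^+ 2 * q ^+ 2 * Q ^+ 2)^-1)
  = dualV q v1 v2 (w * (Q * q)).
Proof.
move=> q0; have e : w * (Q * q) = w * q * Q by ring.
have g1 : (w * q * Q) ^+ 2 / q = q * w ^+ 2 * q ^+ 0 * Q ^+ 2 by field.
have g2 : q * (w * q * Q) ^+ 2 = q * w ^+ 2 * q ^+ 2 * Q ^+ 2 by ring.
by rewrite /dualV e g1 g2 invfM -expr2.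
Qed.

Section Near1.
Variables (R : realType) (q : R).
Hypotheses (q0 : 0 < q) (q1 : q < 1).
Local Notation C := (Cplx R).
Local Notation qC := (q%:C : C).
Implicit Types (u v : nat -> C).

Definition near1 u := bigOq q (fun n => u n - 1) 1.

Lemma near1_bounded u : near1 u -> bigOq q u 0.
Proof.
move=> h; apply: bigOq_ext (bigOqD (bigOq_le q0 q1 (leq0n 1) h) (bigOq_cst q 1)) => n.
by rewrite subrK.
Qed.

Lemma near1M u v : near1 u -> near1 v -> near1 (fun n => u n * v n).
Proof.
move=> hu hv; have := bigOqD (@bigOqM _ _ _ _ 1 0 hu (near1_bounded hv)) hv.
by apply: bigOq_ext => n; ring.
Qed.

Lemma near1_1B (x : nat -> C) : bigOq q x 1 -> near1 (fun n => 1 - x n).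
Proof. by move=> h; apply: bigOq_ext (bigOqN h) => n; ring. Qed.

Lemma bigOq_qX1 (x : C) m : bigOq q (fun n => x * qC ^+ (n * m.+1)) 1.
Proof.
have h := @bigOqM _ _ _ _ 0 m.+1 (bigOq_cst q x) (bigOq_qX q0 m.+1).
apply: bigOq_ext (@bigOq_le _ _ q0 q1 _ m.+1 1 _ h) => // n.
by rewrite mulnC.
Qed.

Lemma bigOqV_1Bq (u : C) m : (forall n, 1 - u * qC ^+ n != 0) ->
  bigOq q (fun n => (1 - u * qC ^+ (n * m))^-1) 0.
Proof.
move=> /(qpoch_lower q0 q1) [e e0 he]; exists e^-1 => n; rewrite mul0n expr0 mulr1.
have := he (n * m)%N 1%N; rewrite /qpoch big_ord1 expr0 mulr1 => h.
by rewrite modulusV lef_pV2 ?posrE // (lt_le_trans e0).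
Qed.

Lemma near1V (u : C) m : (forall n, 1 - u * qC ^+ n != 0) ->
  near1 (fun n => (1 - u * qC ^+ (n * m.+1))^-1).
Proof.
move=> h; have := @bigOqM _ _ _ _ 1 0 (bigOq_qX1 u m) (@bigOqV_1Bq u m.+1 h).
by apply: bigOq_ext => n; have := h (n * m.+1)%N => h1; field.
Qed.

End Near1.

Lemma recurrence_sub (F : fieldType) (z P V f0 f1 f2 g0 g1 g2 : F) :
  f0 / z + z * P * f2 + V * f1 = (z + z^-1) * f1 ->
  g0 / z + z * P * g2 + V * g1 = (z + z^-1) * g1 ->
  (f0 - g0) / z + z * P * (f2 - g2) + V * (f1 - g1) = (z + z^-1) * (f1 - g1).
Proof.
move=> hf hg; rewrite [in RHS]mulrBr -hf -hg; ring.
Qed.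

Section AWisBaker.
Variables (R : realType) (q : R).
Hypotheses (q0 : 0 < q) (q1 : q < 1).
Local Notation C := (Cplx R).
Local Notation qC := (q%:C : C).
Variables (a b c d t : C).
Hypotheses (a0 : a != 0) (b0 : b != 0) (c0 : c != 0) (d0 : d != 0) (t0 : t != 0).
Hypothesis (habcd : t ^+ 2 * qC = a * b * c * d).
Variables (N : nat) (mu B : 'I_N -> C) (z w : C).
Hypotheses (z0 : z != 0) (w0 : w != 0) (hg : AWgen q a b c d t z w).
Hypothesis hmu : forall i, modulus (mu i * w) < 1.

Lemma mu_orbit_neq1 i n : 1 - mu i * w * qC ^+ n != 0.
Proof.
apply: one_sub_neq0; rewrite modulusM (modulus_qX q0).
by apply: le_lt_trans (hmu i); rewrite ler_piMr ?modulus_ge0 // (qX_le1 q0 q1).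
Qed.

Lemma baker_term_bigO i (g : C) :
  bigOq q (fun n => g * (w * qC ^+ n / (1 - mu i * (w * qC ^+ n)))) 1.
Proof.
have h1 := bigOq_qX1 q0 q1 (g * w) 0; have h2 := @bigOqV_1Bq _ _ q0 q1 (mu i * w) 1 (@mu_orbit_neq1 i).
by apply: bigOq_ext (@bigOqM _ _ _ _ 1 0 h1 h2) => n; rewrite muln1 !mulrA.
Qed.

Lemma baker_near1 : near1 q (fun n => baker mu B (w * qC ^+ n)).
Proof.
rewrite /near1 /baker.
suff : bigOq q (fun n => \sum_i residue_coef mu B i 0 * (w * qC ^+ n / (1 - mu i * (w * qC ^+ n)))) 1.
  by apply: bigOq_ext => n; rewrite addrAC subrr add0r.
elim: (index_enum _) => [|i l IH].
  by apply: bigOq_ext (bigOq_le q0 q1 (isT : (1 <= 1)%N) (bigOqN (bigOq_qX1 q0 q1 0 0))) => n;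
    rewrite big_nil mul0r oppr0.
by apply: bigOq_ext (bigOqD (@baker_term_bigO i (residue_coef mu B i 0)) IH) => n; rewrite big_cons.
Qed.

Lemma baker_expandable : expandable q (fun n => baker mu B (w * qC ^+ n)).
Proof.
apply: (expandableD (@expandable_cst _ q 1)).
apply: (expandable_sum) => i.
have [e e0 he] := qpoch_lower q0 q1 (@mu_orbit_neq1 i).
have he' n : e <= modulus (1 - mu i * w * qC ^+ n).
  by have := he n 1%N; rewrite /qpoch big_ord1 expr0 mulr1.
have h := expandableM q0 q1
  (expandableM q0 q1 (@expandable_cst _ q (residue_coef mu B i 0 * w)) (@expandable_qX _ q))
  (expandableV q0 q1 e0 he' (expandable_1Bq q0 q1 (mu i * w))).
by apply: expandable_ext h => n; rewrite !mulrA.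
Qed.

Let Psi n := dualPsi qC a b c d t (w * qC ^+ n.+1).
Let V n := dualV qC (dualV1 a b c d t) (dualV2 qC a b c d) (w * qC ^+ n.+1).

Lemma dualPsi_near1 : near1 q Psi.
Proof.
have M := @near1M _ _ q0 q1.
have L x : near1 q (fun n => 1 - x * qC ^+ n).
  by apply: near1_1B; apply: bigOq_ext (bigOq_qX1 q0 q1 x 0) => n; rewrite muln1.
have I k : near1 q (fun n => (1 - qC * w ^+ 2 * qC ^+ k * qC ^+ (n * 2))^-1).
  by apply: near1V => // n; have := AWgen_w2 hg (k + n); rewrite exprD mulrA.
have h := M _ _ (M _ _ (M _ _ (M _ _ (M _ _ (M _ _ (M _ _ (L (t * w * qC)) (L (qC * w * qC / t)))
   (L (a * b / t * w * qC))) (L (qC * w * qC / (a * b / t))))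
   (M _ _ (L (a * c / t * w * qC)) (L (qC * w * qC / (a * c / t)))))
   (M _ _ (L (a * d / t * w * qC)) (L (qC * w * qC / (a * d / t)))))
   (I 1%N)) (M _ _ (M _ _ (I 2%N) (I 2%N)) (I 3%N)).
apply: bigOq_ext h => n; congr (_ - 1).
by rewrite /Psi (exprSr qC n) -dualPsi_orbit (exprM qC n).
Qed.

Lemma dualV_bigO : bigOq q V 1.
Proof.
have M := @bigOqM R q.
have I k : bigOq q (fun n => (1 - qC * w ^+ 2 * qC ^+ k * qC ^+ (n * 2))^-1) 0.
  by apply: bigOqV_1Bq => // n; have := AWgen_w2 hg (k + n); rewrite exprD mulrA.
have cst x := bigOq_cst q x.
have hw := bigOq_qX1 q0 q1 (w * qC) 0.
have hw2 := bigOqM hw hw.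
have hw2' := bigOq_le q0 q1 (isT : (0 <= 1 + 1)%N) hw2.
have hw' := bigOq_le q0 q1 (isT : (0 <= 1)%N) hw.
have h1 := bigOqM (cst (dualV1 a b c d t)) (bigOqD (cst 1) hw2').
have h2 := bigOqM (cst (dualV2 qC a b c d)) hw'.
have h := bigOqM (bigOqM hw (bigOqD h1 h2)) (bigOqM (I 0%N) (I 2%N)).
apply: bigOq_ext h => n.
by rewrite /V (exprSr qC n) !muln1 (exprM qC n); exact: dualV_orbit (qC_neq0 q0).
Qed.

Variables (s : 'I_N -> C) (j : 'I_N -> nat) (tau : C -> C) (r e1 e2 e3 e4 : C).
Hypotheses (e10 : e1 != 0) (e20 : e2 != 0) (e30 : e3 != 0) (e40 : e4 != 0)
  (he : e1 * e2 * e3 * e4 * qC = qC ^+ N) (hr : r ^+ 2 = qC)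
  (hs : forall i, s i ^+ 2 = 1) (hj : forall i, (0 < j i)%N)
  (hinj : forall i u, s i = s u -> j i = j u -> i = u)
  (hclosed : forall i, (2 < j i)%N -> exists2 u, s u = s i & j i = (j u).+2)
  (htau : forall e, tau e ^+ 2 = 1).
Hypothesis muE : forall i, mu i = s i * r ^+ j i.
Hypothesis hU : forall x, (numU e1 e2 e3 e4).[x] * \prod_i (1 - mu i * (x / qC))
  = (1 - x ^+ 2) * (1 - x ^+ 2 / qC) * \prod_i (1 - mu i * x).
Hypothesis hV : forall e, e ^+ 2 = 1 ->
  e * r * (dualV1 a b c d t * (1 + qC) + dualV2 qC a b c d * (e * r))
  = - (tau e * r ^- N * (1 + qC) * (numU e1 e2 e3 e4).[e * r]).
Hypothesis hPsi : forall x, dualPsi qC a b c d t x =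
  (numU' e1 e2 e3 e4).[x] * (numU e1 e2 e3 e4).[qC * x]
  / ((1 - x ^+ 2) * (1 - qC * x ^+ 2) ^+ 2 * (1 - qC ^+ 2 * x ^+ 2)).
Hypothesis mu1 : forall i u, 1 - mu i * mu u != 0.
Hypothesis hB : forall i, B i = - (s i ^+ N.+1 * (tau (s i) * (r * z)) ^+ j i * (1 - mu i ^+ 2)
   * \prod_(u | u != i) ((1 - mu i * mu u) / (mu i - mu u))).
Hypothesis hM : baker_mx mu B \in unitmx.

(** Both sides solve the same equation on the orbit w q^n, with expansions that
    start with 1, so that recurrence_unique applies to their difference. *)
Theorem AWred_eq_baker : AWred q a b c d t z w = baker mu B w.
Proof.
have qn0 := qC_neq0 q0.
apply/eqP; rewrite -subr_eq0; apply/eqP.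
pose h n := AWred q a b c d t z (w * qC ^+ n) - baker mu B (w * qC ^+ n).
suff : h 0%N = 0 by rewrite /h expr0 mulr1.
apply: (@recurrence_unique _ _ q0 q1 h Psi V z z0).
- by move=> m; rewrite (exprS qC) mulrA [z ^+ 2 * qC]mulrC; exact: (AWgen_z2 hg m).
- apply: expandableB => //; last exact: baker_expandable.
  exact: AWred_expandable.
- have := cvgC_sub (AWred_cvg1 q0 q1 a0 b0 c0 d0 t0 z0 w0 hg) (bigOq1_cvg q0 q1 baker_near1).
  rewrite subr0 => h1; have := cvgC_sub h1 (@cvgC_cst _ 1); rewrite subrr.
  by apply: cvgC_ext => n; rewrite /h; ring.
- exact: dualPsi_near1.
- exact: dualV_bigO.
move=> n.
have hgn : AWgen q a b c d t z (w * qC ^+ n) by exact: AWgen_orbit.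
have wn0 : w * qC ^+ n != 0 by rewrite mulf_neq0 ?expf_neq0.
have hA := AWred_recurrence q0 q1 a0 b0 c0 d0 t0 habcd z0 wn0 hgn.
have muq k : forall i, 1 - mu i * (w * qC ^+ k) != 0.
  by move=> i; rewrite mulrA; exact: mu_orbit_neq1.
have gw := AWgen_w2 hg.
have hBk : baker mu B (w * qC ^+ n) / z
  + z * dualPsi qC a b c d t (w * qC ^+ n * qC) * baker mu B (w * qC ^+ n * qC * qC)
  + dualV qC (dualV1 a b c d t) (dualV2 qC a b c d) (w * qC ^+ n * qC) * baker mu B (w * qC ^+ n * qC)
  = (z + z^-1) * baker mu B (w * qC ^+ n * qC).
  have muE' : mu = (fun i => s i * r ^+ j i) by apply/funext.
  have muq' k i : 1 - s i * r ^+ j i * (w * qC ^+ k) != 0 by rewrite -muE; exact: muq.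
  have hq k : 1 - qC ^+ k.+1 != 0 by rewrite exprS; exact: q_orbit_neq1.
  have := @baker_recurrence C N qC (dualV1 a b c d t) (dualV2 qC a b c d) e1 e2 e3 e4 r z s j tau
    qn0 e10 e20 e30 e40 he hr hq z0 hs hj hinj hclosed htau.
  move: hU mu1 hB hM; rewrite muE' => hU' mu1' hB' hM' /(_ hU' hV mu1' B hB' hM' (w * qC ^+ n * qC)).
  rewrite mulfK // -muE' => H; rewrite hPsi [_ * qC * qC]mulrC; apply: H.
  + exact: muq'.
  + by move=> i; rewrite -[w * _ * _]mulrA -(exprSr qC n); exact: muq'.
  + move=> i; have -> : qC * (w * qC ^+ n * qC) = w * qC ^+ n.+2 by rewrite (exprSr qC n.+1) (exprSr qC n); ring.
    exact: muq'.
  + by have := gw (n + n + 1)%N; rewrite !exprD; congr (_ != _); ring.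
  + have -> : qC - (w * qC ^+ n * qC) ^+ 2 = qC * (1 - qC * w ^+ 2 * qC ^+ (n + n)).
      by rewrite exprD; ring.
    by rewrite mulf_neq0.
  + by have := gw (n + n + 2)%N; rewrite !exprD; congr (_ != _); ring.
  + by have := gw (n + n + 3)%N; rewrite !exprD; congr (_ != _); ring.
have e1' : w * qC ^+ n.+1 = w * qC ^+ n * qC by rewrite (exprSr qC n) mulrA.
have e2' : w * qC ^+ n.+2 = w * qC ^+ n * qC * qC by rewrite (exprSr qC n.+1) mulrA e1'.
rewrite /h /Psi /V e1' e2' -/(dualV _ _ _ _).
exact: recurrence_sub hA hBk.
Qed.

End AWisBaker.

(** * The index sets *)

Section IndexSet.
Variables np nm : nat.
Local Notation I := (index_seq np nm).

Lemma size_index_seq : size I = maxn np nm.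
Proof. rewrite /index_seq size_cat size_map !size_iota /absdiff; lia. Qed.

(** The truncated difference is 0 on the initial run of consecutive integers and
    accounts for the steps of 2 after it. *)
Lemma nth_index_seq i : (i < maxn np nm)%N ->
  nth 0%N I i = (i.+1 + (i.+1 - absdiff np nm))%N.
Proof.
move=> hi; rewrite /index_seq nth_cat size_iota; case: ltnP => h.
  by rewrite nth_iota //; lia.
have h' : (i - absdiff np nm < minn np nm)%N by move: h hi; rewrite /absdiff; lia.
by rewrite (nth_map 0%N) ?size_iota // nth_iota //; lia.
Qed.

Lemma nth_index_seq_lt i k : (i < k)%N -> (k < maxn np nm)%N ->
  (nth 0%N I i < nth 0%N I k)%N.
Proof. by move=> h1 h2; rewrite !nth_index_seq //; lia. Qed.

Lemma nth_index_seq_gt0 i : (i < maxn np nm)%N -> (0 < nth 0%N I i)%N.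
Proof. by move=> h; rewrite nth_index_seq. Qed.

Lemma nth_index_seq_inj i k : (i < maxn np nm)%N -> (k < maxn np nm)%N ->
  nth 0%N I i = nth 0%N I k -> i = k.
Proof.
move=> hi hk e; case: (ltngtP i k) => // h.
  by have := nth_index_seq_lt h hk; rewrite e ltnn.
by have := nth_index_seq_lt h hi; rewrite e ltnn.
Qed.

(** A shift of w by q turns the node j into j - 2, which is again in the set
    unless j is 1 or 2. *)
Lemma nth_index_seq_pred i : (i < maxn np nm)%N -> (2 < nth 0%N I i)%N ->
  exists2 k, (k < maxn np nm)%N & nth 0%N I i = (nth 0%N I k).+2.
Proof.
move=> hi; rewrite nth_index_seq // => h.
have [h1|h1] := leqP i.+1 (absdiff np nm).
  by exists (i - 2)%N; rewrite ?nth_index_seq //; lia.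
by exists (i - 1)%N; rewrite ?nth_index_seq //; lia.
Qed.

Lemma eta_nth i : (i < maxn np nm)%N -> Defs.eta np nm (nth 0%N I i) = i.+1.
Proof. by move=> hi; rewrite nth_index_seq // /Defs.eta; case: ifP; lia. Qed.

(** The sign tau for which epsilon_j times the alternating sign of the position
    of j is - tau^j. *)
Definition block_parity (F : pzRingType) : F := if (nm <= np)%N then -1 else 1.

Lemma epsj_nth (R : realType) i : (i < maxn np nm)%N ->
  epsj R np nm (nth 0%N I i) * (-1) ^+ i = - block_parity R ^+ nth 0%N I i.
Proof.
move=> hi; rewrite /epsj /block_parity eta_nth //; case: ifP => _.
  have e : (-1 : R) ^+ i * (-1) ^+ i = 1 by rewrite -exprMn mulN1r opprK expr1n.
  rewrite addSn exprS exprD; move: ((-1) ^+ i) ((-1) ^+ nth _ _ _) e => u v e.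
  by transitivity (- (u * u * v)); [ring | rewrite e mul1r].
by rewrite expr1n [_ ^+ i.+1]exprS mulN1r mulNr -exprMn mulN1r opprK expr1n.
Qed.

(** The factors cancel in steps of one up to absdiff np nm and in steps of two
    from there on. *)
Lemma block_telescope (F : fieldType) (r x : F) : r != 0 ->
  (1 - r ^+ absdiff np nm / r * x) * (1 - r ^+ (np + nm) * x)
  * \prod_(i < size I) (1 - r ^+ nth 0%N I i * (x / r ^+ 2))
  = (1 - x) * (1 - x / r) * \prod_(i < size I) (1 - r ^+ nth 0%N I i * x).
Proof.
move=> r0; rewrite size_index_seq.
suff H n : (n <= maxn np nm)%N ->
    (1 - r ^+ minn n (absdiff np nm) / r * x) * (1 - r ^+ (n + (n - absdiff np nm)) * x)
    * \prod_(i < n) (1 - r ^+ nth 0%N I i * (x / r ^+ 2))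
    = (1 - x) * (1 - x / r) * \prod_(i < n) (1 - r ^+ nth 0%N I i * x).
  have := H _ (leqnn _).
  have -> : minn (maxn np nm) (absdiff np nm) = absdiff np nm by rewrite /absdiff; lia.
  by have -> : (maxn np nm + (maxn np nm - absdiff np nm) = np + nm)%N by rewrite /absdiff; lia.
elim: n => [|n IH] hn; first by rewrite !big_ord0 min0n sub0n addn0 expr0; field.
rewrite !big_ord_recr /= mulrA [RHS]mulrA -(IH (ltnW hn)) nth_index_seq //.
move: (\prod_(i < n) _) => P.
case: (boolP (n < absdiff np nm)%N) => h.
  have -> : minn n.+1 (absdiff np nm) = n.+1 by lia.
  have -> : minn n (absdiff np nm) = n by lia.
  have -> : (n.+1 - absdiff np nm = 0)%N by lia.
  have -> : (n - absdiff np nm = 0)%N by lia.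
  by rewrite !addn0 !exprS; field.
have -> : minn n.+1 (absdiff np nm) = absdiff np nm by lia.
have -> : minn n (absdiff np nm) = absdiff np nm by lia.
have -> : (n.+1 + (n.+1 - absdiff np nm) = (n + (n - absdiff np nm)).+2)%N by lia.
by rewrite [r ^+ _.+2]exprS [r ^+ _.+1]exprS; field.
Qed.

(** For 0 < r < 1 the negative factors are those with k before i. *)
Lemma prod_index_norm (R : realFieldType) (r : R) (i : 'I_(size I)) : 0 < r -> r < 1 ->
  \prod_(k <- I | k != nth 0%N I i)
     `| (1 - r ^+ (nth 0%N I i + k)) / (r ^+ nth 0%N I i - r ^+ k) |
  = (-1) ^+ i * \prod_(k < size I | k != i)
     ((1 - r ^+ (nth 0%N I i + nth 0%N I k)) / (r ^+ nth 0%N I i - r ^+ nth 0%N I k)).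
Proof.
move=> r0 r1; rewrite (big_nth 0%N) big_mkord.
have szI := size_index_seq.
have hlt (k : 'I_(size I)) : (k < maxn np nm)%N by rewrite -szI.
rewrite (eq_bigl (fun k => k != i)); last first.
  move=> k; congr (~~ _); apply/eqP/eqP => [e|-> //].
  by apply: val_inj; exact: (nth_index_seq_inj (hlt k) (hlt i) e).
have -> : (-1 : R) ^+ i = \prod_(k < size I | k != i) (if (k < i)%N then -1 else 1).
  rewrite -(big_mkcondr _ _) /= prodr_const; congr (_ ^+ _).
  have winj : injective (widen_ord (ltnW (ltn_ord i))).
    by move=> u v /(congr1 val) /= e; apply: val_inj.
  rewrite -[LHS](card_ord i) -(card_codom winj).
  apply: eq_card => k; transitivity ((k != i) && (k < i)%N); last by [].
  apply/codomP/andP => [[u ->]|[_ hk]].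
    by rewrite /= ltn_ord; split => //; rewrite -val_eqE /= neq_ltn ltn_ord.
  by exists (Ordinal hk); apply: val_inj.
rewrite -big_split /=; apply: eq_bigr => k ki.
have posn n : (0 < n)%N -> r ^+ n < 1 by move=> n0; rewrite exprn_ilt1 ?(ltW r0) ?r1 -?lt0n.
have num0 : 0 < 1 - r ^+ (nth 0%N I i + nth 0%N I k).
  by rewrite subr_gt0 posn // addn_gt0 nth_index_seq_gt0.
rewrite normrM normfV (gtr0_norm num0).
have lt u v : (u < v)%N -> r ^+ v < r ^+ u by move=> h; rewrite ltr_iXn2l.
case: ltnP => h.
  rewrite ltr0_norm ?subr_lt0 ?lt ?nth_index_seq_lt //.
  by rewrite invrN mulrN mulN1r.
have h' : (i < k)%N by rewrite ltn_neqAle h andbT eq_sym.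
by rewrite gtr0_norm ?subr_gt0 ?lt ?nth_index_seq_lt // mul1r.
Qed.

End IndexSet.

(** * Nodes and coefficients of both blocks *)

Section Labels.
Variables npp npm nmp nmm : nat.
Local Notation Ip := (index_seq npp npm).
Local Notation Im := (index_seq nmp nmm).
Local Notation N := (label_size npp npm nmp nmm).
Implicit Type t : 'I_N.

Definition label_node t : nat :=
  match fintype.split (t : 'I_(size Ip + size Im)) with
  | inl i => nth 0%N Ip i | inr k => nth 0%N Im k end.

Definition label_sign (F : pzRingType) t : F :=
  match fintype.split (t : 'I_(size Ip + size Im)) with inl _ => 1 | inr _ => -1 end.

Definition label_parity (F : pzRingType) (e : F) : F :=
  if e == 1 then block_parity npp npm F else block_parity nmp nmm F.

Definition label_mu (F : pzRingType) (r : F) t : F := label_sign F t * r ^+ label_node t.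

(** The diagonal entry of B at z = q^x, in terms of the signed nodes, which treats
    the two blocks alike. *)
Definition label_coef (F : fieldType) (r z : F) t : F :=
  - (label_sign F t ^+ N.+1 * (label_parity (label_sign F t) * (r * z)) ^+ label_node t
     * (1 - label_mu r t ^+ 2)
     * \prod_(u | u != t) ((1 - label_mu r t * label_mu r u) / (label_mu r t - label_mu r u))).

Lemma label_node_l i : label_node (lshift (size Im) i) = nth 0%N Ip i.
Proof. by rewrite /label_node -[lshift _ _]/(unsplit (inl i)) unsplitK. Qed.
Lemma label_node_r k : label_node (rshift (size Ip) k) = nth 0%N Im k.
Proof. by rewrite /label_node -[rshift _ _]/(unsplit (inr k)) unsplitK. Qed.
Lemma label_sign_l (F : pzRingType) i : label_sign F (lshift (size Im) i) = 1.
Proof. by rewrite /label_sign -[lshift _ _]/(unsplit (inl i)) unsplitK. Qed.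
Lemma label_sign_r (F : pzRingType) k : label_sign F (rshift (size Ip) k) = -1.
Proof. by rewrite /label_sign -[rshift _ _]/(unsplit (inr k)) unsplitK. Qed.

Lemma label_sizeE : N = (maxn npp npm + maxn nmp nmm)%N.
Proof. by rewrite /label_size !size_index_seq. Qed.

Lemma index_lt_plus (i : 'I_(size Ip)) : (i < maxn npp npm)%N. Proof. by rewrite -size_index_seq. Qed.
Lemma index_lt_minus (i : 'I_(size Im)) : (i < maxn nmp nmm)%N. Proof. by rewrite -size_index_seq. Qed.

Lemma label_sign_sqr (F : pzRingType) t : label_sign F t ^+ 2 = 1.
Proof. by rewrite /label_sign; case: fintype.split => _; rewrite ?sqrrN expr1n. Qed.

Lemma label_parity_sqr (F : pzRingType) (e : F) : label_parity e ^+ 2 = 1.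
Proof.
by rewrite /label_parity /block_parity; case: eqP => _; case: ifP => _; rewrite ?sqrrN expr1n.
Qed.

Lemma label_node_gt0 t : (0 < label_node t)%N.
Proof.
rewrite /label_node; case: fintype.split => i.
  exact: nth_index_seq_gt0 (index_lt_plus i).
exact: nth_index_seq_gt0 (index_lt_minus i).
Qed.

Lemma one_eqN1F (F : numDomainType) : (1 == -1 :> F) = false.
Proof. by rewrite -subr_eq0 opprK -mulr2n pnatr_eq0. Qed.

Lemma label_inj (F : numDomainType) t u :
  label_sign F t = label_sign F u -> label_node t = label_node u -> t = u.
Proof.
case: (split_ordP (t : 'I_(size Ip + size Im))) => i ->;
case: (split_ordP (u : 'I_(size Ip + size Im))) => k ->;
rewrite ?label_sign_l ?label_sign_r ?label_node_l ?label_node_r => es ej.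
- by congr lshift; apply: val_inj; exact: (nth_index_seq_inj (index_lt_plus i) (index_lt_plus k) ej).
- by move: es => /eqP; rewrite one_eqN1F.
- by move: es => /eqP; rewrite eq_sym one_eqN1F.
- by congr rshift; apply: val_inj; exact: (nth_index_seq_inj (index_lt_minus i) (index_lt_minus k) ej).
Qed.

Lemma label_closed (F : pzRingType) t : (2 < label_node t)%N ->
  exists2 u, label_sign F u = label_sign F t & label_node t = (label_node u).+2.
Proof.
case: (split_ordP (t : 'I_(size Ip + size Im))) => i ->;
rewrite ?label_sign_l ?label_sign_r ?label_node_l ?label_node_r => h.
  have [k hk e] := nth_index_seq_pred (index_lt_plus i) h.
  rewrite -size_index_seq in hk.
  by exists (lshift (size Im) (Ordinal hk)); rewrite ?label_sign_l ?label_node_l.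
have [k hk e] := nth_index_seq_pred (index_lt_minus i) h.
rewrite -size_index_seq in hk.
by exists (rshift (size Ip) (Ordinal hk)); rewrite ?label_sign_r ?label_node_r.
Qed.

Lemma label_telescope (F : fieldType) (r x : F) : r != 0 ->
  (1 - r ^+ absdiff npp npm / r * x) * (1 - r ^+ (npp + npm) * x)
  * (1 - - (r ^+ absdiff nmp nmm / r) * x) * (1 - - r ^+ (nmp + nmm) * x)
  * \prod_t (1 - label_mu r t * (x / r ^+ 2))
  = (1 - x ^+ 2) * (1 - x ^+ 2 / r ^+ 2) * \prod_t (1 - label_mu r t * x).
Proof.
move=> r0; rewrite !big_split_ord /=.
have eP y : \prod_(i < size Ip) (1 - label_mu r (lshift (size Im) i) * y)
    = \prod_(i < size Ip) (1 - r ^+ nth 0%N Ip i * y).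
  by apply: eq_bigr => i _; rewrite /label_mu label_sign_l label_node_l mul1r.
have eM y : \prod_(i < size Im) (1 - label_mu r (rshift (size Ip) i) * y)
    = \prod_(i < size Im) (1 - r ^+ nth 0%N Im i * (- y)).
  by apply: eq_bigr => i _; rewrite /label_mu label_sign_r label_node_r mulN1r mulrN mulNr.
rewrite !eP !eM -(mulNr x).
have hP := block_telescope npp npm x r0; have hM := block_telescope nmp nmm (- x) r0.
transitivity ((1 - x) * (1 - x / r) * \prod_(i < size Ip) (1 - r ^+ nth 0%N Ip i * x)
  * ((1 - - x) * (1 - - x / r) * \prod_(i < size Im) (1 - r ^+ nth 0%N Im i * (- x)))).
  by rewrite -hP -hM; ring.
by field.
Qed.

Lemma label_mu_rmorph (F G : pzRingType) (f : {rmorphism F -> G}) r t :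
  f (label_mu r t) = label_mu (f r) t.
Proof.
by rewrite /label_mu rmorphM rmorphXn /label_sign; case: fintype.split => _; rewrite ?rmorphN1 ?rmorph1.
Qed.

Lemma label_coef_rmorph (F G : numFieldType) (f : {rmorphism F -> G}) r z t :
  f (label_coef r z t) = label_coef (f r) (f z) t.
Proof.
have fs : f (label_sign F t) = label_sign G t.
  by rewrite /label_sign; case: fintype.split => _; rewrite ?rmorphN1 ?rmorph1.
have fp : f (label_parity (label_sign F t)) = label_parity (label_sign G t).
  rewrite /label_parity /block_parity /label_sign; case: fintype.split => _;
  rewrite ?eqxx ?[-1 == 1]eq_sym ?one_eqN1F; case: ifP => _; rewrite ?rmorphN1 ?rmorph1 //.
rewrite /label_coef rmorphN !rmorphM rmorphXn rmorphXn !rmorphM rmorphB rmorph1 rmorphXn fs fp.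
rewrite label_mu_rmorph rmorph_prod; congr (- (_ * _)); apply: eq_bigr => u _.
by rewrite fmorph_div !rmorphB rmorph1 rmorphM !label_mu_rmorph.
Qed.

End Labels.

(** * The real matrix entries in terms of nodes *)

(** Each of the N - 1 factors takes one s, and s^(N + 1) = s^(N - 1). *)
Lemma sign_prod_others (F : fieldType) N (s : F) (t : 'I_N) (g : 'I_N -> F) : s ^+ 2 = 1 ->
  s ^+ N.+1 * \prod_(u | u != t) g u = \prod_(u | u != t) (s * g u).
Proof.
move=> s2; rewrite big_split /= prodr_const; congr (_ * _).
have -> : #|(fun u : 'I_N => u != t)| = N.-1.
  by rewrite -[N in RHS]card_ord -(cardC1 t); apply: eq_card => u; rewrite !inE.
have hN : (0 < N)%N by apply: leq_ltn_trans (ltn_ord t).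
by rewrite -[N in LHS]prednK // -addn2 exprD s2 mulr1.
Qed.

Lemma neg_cross_factor (F : fieldType) (a b : F) :
  -1 * ((1 - - a * b) / (- a - b)) = (1 + a * b) / (a + b).
Proof. by rewrite (mulNr a b) (opprK (a * b)) -opprD invrN mulrN mulN1r opprK. Qed.

Lemma neg_same_factor (F : fieldType) (a b : F) :
  -1 * ((1 - - a * - b) / (- a - - b)) = (1 - a * b) / (a - b).
Proof. by rewrite mulrNN -opprD invrN mulrN mulN1r opprK. Qed.

Section Matrices.
Variables (R : realType) (q : R) (npp npm nmp nmm : nat).
Hypotheses (q0 : 0 < q) (q1 : q < 1).
Local Notation Ip := (index_seq npp npm).
Local Notation Im := (index_seq nmp nmm).
Local Notation N := (label_size npp npm nmp nmm).
Local Notation r := (Num.sqrt q).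

Lemma sqrtq_gt0 : 0 < r. Proof. by rewrite sqrtr_gt0. Qed.
Lemma sqrtq_lt1 : r < 1. Proof. by rewrite -sqrtr1 ltr_sqrt. Qed.
Lemma sqrtq_sqr : r ^+ 2 = q. Proof. by rewrite sqr_sqrtr // ltW. Qed.

Lemma powR_half n : q `^ (n%:R / 2) = r ^+ n.
Proof. by rewrite -powR12_sqrt ?(ltW q0) // -powR_mulrn ?powR_ge0 // -powRrM mulrC. Qed.

Lemma powR_node (n : nat) (x : R) : q `^ (n%:R * (x + 1 / 2)) = (r * q `^ x) ^+ n.
Proof.
have q0' : q != 0 by rewrite gt_eqF.
rewrite mulrC powRrM powRD ?q0' ?implybT // mulrC powR_mulrn ?mulr_ge0 ?powR_ge0 //.
by rewrite mul1r -powR12_sqrt ?(ltW q0).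
Qed.

Lemma label_coef_split (t : 'I_N) x (D S P X : R) :
  D = (r * q `^ x) ^+ label_node t ->
  S = label_sign R t ->
  X = 1 - label_mu r t ^+ 2 ->
  P = \prod_(u | u != t) (S * ((1 - label_mu r t * label_mu r u) / (label_mu r t - label_mu r u))) ->
  label_coef r (q `^ x) t = (- label_parity npp npm nmp nmm S ^+ label_node t) * D * X * P.
Proof.
move=> -> -> -> ->; rewrite /label_coef -sign_prod_others ?label_sign_sqr // exprMn.
by ring.
Qed.

Lemma label_mu_sqr (t : 'I_N) : label_mu r t ^+ 2 = q ^+ label_node t :> R.
Proof. by rewrite exprMn label_sign_sqr mul1r exprAC sqrtq_sqr. Qed.

Lemma BblockE_l x : Bblock q npp npm Im x
  = diag_mx (\row_i label_coef r (q `^ x) (lshift (size Im) i : 'I_N)).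
Proof.
rewrite /Bblock; congr diag_mx; apply/rowP => i; rewrite !mxE; cbv zeta.
have hi := index_lt_plus i.
set S := label_sign R (lshift (size Im) i : 'I_N).
have S1 : S = 1 by exact: label_sign_l.
have muE k : label_mu r (lshift (size Im) k : 'I_N) = r ^+ nth 0%N Ip k.
  by rewrite /label_mu label_sign_l label_node_l mul1r.
have muE' k : label_mu r (rshift (size Ip) k : 'I_N) = - r ^+ nth 0%N Im k.
  by rewrite /label_mu label_sign_r label_node_r mulN1r.
rewrite (label_coef_split (erefl _) (erefl S) (erefl _) (erefl _)).
rewrite powR_node label_node_l label_mu_sqr label_node_l.
under eq_bigr => k _ do rewrite !powR_half.
under [X in _ * X = _]eq_bigr => k _ do rewrite !powR_half.
rewrite prod_index_norm ?sqrtq_gt0 ?sqrtq_lt1 //.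
rewrite big_split_ord /= S1 /label_parity eqxx -epsj_nth //.
under [X in _ = _ * (X * _)]eq_bigl => k do rewrite (inj_eq (@lshift_inj _ _)).
under [X in _ = _ * (X * _)]eq_bigr => k _ do rewrite !muE mul1r -exprD.
under [X in _ = _ * (_ * X)]eq_bigl => k do rewrite eq_rlshift.
under [X in _ = _ * (_ * X)]eq_bigr => k _ do rewrite muE muE' mul1r mulrN opprK opprK -exprD.
rewrite (big_nth 0%N) big_mkord.
ring.
Qed.

Lemma BblockE_r x : Bblock q nmp nmm Ip x
  = diag_mx (\row_i label_coef r (q `^ x) (rshift (size Ip) i : 'I_N)).
Proof.
rewrite /Bblock; congr diag_mx; apply/rowP => i; rewrite !mxE; cbv zeta.
have hi := index_lt_minus i.
set S := label_sign R (rshift (size Ip) i : 'I_N).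
have S1 : S = -1 by exact: label_sign_r.
have muE k : label_mu r (lshift (size Im) k : 'I_N) = r ^+ nth 0%N Ip k.
  by rewrite /label_mu label_sign_l label_node_l mul1r.
have muE' k : label_mu r (rshift (size Ip) k : 'I_N) = - r ^+ nth 0%N Im k.
  by rewrite /label_mu label_sign_r label_node_r mulN1r.
rewrite (label_coef_split (erefl _) (erefl S) (erefl _) (erefl _)).
rewrite powR_node label_node_r label_mu_sqr label_node_r.
under eq_bigr => k _ do rewrite !powR_half.
under [X in _ * X = _]eq_bigr => k _ do rewrite !powR_half.
rewrite prod_index_norm ?sqrtq_gt0 ?sqrtq_lt1 //.
rewrite big_split_ord /= S1 /label_parity [-1 == 1]eq_sym one_eqN1F -epsj_nth //.
under [X in _ = _ * (X * _)]eq_bigl => k do rewrite eq_lrshift.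
under [X in _ = _ * (X * _)]eq_bigr => k _.
  rewrite muE muE' neg_cross_factor -exprD; over.
under [X in _ = _ * (_ * X)]eq_bigl => k do rewrite (inj_eq (@rshift_inj _ _)).
under [X in _ = _ * (_ * X)]eq_bigr => k _.
  rewrite !muE' neg_same_factor -exprD; over.
rewrite (big_nth 0%N) big_mkord.
ring.
Qed.

End Matrices.

(** * Complex powers of q and the three matrices *)

Section QPow.
Variables (R : realType) (q : R).
Hypotheses (q0 : 0 < q).
Local Notation C := (Cplx R).

Lemma cexpD (u v : R[i]) : cexp (u + v) = cexp u * cexp v.
Proof.
case: u v => [a b] [c d]; rewrite /cexp /= expRD cosD sinD.
apply/eqP; rewrite eq_complex; apply/andP; split; apply/eqP => /=; ring.
Qed.

Lemma qpowD u v : qpow q (u + v) = qpow q u * qpow q v.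
Proof. by rewrite /qpow mulrDl cexpD. Qed.

Lemma qpow0 : qpow q 0 = 1.
Proof. by rewrite /qpow mul0r /cexp /= expR0 cos0 sin0 mul1r. Qed.

Lemma qpow_neq0 u : qpow q u != 0.
Proof.
apply/eqP => e; have := qpowD u (- u); rewrite subrr qpow0 e mul0r => /eqP.
by rewrite oner_eq0.
Qed.

Lemma qpowN u : qpow q (- u) = (qpow q u)^-1.
Proof.
by apply: (mulfI (qpow_neq0 u)); rewrite -qpowD subrr qpow0 divff // qpow_neq0.
Qed.

Lemma qpow_real (x : R) : qpow q x%:C = (q `^ x)%:C.
Proof.
rewrite /qpow /cexp /= !mul0r mulr0 subr0 addr0 cos0 sin0 mulr1 /powR gt_eqF //.
Qed.

Lemma modulus_qpow u : modulus (qpow q u) = q `^ (complex.Re u).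
Proof.
rewrite /qpow /cexp modulusM modulus_real ger0_norm ?expR_ge0 //.
rewrite /modulus normc_def /= cos2Dsin2 sqrtr1 mulr1 /powR gt_eqF //.
by case: u => a b /=; rewrite mulr0 subr0.
Qed.

End QPow.

Section Matrices.
Variables (R : realType) (q : R) (npp npm nmp nmm : nat).
Hypotheses (q0 : 0 < q) (q1 : q < 1).
Local Notation Ip := (index_seq npp npm).
Local Notation Im := (index_seq nmp nmm).
Local Notation N := (label_size npp npm nmp nmm).
Local Notation r := (Num.sqrt q).
Local Notation C := (Cplx R).

Lemma row_label (T : Type) (f : 'I_N -> T) :
  \row_t f t = row_mx (\row_i f (lshift (size Im) i)) (\row_k f (rshift (size Ip) k)).
Proof.
apply/rowP => t; rewrite mxE.
case: (split_ordP (t : 'I_(size Ip + size Im))) => i ->.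
  by rewrite row_mxEl mxE.
by rewrite row_mxEr mxE.
Qed.

Lemma BmxE x : Bmx q npp npm nmp nmm x = diag_mx (\row_t label_coef r (q `^ x) t).
Proof. by rewrite /Bmx row_label [RHS]diag_mx_row (@BblockE_l _ _ npp npm nmp nmm q0 q1)
  (@BblockE_r _ _ npp npm nmp nmm q0 q1). Qed.

Lemma CmxE : Cmx q npp npm nmp nmm = cauchy_mx (label_mu r : 'I_N -> R).
Proof.
apply/matrixP => t u; rewrite /Cmx [RHS]mxE /label_mu.
case: (split_ordP (t : 'I_(size Ip + size Im))) => i ->;
case: (split_ordP (u : 'I_(size Ip + size Im))) => k ->;
rewrite ?label_sign_l ?label_sign_r ?label_node_l ?label_node_r
  ?block_mxEul ?block_mxEur ?block_mxEdl ?block_mxEdr mxE (powR_half q0) exprD; congr (_^-1); ring.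
Qed.

Lemma AmxE (xh : R[i]) : Amx q npp npm nmp nmm xh =
  diag_mx (\row_t ((1 - qpow q xh / label_mu (r%:C : C) t) / (1 - label_mu (r%:C : C) t * qpow q xh))).
Proof.
have r0 : (r%:C : C) != 0 by rewrite (qC_neq0 (sqrtq_gt0 q0)).
have eD n : qpow q (xh + (n%:R / 2)%:C) = (r%:C : C) ^+ n * qpow q xh.
  by rewrite qpowD (qpow_real q0) (powR_half q0) rmorphXn mulrC.
have eB n : qpow q (xh - (n%:R / 2)%:C) = qpow q xh / (r%:C : C) ^+ n.
  by rewrite qpowD qpowN (qpow_real q0) (powR_half q0) rmorphXn.
rewrite /Amx row_label [RHS]diag_mx_row /Ablock.
congr (block_mx (diag_mx _) _ _ (diag_mx _)); apply/rowP => i; rewrite !mxE eD eB /label_mu.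
  by rewrite label_sign_l label_node_l !mul1r.
by rewrite label_sign_r label_node_r !mulN1r mulNr invrN mulrN.
Qed.

End Matrices.

(** * The special parameters *)

(** The relation under which (1 - alpha x) (1 - q x / alpha), a product invariant
    under alpha -> q / alpha, is a factor of dualPsi as prescribed by e. *)
Definition dual_pair (F : fieldType) (q alpha e : F) (f : bool) : Prop :=
  if f then alpha * e = 1 else alpha = q * e.

Lemma dual_pair_theta (F : fieldType) (q alpha e x : F) f : q != 0 -> e != 0 ->
  dual_pair q alpha e f ->
  (1 - alpha * x) * (1 - q * x / alpha) = (1 - e^-1 * x) * (1 - e * (q * x)).
Proof.
move=> q0 e0; case: f => /= [h|->]; last by field; rewrite q0 e0.
have -> : alpha = e^-1 by rewrite -[e^-1]mul1r -h mulfK.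
by rewrite invrK; ring.
Qed.

Lemma dual_pair_root (F : fieldType) (q alpha e w : F) f : q != 0 -> e != 0 ->
  dual_pair q alpha e f -> w ^+ 2 = q ->
  1 - alpha * w / q = (if f then - w / (q * e) else 1) * (1 - e * w).
Proof.
move=> q0 e0; case: f => /= [h|->] hw; last by field.
have -> : alpha = e^-1 by rewrite -[e^-1]mul1r -h mulfK.
have w0 : w != 0 by move: q0; rewrite -hw expf_eq0.
by rewrite -hw; field; rewrite w0 e0.
Qed.

(** At a square root w of q the coefficient factors; this is an identity of
    rational functions once d is eliminated. *)
Lemma dualV_root (F : fieldType) (q a b c d t w : F) :
  q != 0 -> a != 0 -> b != 0 -> c != 0 -> t != 0 -> t ^+ 2 * q = a * b * c * d -> w ^+ 2 = q ->
  w * (dualV1 a b c d t * (1 + q) + dualV2 q a b c d * w)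
  = - ((1 + q) * (q / a) * ((1 - t * w / q) * (1 - a * b / t * w / q)
      * (1 - a * c / t * w / q) * (1 - a * d / t * w / q))).
Proof.
move=> q0 a0 b0 c0 t0 h hw.
have w0 : w != 0 by move: q0; rewrite -hw expf_eq0.
have -> : d = t ^+ 2 * w ^+ 2 / (a * b * c) by rewrite hw h; field; rewrite c0 b0 a0.
rewrite /dualV1 /dualV2 -hw; field.
by rewrite w0 t0 a0 b0 c0.
Qed.

(** The e_i are what the telescoping over the nodes leaves over: e1 and e2 for I^+,
    e3 and e4 for I^-. *)
Section SpecialParams.
Variables (F : numFieldType) (r : F) (ap am bp bm : nat).
Hypothesis r0 : r != 0.
Local Notation q := (r ^+ 2).
Local Notation a := (r ^+ (am.*2 + 2)).
Local Notation b := (- r ^+ (ap.*2 + 2)).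
Local Notation c := (r ^+ (bm.*2 + 1)).
Local Notation d := (- r ^+ (bp.*2 + 1)).
Local Notation t := (r ^+ (am + ap + bm + bp + 2)).
Local Notation npp := (nplus ap bp).
Local Notation npm := (nplus am bm).
Local Notation nmp := (nminus ap bp).
Local Notation nmm := (nminus am bm).
Local Notation e1 := (r ^+ absdiff npp npm / r).
Local Notation e2 := (r ^+ (npp + npm)).
Local Notation e3 := (- (r ^+ absdiff nmp nmm / r)).
Local Notation e4 := (- r ^+ (nmp + nmm)).

Lemma params_product : t ^+ 2 * q = a * b * c * d.
Proof.
rewrite !(mulrN, mulNr) opprK -exprM -!exprD; congr (_ ^+ _); lia.
Qed.

Lemma nodes_product : e1 * e2 * e3 * e4 * q = q ^+ label_size npp npm nmp nmm.
Proof.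
transitivity (r ^+ absdiff npp npm * r ^+ (npp + npm) * r ^+ absdiff nmp nmm * r ^+ (nmp + nmm)).
  by field.
rewrite -exprM -!exprD label_sizeE; congr (_ ^+ _); rewrite /absdiff; lia.
Qed.

Let tn0 : t != 0. Proof. by rewrite expf_neq0. Qed.

Lemma dual_pair_t : dual_pair q t e2 false.
Proof. rewrite /= -exprD; congr (_ ^+ _); rewrite /nplus; lia. Qed.

Lemma dual_pair_pow (k l m n : nat) (s : F) (f : bool) : s ^+ 2 = 1 ->
  (if f then k + n = l + m else k + m = l + n + 2)%N ->
  dual_pair q (s * r ^+ k / r ^+ l) (s * (r ^+ n / r ^+ m)) f.
Proof.
move=> hs; case: f => /= h.
  transitivity (s ^+ 2 * r ^+ (k + n) / r ^+ (l + m)); last by rewrite hs h mul1r divff ?expf_neq0.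
  by rewrite !exprD; field; rewrite !expf_neq0.
transitivity (s * r ^+ (k + m) / (r ^+ l * r ^+ m)).
  by rewrite !exprD; field; rewrite !expf_neq0.
by rewrite h !exprD; field; rewrite !expf_neq0.
Qed.

Lemma dual_pair_ac : dual_pair q (a * c / t) e1 (npm <= npp)%N.
Proof.
have := @dual_pair_pow (am.*2 + 2 + (bm.*2 + 1)) (am + ap + bm + bp + 2) 1
  (absdiff npp npm) 1 (npm <= npp)%N.
rewrite exprD !mul1r expr1; apply; first by rewrite expr1n.
by rewrite /absdiff /nplus; case: ifP; lia.
Qed.

(** Of a b / t and a d / t one is paired with e3 and the other with e4; which one
    depends on whether the inequalities am < bm and ap < bp agree. *)
Lemma dual_pair_ab_ad : exists al3 al4,
  [/\ (al3 = a * b / t /\ al4 = a * d / t) \/ (al4 = a * b / t /\ al3 = a * d / t),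
      dual_pair q al3 e3 ((nmm <= nmp)%N (+) (am < bm)%N) &
      dual_pair q al4 e4 (am < bm)%N].
Proof.
have P3 k f : (if f then k + absdiff nmp nmm = am + ap + bm + bp + 2 + 1
      else k + 1 = am + ap + bm + bp + 2 + absdiff nmp nmm + 2)%N ->
    dual_pair q (- r ^+ k / t) e3 f.
  move=> h; have := @dual_pair_pow k (am + ap + bm + bp + 2) 1 (absdiff nmp nmm) (-1) f.
  by rewrite !mulN1r expr1; apply => //; rewrite sqrrN expr1n.
have P4 k f : (if f then k + (nmp + nmm) = am + ap + bm + bp + 2 + 0
      else k + 0 = am + ap + bm + bp + 2 + (nmp + nmm) + 2)%N ->
    dual_pair q (- r ^+ k / t) e4 f.
  move=> h; have := @dual_pair_pow k (am + ap + bm + bp + 2) 0 (nmp + nmm) (-1) f.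
  by rewrite !mulN1r expr0 divr1; apply => //; rewrite sqrrN expr1n.
have abE : a * b = - r ^+ (am.*2 + 2 + (ap.*2 + 2)) by rewrite mulrN -exprD.
have adE : a * d = - r ^+ (am.*2 + 2 + (bp.*2 + 1)) by rewrite mulrN -exprD.
have lo u v : (u < v)%N -> nminus u v = (v - u - 1)%N by move=> h; rewrite /nminus leqNgt h.
have hi u v : (v <= u)%N -> nminus u v = (u - v)%N by move=> h; rewrite /nminus h.
rewrite abE adE; have [hm|hm] := ltnP am bm; have [hp|hp] := ltnP ap bp;
  [have hm' := lo _ _ hm|have hm' := lo _ _ hm|have hm' := hi _ _ hm|have hm' := hi _ _ hm];
  [have hp' := lo _ _ hp|have hp' := hi _ _ hp|have hp' := lo _ _ hp|have hp' := hi _ _ hp].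
- exists (- r ^+ (am.*2 + 2 + (bp.*2 + 1)) / t), (- r ^+ (am.*2 + 2 + (ap.*2 + 2)) / t).
  split; [by right | apply: P3 | apply: P4]; rewrite /absdiff hm' hp' ?addbT ?addbF; try case: ifP; lia.
- exists (- r ^+ (am.*2 + 2 + (ap.*2 + 2)) / t), (- r ^+ (am.*2 + 2 + (bp.*2 + 1)) / t).
  split; [by left | apply: P3 | apply: P4]; rewrite /absdiff hm' hp' ?addbT ?addbF; try case: ifP; lia.
- exists (- r ^+ (am.*2 + 2 + (ap.*2 + 2)) / t), (- r ^+ (am.*2 + 2 + (bp.*2 + 1)) / t).
  split; [by left | apply: P3 | apply: P4]; rewrite /absdiff hm' hp' ?addbT ?addbF; try case: ifP; lia.
- exists (- r ^+ (am.*2 + 2 + (bp.*2 + 1)) / t), (- r ^+ (am.*2 + 2 + (ap.*2 + 2)) / t).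
  split; [by right | apply: P3 | apply: P4]; rewrite /absdiff hm' hp' ?addbT ?addbF; try case: ifP; lia.
Qed.

Let q0 : q != 0. Proof. by rewrite expf_neq0. Qed.
Lemma e1_neq0 : e1 != 0. Proof. by rewrite mulf_neq0 ?invr_eq0 ?expf_neq0. Qed.
Lemma e2_neq0 : e2 != 0. Proof. by rewrite expf_neq0. Qed.
Lemma e3_neq0 : e3 != 0. Proof. by rewrite oppr_eq0 mulf_neq0 ?invr_eq0 ?expf_neq0. Qed.
Lemma e4_neq0 : e4 != 0. Proof. by rewrite oppr_eq0 expf_neq0. Qed.

Lemma dualPsi_nodes x : dualPsi q a b c d t x =
  (numU' e1 e2 e3 e4).[x] * (numU e1 e2 e3 e4).[q * x]
  / ((1 - x ^+ 2) * (1 - q * x ^+ 2) ^+ 2 * (1 - q ^+ 2 * x ^+ 2)).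
Proof.
rewrite /dualPsi; congr (_ / _).
have h2 := dual_pair_theta x q0 e2_neq0 dual_pair_t.
have h1 := dual_pair_theta x q0 e1_neq0 dual_pair_ac.
have [al3 [al4 [E /(dual_pair_theta x q0 e3_neq0) h3 /(dual_pair_theta x q0 e4_neq0) h4]]] := dual_pair_ab_ad.
rewrite (numUE e1) (numU'E e1).
transitivity ((1 - t * x) * (1 - q * x / t) * ((1 - a * c / t * x) * (1 - q * x / (a * c / t)))
  * ((1 - al3 * x) * (1 - q * x / al3)) * ((1 - al4 * x) * (1 - q * x / al4))).
  by case: E => -[-> ->]; ring.
by rewrite h1 h2 h3 h4; ring.
Qed.

(** The factors of dualV_root agree with those of numU up to monomials, and the
    product of these monomials is a sign times a power of r. *)
Lemma dualV_nodes e : e ^+ 2 = 1 ->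
  e * r * (dualV1 a b c d t * (1 + q) + dualV2 q a b c d * (e * r))
  = - (label_parity npp npm nmp nmm e * r ^- label_size npp npm nmp nmm * (1 + q)
       * (numU e1 e2 e3 e4).[e * r]).
Proof.
move=> he.
have hw : (e * r) ^+ 2 = q by rewrite exprMn he mul1r.
have h2 := dual_pair_root q0 e2_neq0 dual_pair_t hw.
have h1 := dual_pair_root q0 e1_neq0 dual_pair_ac hw.
have [al3 [al4 [E p3 p4]]] := dual_pair_ab_ad.
have h3 := dual_pair_root q0 e3_neq0 p3 hw.
have h4 := dual_pair_root q0 e4_neq0 p4 hw.
rewrite (dualV_root q0) ?oppr_eq0 ?expf_neq0 ?params_product // (numUE e1).
transitivity (- ((1 + q) * (q / a) * ((1 - t * (e * r) / q) * (1 - a * c / t * (e * r) / q)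
   * (1 - al3 * (e * r) / q) * (1 - al4 * (e * r) / q)))).
  by case: E => -[-> ->]; ring.
rewrite h1 h2 h3 h4 mul1r.
suff H : q / a * ((if (npm <= npp)%N then - (e * r) / (q * e1) else 1)
   * (if (nmm <= nmp)%N (+) (am < bm)%N then - (e * r) / (q * e3) else 1)
   * (if (am < bm)%N then - (e * r) / (q * e4) else 1))
   = label_parity npp npm nmp nmm e * r ^- label_size npp npm nmp nmm.
  rewrite -H; move: (if (npm <= npp)%N then _ else _) (if _ (+) _ then _ else _) (if (am < bm)%N then _ else _).
  by move: (q / a) => qa u1 u2 u3; ring.
have k1 : - (e * r) / (q * e1) = - e / r ^+ absdiff npp npm by field; rewrite !expf_neq0.
have k3 : - (e * r) / (q * e3) = e / r ^+ absdiff nmp nmm by field; rewrite !expf_neq0.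
have k4 : - (e * r) / (q * e4) = e / r ^+ (nmp + nmm + 1).
  by rewrite (exprD _ _ 1) expr1; field; rewrite r0 expf_neq0.
rewrite k1 k3 k4 label_sizeE.
have -> : q / a = r ^- am.*2 by rewrite exprD invfM mulrCA divff ?mulr1.
have pw (k1' k2' k3' k4' n : nat) (s1 s2 s3 : F) : (k1' + k2' + k3' + k4' = n)%N ->
   r ^- k1' * (s1 / r ^+ k2' * (s2 / r ^+ k3') * (s3 / r ^+ k4')) = s1 * s2 * s3 * r ^- n.
  by move=> <-; rewrite !exprD; field; rewrite !expf_neq0.
have ifE (f : bool) s k : (if f then s / r ^+ k else 1) = (if f then s else 1) / r ^+ (f * k).
  by case: f; rewrite ?mul1n ?mul0n ?expr0 ?divr1.
rewrite !ifE (pw _ _ _ _ (maxn npp npm + maxn nmp nmm)%N); last first.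
  by rewrite /absdiff /nplus /nminus; case: (ltnP am bm) => ?; case: (leqP bp ap) => ?;
    case: (leqP (am + bm) (ap + bp)) => ?;
    rewrite ?addbT ?addbF ?mul1n ?mul0n; try case: leqP => ?; rewrite ?mul1n ?mul0n; lia.
congr (_ * _); rewrite /label_parity /block_parity.
have [->|->] : e = 1 \/ e = -1.
  by move/eqP: he; rewrite sqrf_eq1 => /orP [] /eqP; [left | right].
  by rewrite eqxx; case: ifP => _; do 2 case: ifP => _; rewrite ?mulr1.
rewrite [-1 == 1]eq_sym one_eqN1F opprK; case: ifP => _; case: (nmm <= nmp)%N; case: ltnP => _;
  by rewrite ?mulr1 ?mul1r ?mulrNN ?mulr1.
Qed.
End SpecialParams.

(** * Limits along a filter *)

Section FilterLimits.
Variables (R : realType) (T : Type) (G : set_system T).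
Context {FG : Filter G}.
Local Notation C := (Cplx R).

Lemma cvgC_fsum (I : Type) (s : seq I) (f : I -> T -> C) (l : I -> C) :
  (forall i, f i @ G --> l i) -> (fun x => \sum_(i <- s) f i x) @ G --> \sum_(i <- s) l i.
Proof.
move=> h; elim: s => [|i s IH].
  by rewrite big_nil; apply: cvgC_ext (cvg_cst (0 : C)) => x; rewrite big_nil.
by rewrite big_cons; apply: cvgC_ext (cvgD (h i) IH) => x; rewrite big_cons.
Qed.

Lemma cvgC_fprod (I : Type) (s : seq I) (P : pred I) (f : I -> T -> C) (l : I -> C) :
  (forall i, f i @ G --> l i) ->
  (fun x => \prod_(i <- s | P i) f i x) @ G --> \prod_(i <- s | P i) l i.
Proof.
move=> h; elim: s => [|i s IH].
  by rewrite big_nil; apply: cvgC_ext (cvg_cst (1 : C)) => x; rewrite big_nil.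
rewrite big_cons; case: ifP => Pi.
  by apply: cvgC_ext (cvgM (h i) IH) => x; rewrite big_cons Pi.
by apply: cvgC_ext IH => x; rewrite big_cons Pi.
Qed.

Lemma cvgC_fexp (f : T -> C) (l : C) n : f @ G --> l -> (fun x => f x ^+ n) @ G --> l ^+ n.
Proof.
move=> h; elim: n => [|n IH]; first by rewrite expr0; apply: cvgC_ext (cvg_cst (1 : C)) => x; rewrite expr0.
by rewrite exprS; apply: cvgC_ext (cvgM h IH) => x; rewrite exprS.
Qed.

Lemma cvgC_det n (M : T -> 'M[C]_n) (L : 'M[C]_n) :
  (forall i j, (fun x => M x i j) @ G --> L i j) -> (fun x => \det (M x)) @ G --> \det L.
Proof.
move=> h; apply: (@cvgC_fsum _ _ (fun (s : 'S_n) x => (-1) ^+ s * \prod_i M x i (s i))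
  (fun s : 'S_n => (-1) ^+ s * \prod_i L i (s i))) => s.
apply: (cvgM (cvg_cst _)).
exact: (@cvgC_fprod _ _ xpredT (fun i x => M x i (s i)) (fun i => L i (s i))).
Qed.

Lemma cvgC_near_neq0 (u : T -> C) (l : C) : u @ G --> l -> l != 0 -> \forall x \near G, u x != 0.
Proof.
move=> /cvgCP h; rewrite -modulus_gt0 => /h; apply: filterS => x.
by apply: contraTneq => ->; rewrite sub0r modulusN ltxx.
Qed.

Lemma cvgC_Re (u : T -> C) (l : C) : u @ G --> l -> (fun x => complex.Re (u x)) @ G --> complex.Re l.
Proof.
move=> /cvgCP h; apply/cvgrPdist_lt => e e0; apply: filterS (h e e0) => x hx.
by rewrite distrC; apply: le_lt_trans hx; rewrite -raddfB Re_le_modulus.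
Qed.

Lemma cvgC_Im (u : T -> C) (l : C) : u @ G --> l -> (fun x => complex.Im (u x)) @ G --> complex.Im l.
Proof.
move=> /cvgCP h; apply/cvgrPdist_lt => e e0; apply: filterS (h e e0) => x hx.
by rewrite distrC; apply: le_lt_trans hx; rewrite -raddfB Im_le_modulus.
Qed.

Lemma cvgC_ReIm (f g : T -> R) (a b : R) : f @ G --> a -> g @ G --> b ->
  (fun x => (f x +i* g x : C)) @ G --> (a +i* b : C).
Proof.
move=> /cvgrPdist_lt hf /cvgrPdist_lt hg; apply/cvgCP => e e0.
have e20 : 0 < e / 2 by rewrite divr_gt0.
apply: filterS2 (hf _ e20) (hg _ e20) => x h1 h2.
rewrite modulus_dist; apply: le_lt_trans (modulus_le_ReIm _) _.
by rewrite [ltRHS]splitr; apply: ltrD.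
Qed.

Lemma cvgC_cexp (u : T -> C) (l : C) : u @ G --> l -> (fun x => cexp (u x)) @ G --> cexp l.
Proof.
move=> h; have hr := cvgC_Re h; have hi := cvgC_Im h.
have he : (fun x => expR (complex.Re (u x))) @ G --> expR (complex.Re l).
  exact: (cvg_comp _ _ hr (@continuous_expR R _)).
have hc : (fun x => cos (complex.Im (u x))) @ G --> cos (complex.Im l).
  exact: (cvg_comp _ _ hi (@continuous_cos R _)).
have hs : (fun x => sin (complex.Im (u x))) @ G --> sin (complex.Im l).
  exact: (cvg_comp _ _ hi (@continuous_sin R _)).
exact: (cvgM (cvgC_ReIm he (cvg_cst 0)) (cvgC_ReIm hc hs)).
Qed.

Lemma cvgC_qpow (q : R) (u : T -> C) (l : C) : u @ G --> l -> (fun x => qpow q (u x)) @ G --> qpow q l.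
Proof. by move=> h; apply: cvgC_cexp; exact: (cvgM h (cvg_cst _)). Qed.

End FilterLimits.

(** * The identity at generic complex points *)

Section Ratio.
Variables (R : realType) (q : R).
Hypotheses (q0 : 0 < q) (q1 : q < 1).
Local Notation C := (Cplx R).
Local Notation r := (Num.sqrt q).
Local Notation rC := (r%:C : C).

Lemma sqrtqC_neq0 : rC != 0. Proof. exact: (qC_neq0 (sqrtq_gt0 q0)). Qed.
Lemma sqrtqC_sqr : rC ^+ 2 = q%:C. Proof. by rewrite -rmorphXn /= sqrtq_sqr. Qed.

Section AnyLabels.
Variables (npp npm nmp nmm : nat).
Local Notation N := (label_size npp npm nmp nmm).

Lemma modulus_label_mu (t : 'I_N) : modulus (label_mu rC t) = r ^+ label_node t.
Proof.
rewrite modulusM modulusX modulus_real ger0_norm ?sqrtr_ge0 // /label_sign.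
by case: fintype.split => _; rewrite ?modulusN modulus1 mul1r.
Qed.

Lemma modulus_label_mu_le (t : 'I_N) : modulus (label_mu rC t) <= r.
Proof.
rewrite modulus_label_mu; case: (label_node t) (label_node_gt0 t) => // n _.
by rewrite exprS ler_piMr ?sqrtr_ge0 // exprn_ile1 ?sqrtr_ge0 // ltW // sqrtq_lt1.
Qed.

Lemma modulus_label_mu_mul (t : 'I_N) (w : C) : modulus (rC * w) < 1 ->
  modulus (label_mu rC t * w) < 1.
Proof.
apply: le_lt_trans; rewrite (modulusM (label_mu _ _)) (modulusM rC) ler_wpM2r ?modulus_ge0 //.
by rewrite [leRHS]modulus_real ger0_norm ?sqrtr_ge0 // modulus_label_mu_le.
Qed.

Lemma label_mu_prod_neq1 (t u : 'I_N) : 1 - label_mu rC t * label_mu rC u != 0.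
Proof.
apply: one_sub_neq0; rewrite modulusM; apply: le_lt_trans (ler_pM (modulus_ge0 _)
  (modulus_ge0 _) (modulus_label_mu_le t) (modulus_label_mu_le u)) _.
by rewrite -expr2 sqrtq_sqr.
Qed.

Definition tau_mx (z : C) : 'M[C]_N := baker_mx (label_mu rC : 'I_N -> C) (label_coef rC z).

Definition soliton_mx (z w : C) : 'M[C]_N :=
  1%:M + diag_mx (\row_t ((1 - w / label_mu rC t) / (1 - label_mu rC t * w)))
    *m diag_mx (\row_t label_coef rC z t) *m cauchy_mx (label_mu rC : 'I_N -> C).

End AnyLabels.

Variables ap am bp bm : nat.
Local Notation npp := (nplus ap bp).
Local Notation npm := (nplus am bm).
Local Notation nmp := (nminus ap bp).
Local Notation nmm := (nminus am bm).
Local Notation N := (label_size npp npm nmp nmm).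
Local Notation a := (q ^+ am.+1).
Local Notation b := (- q ^+ ap.+1).
Local Notation c := (q `^ (bm%:R + 1 / 2)).
Local Notation d := (- q `^ (bp%:R + 1 / 2)).

Lemma powq_nat n : q ^+ n.+1 = r ^+ (n.*2 + 2).
Proof. by rewrite -{1}(sqrtq_sqr q0) -exprM; congr (_ ^+ _); lia. Qed.

Lemma powq_half n : q `^ (n%:R + 1 / 2) = r ^+ (n.*2 + 1).
Proof.
by rewrite -(powR_half q0) natrD -muln2 natrM mulrDl mulfK ?pnatr_eq0.
Qed.

Lemma hata_pow : hata q a b c d = r ^+ (am + ap + bm + bp + 2).
Proof.
have r0 : r != 0 by rewrite gt_eqF // sqrtq_gt0.
rewrite /hata !powq_nat !powq_half.
have -> : q^-1 * (r ^+ (am.*2 + 2) * - r ^+ (ap.*2 + 2) * r ^+ (bm.*2 + 1) * - r ^+ (bp.*2 + 1))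
   = (r ^+ (am + ap + bm + bp + 2)) ^+ 2.
  by rewrite -(params_product ap am bp bm r0) (sqrtq_sqr q0) mulrC mulfK // gt_eqF.
by rewrite sqrtr_sqr ger0_norm // exprn_ge0 // sqrtr_ge0.
Qed.

(** The bound on r w keeps the orbit w q^n off the poles 1 / mu_t. *)
Theorem AWred_eq_det z w : z != 0 -> w != 0 ->
  AWgen q (a%:C : C) b%:C c%:C d%:C (hata q a b c d)%:C z w ->
  modulus (rC * w) < 1 -> \det (tau_mx npp npm nmp nmm z) != 0 ->
  AWred q (a%:C : C) b%:C c%:C d%:C (hata q a b c d)%:C z w
  = \det (soliton_mx npp npm nmp nmm z w) / \det (tau_mx npp npm nmp nmm z).
Proof.
move=> z0 w0; rewrite hata_pow !powq_nat !powq_half !rmorphN !rmorphXn => hg hw hM.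
have r0 := sqrtqC_neq0; have hr := sqrtqC_sqr.
have hmu (t : 'I_N) := modulus_label_mu_mul t hw.
have uM : tau_mx npp npm nmp nmm z \in unitmx by rewrite unitmxE unitfE.
have mu0 (t : 'I_N) : label_mu rC t != 0.
  by rewrite -modulus_gt0 modulus_label_mu exprn_gt0 // sqrtq_gt0.
have mu1w (t : 'I_N) : 1 - label_mu rC t * w != 0 by apply: one_sub_neq0; exact: hmu.
rewrite [X in _ = X / _](det_baker mu0 (@label_mu_prod_neq1 _ _ _ _) uM mu1w) mulrAC divff ?mul1r //.
have pw n : rC ^+ n != 0 by rewrite expf_neq0.
have pn n : - rC ^+ n != 0 by rewrite oppr_eq0.
apply: (@AWred_eq_baker R q q0 q1 _ _ _ _ _ (pw _) (pn _) (pw _) (pn _) (pw _) _ N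
  (label_mu rC) (label_coef rC z) z w z0 w0 hg hmu
  (label_sign C) (@label_node _ _ _ _) (@label_parity npp npm nmp nmm C) rC
  (rC ^+ absdiff npp npm / rC) (rC ^+ (npp + npm)) (- (rC ^+ absdiff nmp nmm / rC)) (- rC ^+ (nmp + nmm))).
- by rewrite -hr; exact: params_product.
- by apply: e1_neq0.
- by [].
- by apply: e3_neq0.
- by [].
- by rewrite -hr; apply: nodes_product.
- exact: hr.
- by move=> i; exact: label_sign_sqr.
- exact: label_node_gt0.
- exact: label_inj.
- by move=> i; exact: label_closed.
- exact: label_parity_sqr.
- by [].
- by move=> x; rewrite -hr numUE; exact: label_telescope.
- by move=> e he; rewrite -hr; exact: dualV_nodes.
- by move=> x; rewrite -hr; exact: dualPsi_nodes.
- exact: label_mu_prod_neq1.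
- by [].
- exact: uM.
Qed.

End Ratio.

(** * Generic points accumulate at the given point *)

Section Density.
Variables (R : realType) (q : R).
Hypotheses (q0 : 0 < q) (q1 : q < 1).
Local Notation C := (Cplx R).

(** The zeros of the sine are isolated. *)
Lemma sin_right_neq0 (th k : R) : k != 0 -> \forall s \near 0^'+, sin (th + s * k) != 0.
Proof.
move=> k0; have [e|ne] := eqVneq (sin th) 0; last first.
  have hc : (fun s : R => sin (th + s * k)) @ 0^'+ --> sin th.
    apply: cvg_at_right_filter.
    have h : (fun s : R => th + s * k) @ 0 --> th.
      have := cvgD (cvg_cst th) (cvgM (cvg_id (F := nbhs (0 : R))) (cvg_cst k)).
      by rewrite mul0r addr0; apply.
    exact: (cvg_comp _ _ h (@continuous_sin R _)).
  move/cvgrPdist_lt: hc => /(_ `|sin th|); rewrite normr_gt0 => /(_ ne).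
  by apply: filterS => s; apply: contraTneq => ->; rewrite subr0 ltxx.
have c0 : cos th != 0.
  by apply/eqP => c0; have := cos2Dsin2 th; rewrite c0 e expr0n /= addr0 => /eqP; rewrite eq_sym oner_eq0.
have hs (y : R) : 0 < `|y| < pi -> sin y != 0.
  have [y0|y0] := leP 0 y; first by rewrite ger0_norm // => /sin_gt0_pi /gt_eqF ->.
  by rewrite ltr0_norm // => /sin_gt0_pi; rewrite sinN oppr_gt0 => /lt_eqF ->.
have b0 : 0 < pi / `|k| :> R by rewrite divr_gt0 ?pi_gt0 ?normr_gt0.
near=> s.
have s0 : 0 < s by near: s; exact: nbhs_right_gt.
have sb : s < pi / `|k| by near: s; exact: nbhs_right_lt.
rewrite sinD e mul0r add0r mulf_neq0 // hs // normrM (gtr0_norm s0).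
by rewrite mulr_gt0 ?normr_gt0 //= -ltr_pdivlMr ?normr_gt0.
Unshelve. all: by end_near.
Qed.

(** For small s > 0 the number 2 (x + s) is not an integer, since it lies strictly
    between 2 x and the next integer above 2 x. *)
Lemma powR_right_neq1 (x : R) : \forall s \near 0^'+,
  forall n, q `^ (x + s) ^+ 2 * q ^+ n != 1.
Proof.
pose k := Num.floor (2 * x).
have hk : 0 < ((k + 1)%:~R - 2 * x) / 2 :> R by rewrite divr_gt0 ?subr_gt0 ?floorD1_gt.
near=> s.
have s0 : 0 < s by near: s; exact: nbhs_right_gt.
have sb : s < ((k + 1)%:~R - 2 * x) / 2 by near: s; exact: nbhs_right_lt.
move=> n; rewrite -!powR_mulrn ?(ltW q0) ?powR_ge0 // -powRrM -powRD ?(gt_eqF q0) ?implybT //.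
rewrite /powR (gt_eqF q0) -[X in _ != X]expR0 (inj_eq (@expR_inj R)) mulf_eq0 negb_or.
rewrite (lt_eqF (_ : ln q < 0)) ?ln_lt0 ?q0 // andbT.
apply/eqP => e.
have h1 : (k%:~R : R) <= 2 * x by rewrite floor_le.
have h2 : (k%:~R : R) < (- n%:Z)%:~R.
  have -> : ((- n%:Z)%:~R : R) = (x + s) * 2 by rewrite mulrNz -[n%:~R]/(n%:R : R); lra.
  lra.
have h3 : ((- n%:Z)%:~R : R) < (k + 1)%:~R.
  have -> : ((- n%:Z)%:~R : R) = (x + s) * 2 by rewrite mulrNz -[n%:~R]/(n%:R : R); lra.
  lra.
by move: h2 h3; rewrite !ltr_int; lia.
Unshelve. all: by end_near.
Qed.

Lemma nonreal_neq1 (K : R) (w : C) : complex.Im w != 0 -> 1 - K%:C * w != 0.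
Proof.
case: w => u v /= v0; apply/eqP => e.
have e' : (K%:C * (u +i* v) : C) = 1 by apply/esym/eqP; rewrite -subr_eq0; apply/eqP.
case: e' => e1; rewrite mul0r addr0 => /eqP; rewrite mulf_eq0 (negbTE v0) orbF => /eqP K0.
by move: e1; rewrite K0 !mul0r subr0 => /eqP; rewrite eq_sym oner_eq0.
Qed.

(** Generic points near (x, xh) are found with z real and with zh on the unit
    circle but not real. Then each u in the list is a real multiple of zh,
    hence 0 or not real, or has modulus q, or is q z^2, which avoids the powers of
    q for a suitable z. *)
Lemma AW_punctured_proper (a b c d x : R) (xh : R[i]) :
  hata q a b c d < 1 -> complex.Re xh = 0 ->
  ProperFilter (AW_punctured q a b c d (x%:C, xh)).
Proof.
move=> ha hxh; apply: within_nbhs_proper.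
(* Both coordinates move: the first along the real axis, the second along the
   imaginary axis. *)
pose f (s : R) : C * C := ((x + s)%:C, (0 +i* (complex.Im xh + s))).
have hf : f @ 0^'+ --> ((x%:C, xh) : C * C).
  have hid : (fun s : R => s) @ 0^'+ --> (0 : R).
    by apply: cvg_at_right_filter; exact: cvg_id.
  have hadd (y : R) : (fun s : R => y + s) @ 0^'+ --> y.
    by rewrite -[X in _ --> X]addr0; exact: (cvgD (cvg_cst y) hid).
  have h1 : (fun s : R => ((x + s) +i* 0 : C)) @ 0^'+ --> (x +i* 0 : C).
    exact: (cvgC_ReIm (hadd x) (cvg_cst 0)).
  have h2 : (fun s : R => (0 +i* (complex.Im xh + s) : C)) @ 0^'+ --> (0 +i* complex.Im xh : C).
    exact: (cvgC_ReIm (cvg_cst 0) (hadd _)).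
  rewrite [X in (_, X)](_ : xh = 0 +i* complex.Im xh); last by case: (xh) hxh => u v /= ->.
  exact: (cvg_pair h1 h2).
have ln0 : ln q != 0 by rewrite lt_eqF // ln_lt0 // q0.
have hsin := sin_right_neq0 (complex.Im xh * ln q) ln0.
have hpow := powR_right_neq1 x.
move=> B /hf hB.
have [s [[sin0 pow1] Bs]] := filter_ex (filterI (filterI hsin hpow) hB).
exists (f s); split => //.
have zE : qpow q (f s).1 = (q `^ (x + s))%:C by exact: qpow_real.
have imw : complex.Im (qpow q (f s).2) != 0.
  rewrite /qpow /cexp /= !mul0r !mulr0 !addr0 subrr expR0 mul1r.
  by rewrite add0r mulrDl.
have modw : modulus (qpow q (f s).2) = 1 by rewrite modulus_qpow //= powRr0.
rewrite /AW_generic /= zE; move: (qpow q (f s).2) imw modw => w imw modw.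
set Z := q `^ (x + s); set h := hata q a b c d.
split.
  rewrite modulusE -[1]/(1%:C) ltcR modulusM modw mulr1 modulus_real ger0_norm //.
  by rewrite sqrtr_ge0.
move=> u n.
have real_w (K : R) : u = K%:C * w -> 1 - u * q%:C ^+ n != 0.
  move=> ->; have -> : K%:C * w * q%:C ^+ n = (K * q ^+ n)%:C * w.
    by rewrite rmorphM rmorphXn mulrAC.
  exact: nonreal_neq1.
rewrite !inE => /or3P[/eqP hu|/eqP hu|/or3P[/eqP hu|/eqP hu|/or3P[/eqP hu|/eqP hu|/eqP hu]]].
- apply: (real_w (q * Z ^+ 2 / h)); rewrite hu !rmorphM fmorphV; ring.
- rewrite hu; apply: one_sub_neq0.
  rewrite !modulusM !modulusX modw !modulus_real (gtr0_norm q0) !mulr1 -exprS.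
  by rewrite exprn_ilt1 // ltW.
- apply: (real_w (q * a * Z / h)); rewrite hu !rmorphM fmorphV; ring.
- apply: (real_w (q * b * Z / h)); rewrite hu !rmorphM fmorphV; ring.
- apply: (real_w (q * c * Z / h)); rewrite hu !rmorphM fmorphV; ring.
- apply: (real_w (q * d * Z / h)); rewrite hu !rmorphM fmorphV; ring.
- rewrite hu subr_eq0 eq_sym; apply/negP => /eqP /(congr1 (@complex.Re R)).
  have -> : q%:C * Z%:C ^+ 2 * q%:C ^+ n = (Z ^+ 2 * q ^+ n.+1)%:C.
    by rewrite -!rmorphXn -!rmorphM [q ^+ n.+1]exprS; congr (_%:C); ring.
  by apply/eqP; exact: pow1.
Qed.

End Density.

(** * Passage to the limit *)

Lemma cvgC_ext_lim (R : realType) (T : Type) (G : set_system T) (u v : T -> Cplx R) (l k : Cplx R) :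
  (forall x, u x = v x) -> l = k -> u @ G --> l -> v @ G --> k.
Proof. by move=> e <-; exact: cvgC_ext. Qed.

Section Soliton.
Variables (R : realType) (q : R).
Hypotheses (q0 : 0 < q) (q1 : q < 1).
Variables (npp npm nmp nmm : nat).
Local Notation C := (Cplx R).
Local Notation N := (label_size npp npm nmp nmm).
Local Notation r := (Num.sqrt q).
Local Notation rC := (r%:C : C).

Lemma map_coef_diag (x : R) :
  map_mx (real_complex R) (Bmx q npp npm nmp nmm x)
  = diag_mx (\row_t label_coef rC (qpow q x%:C) t).
Proof.
rewrite BmxE // qpow_real //; apply/matrixP => i j; rewrite !mxE.
by rewrite rmorphMn; congr (_ *+ _); exact: label_coef_rmorph.
Qed.

Lemma map_cauchy :
  map_mx (real_complex R) (Cmx q npp npm nmp nmm) = cauchy_mx (label_mu rC : 'I_N -> C).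
Proof.
rewrite CmxE //; apply/matrixP => i j; rewrite !mxE fmorphV rmorphB rmorph1 rmorphM.
by rewrite !label_mu_rmorph.
Qed.

Lemma det_tau_real (x : R) :
  \det (tau_mx q npp npm nmp nmm (qpow q x%:C))
  = (\det (1%:M + Bmx q npp npm nmp nmm x *m Cmx q npp npm nmp nmm))%:C.
Proof.
by rewrite -[RHS]det_map_mx map_mxD map_mx1 map_mxM map_coef_diag map_cauchy.
Qed.

Lemma det_soliton_real (x : R) (xh : R[i]) :
  \det (soliton_mx q npp npm nmp nmm (qpow q x%:C) (qpow q xh))
  = \det (1%:M + Amx q npp npm nmp nmm xh *m map_mx (real_complex R) (Bmx q npp npm nmp nmm x)
       *m map_mx (real_complex R) (Cmx q npp npm nmp nmm)).
Proof. by rewrite map_coef_diag map_cauchy (AmxE _ _ _ _ q0). Qed.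

Variables (T : Type) (G : set_system T).
Context {FG : Filter G}.

Lemma cvg_label_coef (f : T -> C) (z : C) (t : 'I_N) : f @ G --> z ->
  (fun x => label_coef rC (f x) t) @ G --> label_coef rC z t.
Proof.
move=> h; rewrite /label_coef.
have h1 : (fun x => label_parity npp npm nmp nmm (label_sign C t) * (rC * f x)) @ G
   --> label_parity npp npm nmp nmm (label_sign C t) * (rC * z).
  exact: (cvgM (cvg_cst _) (cvgM (cvg_cst rC) h)).
have h2 := @cvgC_fexp _ _ _ FG _ _ (label_node t) h1.
move: (\prod_(u | u != t) _) (1 - _ ^+ 2) (label_sign C t ^+ N.+1) => p1 p2 p3.
exact: (cvgN (cvgM (cvgM (cvgM (cvg_cst p3) h2) (cvg_cst p2)) (cvg_cst p1))).
Qed.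

Lemma cvg_det_tau (f : T -> C) (z : C) : f @ G --> z ->
  (fun x => \det (tau_mx q npp npm nmp nmm (f x))) @ G --> \det (tau_mx q npp npm nmp nmm z).
Proof.
move=> hf; apply: cvgC_det => i j.
pose h (y : C) : C := (i == j)%:R + label_coef rC y i * cauchy_mx (label_mu rC : 'I_N -> C) i j.
have e (y : C) : h y = tau_mx q npp npm nmp nmm y i j.
  by rewrite /h /tau_mx /baker_mx mul_diag_mx !mxE.
have ch : (fun x => h (f x)) @ G --> h z.
  have cl := @cvg_label_coef f z i hf.
  exact: (cvgD (cvg_cst _) (cvgM cl (cvg_cst _))).
exact: (@cvgC_ext_lim _ _ _ _ _ _ _ (fun x => e (f x)) (e z) ch).
Qed.

Lemma cvg_det_soliton (f g : T -> C) (z w : C) : f @ G --> z -> g @ G --> w ->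
  modulus (rC * w) < 1 ->
  (fun x => \det (soliton_mx q npp npm nmp nmm (f x) (g x))) @ G
    --> \det (soliton_mx q npp npm nmp nmm z w).
Proof.
move=> hf hg hw; apply: cvgC_det => i j.
pose h (y v : C) : C := (i == j)%:R + (1 - v / label_mu rC i) / (1 - label_mu rC i * v)
    * (label_coef rC y i * cauchy_mx (label_mu rC : 'I_N -> C) i j).
have e (y v : C) : h y v = soliton_mx q npp npm nmp nmm y v i j.
  by rewrite /h /soliton_mx -mulmxA !mul_diag_mx !mxE.
have mu1w : 1 - label_mu rC i * w != 0.
  by apply: one_sub_neq0; exact: modulus_label_mu_mul.
have c1 : (fun x => 1 - g x / label_mu rC i) @ G --> 1 - w / label_mu rC i.
  exact: (cvgB (cvg_cst _) (cvgM hg (cvg_cst _))).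
have c2 : (fun x => 1 - label_mu rC i * g x) @ G --> 1 - label_mu rC i * w.
  exact: (cvgB (cvg_cst _) (cvgM (cvg_cst _) hg)).
have ch : (fun x => h (f x) (g x)) @ G --> h z w.
  exact: (cvgD (cvg_cst _) (cvgM (cvgM c1 (cvgV mu1w c2))
    (cvgM (@cvg_label_coef f z i hf) (cvg_cst (cauchy_mx (label_mu rC : 'I_N -> C) i j))))).
exact: (@cvgC_ext_lim _ _ _ _ _ _ _ (fun x => e (f x) (g x)) (e z w) ch).
Qed.

End Soliton.

Lemma AW_W87_AWred (R : realType) (q a b c d : R) (p : Cplx R * Cplx R) :
  AW_W87 q a b c d p = qpow q (p.1 * p.2)
    * AWred q a%:C b%:C c%:C d%:C (hata q a b c d)%:C (qpow q p.1) (qpow q p.2).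
Proof. by rewrite /AW_W87 -mulrA. Qed.

Lemma AW_generic_AWgen (R : realType) (q a b c d : R) (p : Cplx R * Cplx R) :
  AW_generic q a b c d p ->
  AWgen q a%:C b%:C c%:C d%:C (hata q a b c d)%:C (qpow q p.1) (qpow q p.2).
Proof. by case=> h1 h2; split => //; rewrite -ltcR -modulusE. Qed.

Unset Implicit Arguments.

Theorem theorem3p1 (R : realType) (q : R) (hq0 : 0 < q) (hq1 : q < 1)
  (ap am bp bm npp npm nmp nmm : nat)
  (hnpp : npp = nplus ap bp) (hnpm : npm = nplus am bm)
  (hnmp : nmp = nminus ap bp) (hnmm : nmm = nminus am bm)
  (x : R) (xh : R[i]) (hxh : complex.Re xh = 0)
  (hx : \det (1%:M + Bmx q npp npm nmp nmm x *m Cmx q npp npm nmp nmm) != 0) :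
  let A := Amx q npp npm nmp nmm xh in
  let B := Bmx q npp npm nmp nmm x in
  let C := Cmx q npp npm nmp nmm in
  let a := q ^+ am.+1 in
  let b := - q ^+ ap.+1 in
  let c := q `^ (bm%:R + 1 / 2) in
  let d := - q `^ (bp%:R + 1 / 2) in
  AW_regular q a b c d x%:C xh /\
  AWpsi q a b c d x%:C xh =
    qpow q (x%:C * xh)
    * (\det (1%:M + A *m map_mx (real_complex R) B *m map_mx (real_complex R) C)
       / (\det (1%:M + B *m C))%:C).
Proof.
move=> A B C a b c d; rewrite {}/A {}/B {}/C.
subst npp npm nmp nmm.
rewrite -det_soliton_real // -det_tau_real //.
move: hx; rewrite -(inj_eq (@complexI R)) -det_tau_real // => hx.
set npp := nplus ap bp; set npm := nplus am bm; set nmp := nminus ap bp; set nmm := nminus am bm.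
pose rhs (p : Cplx R * Cplx R) : Cplx R := qpow q (p.1 * p.2)
  * (\det (soliton_mx q npp npm nmp nmm (qpow q p.1) (qpow q p.2))
     / \det (tau_mx q npp npm nmp nmm (qpow q p.1))).
pose p0 : Cplx R * Cplx R := (x%:C, xh).
rewrite -/(rhs p0).
have c1 : (fun p : Cplx R * Cplx R => p.1) @ nbhs p0 --> p0.1 by exact: cvg_fst.
have c2 : (fun p : Cplx R * Cplx R => p.2) @ nbhs p0 --> p0.2 by exact: cvg_snd.
have q1' : (fun p : Cplx R * Cplx R => qpow q p.1) @ nbhs p0 --> qpow q p0.1.
  by apply: cvgC_qpow; exact: c1.
have q2' : (fun p : Cplx R * Cplx R => qpow q p.2) @ nbhs p0 --> qpow q p0.2.
  by apply: cvgC_qpow; exact: c2.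
have r1 : Num.sqrt q < 1 by exact: sqrtq_lt1.
have modw : modulus (qpow q xh) = 1 by rewrite modulus_qpow // hxh powRr0.
have hw : modulus ((Num.sqrt q)%:C * qpow q p0.2) < 1.
  by rewrite modulusM modw mulr1 modulus_real ger0_norm ?sqrtr_ge0.
have ctau : (fun p : Cplx R * Cplx R => \det (tau_mx q npp npm nmp nmm (qpow q p.1))) @ nbhs p0
   --> \det (tau_mx q npp npm nmp nmm (qpow q p0.1)).
  exact: (cvg_det_tau q1').
have crhs : rhs @ nbhs p0 --> rhs p0.
  have csol : (fun p : Cplx R * Cplx R => \det (soliton_mx q npp npm nmp nmm (qpow q p.1) (qpow q p.2)))
      @ nbhs p0 --> \det (soliton_mx q npp npm nmp nmm (qpow q p0.1) (qpow q p0.2)).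
    exact: (cvg_det_soliton hq1 q1' q2' hw).
  have c12 : (fun p : Cplx R * Cplx R => p.1 * p.2) @ nbhs p0 --> p0.1 * p0.2 by exact: (cvgM c1 c2).
  have cq : (fun p : Cplx R * Cplx R => qpow q (p.1 * p.2)) @ nbhs p0 --> qpow q (p0.1 * p0.2).
    by apply: cvgC_qpow; exact: c12.
  exact: (cvgM cq (cvgM csol (cvgV hx ctau))).
(* At p0 the modulus of q^xh is 1, so |r q^xh| < 1 holds nearby. *)
have hnear : \forall p \near p0, AW_generic q a b c d p -> AW_W87 q a b c d p = rhs p.
  have n1 : \forall p \near p0, \det (tau_mx q npp npm nmp nmm (qpow q p.1)) != 0.
    exact: (cvgC_near_neq0 ctau hx).
  have n2 : \forall p \near p0, modulus ((Num.sqrt q)%:C * qpow q p.2) < 1.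
    have e0 : 0 < 1 - Num.sqrt q by rewrite subr_gt0.
    move/cvgCP: q2' => /(_ _ e0); apply: filterS => p /= hp.
    have hle : modulus (qpow q p.2) <= modulus (qpow q p.2 - qpow q xh) + 1.
      by rewrite -modw -[X in modulus X <= _](subrK (qpow q xh)) modulusD.
    rewrite modulusM modulus_real ger0_norm ?sqrtr_ge0 //.
    have r0 : 0 < Num.sqrt q by rewrite sqrtr_gt0.
    nra.
  apply: filterS2 n1 n2 => p t1 t2 hg.
  rewrite AW_W87_AWred /rhs; congr (_ * _).
  exact: (AWred_eq_det hq0 hq1 (qpow_neq0 _ _) (qpow_neq0 _ _) (AW_generic_AWgen hg) t2 t1).
have ha : hata q a b c d < 1.
  rewrite hata_pow // exprn_ilt1 ?sqrtr_ge0 ?sqrtq_lt1 //; lia.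
have PF : ProperFilter (AW_punctured q a b c d p0) by exact: AW_punctured_proper.
have clim : AW_W87 q a b c d @ AW_punctured q a b c d p0 --> rhs p0.
  apply/cvgCP => e e0; move/cvgCP: crhs => /(_ _ e0) hr.
  by apply: filterS2 hr hnear => p h1 h2 hg; rewrite h2.
rewrite /AW_regular /AWpsi; case: asboolP => hg.
  by split; [left | exact: (nbhs_singleton hnear)].
split; first by right; apply/cvg_ex; exists (rhs p0).
exact: (cvg_lim (@norm_hausdorff _ _) clim).
Qed.
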